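(* Let $p>1$, $p'=\frac p{p-1}$, and let $f,g,h,d$ satisfy the standing assumptions (H1)–(H4) listed in the context, with $\kappa=d^{\frac1{p-1}}h$. Put $$\ell_p:=\liminf_{\xi\to0^+}\frac{\kappa(\xi)^{p-1}}{\xi},\qquad L_p:=\limsup_{\xi\to0^+}\frac{\kappa(\xi)^{p-1}}{\xi},$$ and let $\mathcal C$ be the set of all $c\in\mathbb R$ for which there exists a t.w.s. of speed $c$. Suppose that $g(0)>0$ and $L_p<+\infty$. If $$\inf_{\xi\in(0,1)}\frac1\xi\int_0^\xi(cg(\tau)-f(\tau))\,d\tau>p'(p-1)^{\frac1p}\left(\sup_{\xi\in(0,1)}\frac1\xi\int_0^\xi\frac{\kappa(\tau)}{\tau^{\frac1{p-1}}}\,d\tau\right)^{\frac1{p'}}$$ is satisfied for some $c\in\mathbb R$, then $\mathcal C$ is non-empty and bounded from below. Moreover, $\mathcal C$ admits a minimum $c^*$, which fulfills $$\inf_{\xi\in(0,1)}\frac1\xi\int_0^\xi(c^*g(\tau)-f(\tau))\,d\tau\le p'(p-1)^{\frac1p}\left(\sup_{\xi\in(0,1)}\frac1\xi\int_0^\xi\frac{\kappa(\tau)}{\tau^{\frac1{p-1}}}\,d\tau\right)^{\frac1{p'}}$$ and $$c^*g(0)-f(0)\ge p'(p-1)^{\frac1p}\ell_p^{\frac1p}.$$ Finally, if in addition $\int_0^\xi g(\tau)\,d\tau\ge0$ for all $\xi\in[0,1]$, then $\mathcal C=[c^*,+\infty)$.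
   Context: $\hat C[0,1]$ (resp. $\hat C(0,1)$) is the set of functions $\mu:[0,1]\to\mathbb R$ (resp. $\mu:(0,1)\to\mathbb R$) that are continuous except at a finite set $\mathcal D(\mu)\subset(0,1)$ of discontinuity points (of any type). Functions differing at finitely many points of $(0,1)$ are identified, and the coefficients are assumed to have no removable discontinuities. Standing assumptions: $p>1$ and (H1) $f,g,h\in\hat C[0,1]\cap L^\infty(0,1)$, $d\in\hat C(0,1)$; (H2) $\inf_{[a,b]}d>0$ and $\sup_{[a,b]}d<+\infty$ whenever $0<a<b<1$; (H3) $h(0)=h(1)=0$ and $\inf_{[a,b]}h>0$ whenever $0<a<b<1$; (H4) $\kappa:=d^{\frac1{p-1}}h\in L^1(0,1)$. Put $\Theta:=\mathcal D(d)\cup\mathcal D(f)\cup\mathcal D(g)\cup\mathcal D(h)$ and $\Theta^*:=\Theta\cup\{0,1\}$. For $c\in\mathbb R$, consider the problem $$(P_c)\quad (d(v)|v'|^{p-2}v')'+(cg(v)-f(v))v'+h(v)=0,\quad v\in[0,1],\quad v(-\infty)=1,\ v(+\infty)=0.$$ Definition (solution of $(P_c)$). A continuous function $v:\mathbb R\to[0,1]$ is a solution of $(P_c)$ if $v\in C^1(\mathbb R\setminus v^{-1}(\Theta^* ))$, $v(z)\to1$ as $z\to-\infty$, $v(z)\to0$ as $z\to+\infty$, and there exists a continuous function $\Phi_v:\mathbb R\to\mathbb R$ such that: (i) $\Phi_v(z)=d(v(z))|v'(z)|^{p-2}v'(z)$ in each open interval where $v$ is $C^1$ (the right-hand side being read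 as $0$ at points where $v'(z)=0$, in particular where $v(z)\in\{0,1\}$); (ii) $\lim_{z\to\pm\infty}\Phi_v(z)=0$; (iii) $\Phi_v(z)=0$ whenever $v(z)=0$ or $v(z)=1$; (iv) for all $z_1,z_2\in\mathbb R$, $$\Phi_v(z_2)-\Phi_v(z_1)+\int_{v(z_1)}^{v(z_2)}(cg(\xi)-f(\xi))\,d\xi+\int_{z_1}^{z_2}h(v(z))\,dz=0.$$ A traveling wave solution (t.w.s.) of speed $c$ (for the equation $f(u)u_x+g(u)u_t=(d(u)|u_x|^{p-2}u_x)_x+h(u)$) is a function $u(x,t)=v(x-ct)$ with $v$ a solution of $(P_c)$ in this sense. *)

(* Defs.v *)
From HB Require Import structures.
From mathcomp Require Import all_boot all_order all_algebra.
From mathcomp Require Import all_classical all_reals all_analysis.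

Set Implicit Arguments.
Unset Strict Implicit.
Unset Printing Implicit Defensive.

Import Order.TTheory GRing.Theory Num.Theory.
Import numFieldNormedType.Exports.

Local Open Scope classical_set_scope.
Local Open Scope ring_scope.

(* Functions on [0,1] or (0,1) are represented by total functions [R -> R], and
   elements of the piecewise continuous classes (where functions differing at
   finitely many points are identified) by a representative.  Values outside the
   domain are irrelevant. *)

Definition disc {R : realType} (m : R -> R) : set R :=
  [set x | 0 < x < 1 /\ ~ {for x, continuous m}].

Definition hatC_open {R : realType} (m : R -> R) : Prop :=
  finite_set (disc m).

Definition hatC_closed {R : realType} (m : R -> R) : Prop :=
  [/\ finite_set (disc m), m x @[x --> 0^'+] --> m 0
    & m x @[x --> 1^'-] --> m 1].

Definition no_removable {R : realType} (m : R -> R) : Prop :=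
  forall x, disc m x -> ~ cvg (m y @[y --> x^']).

Definition Linfty01 {R : realType} (m : R -> R) : Prop :=
  (m \_ `]0, 1[) \in Lfun (@lebesgue_measure R) +oo%E.

(* The oriented integral from [a] to [b]. *)
Definition oint {R : realType} (a b : R) (F : R -> R) : R :=
  if a <= b then \int[@lebesgue_measure R]_(x in `[a, b]) F x
  else - \int[@lebesgue_measure R]_(x in `[b, a]) F x.

Definition kappa {R : realType} (p : R) (d h : R -> R) (x : R) : R :=
  d x `^ (p - 1)^-1 * h x.

Definition ell {R : realType} (p : R) (d h : R -> R) : \bar R :=
  limf_einf (fun x => (kappa p d h x `^ (p - 1) / x)%:E) (0 : R)^'+.

Definition Ell {R : realType} (p : R) (d h : R -> R) : \bar R :=
  limf_esup (fun x => (kappa p d h x `^ (p - 1) / x)%:E) (0 : R)^'+.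

Definition inf_avg {R : realType} (f g : R -> R) (c : R) : \bar R :=
  ereal_inf [set (x^-1 * oint 0 x (fun t => c * g t - f t))%:E
            | x in `]0, 1[].

Definition sup_avg {R : realType} (p : R) (d h : R -> R) : \bar R :=
  ereal_sup [set (x^-1%:E *
      \int[@lebesgue_measure R]_(t in `]0%R, x[)
        (kappa p d h t / t `^ (p - 1)^-1)%:E)%E
    | x in `]0, 1[].

Definition conj_exp {R : realType} (p : R) : R := p / (p - 1).

Definition threshold {R : realType} (p : R) (d h : R -> R) : \bar R :=
  ((conj_exp p * (p - 1) `^ p^-1)%:E
    * sup_avg p d h `^ (conj_exp p)^-1)%E.

Definition Theta {R : realType} (f g h d : R -> R) : set R :=
  disc d `|` disc f `|` disc g `|` disc h.

Definition Theta_star {R : realType} (f g h d : R -> R) : set R :=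
  Theta f g h d `|` [set 0; 1].

(* Meaningful only for open [A], where the full derivative and neighbourhoods
   agree with those relative to [A]. *)
Definition C1_on {R : realType} (A : set R) (v : R -> R) : Prop :=
  forall z, A z -> derivable v z 1 /\ {for z, continuous (derive1 v)}.

(* In the formula for [Phi], if [derive1 v z = 0] then the right-hand side is [0]
   whatever the values of [d (v z)] and [0 `^ (p - 2)].  As [v] takes values in
   [0,1], this happens in particular wherever [v] is differentiable with value
   [0] or [1], so that [d 0] and [d 1] are irrelevant. *)
Record solution {R : realType} (p : R) (f g h d : R -> R) (c : R)
    (v : R -> R) : Prop := Solution {
  sol_cont : continuous v ;
  sol_range : forall z, 0 <= v z <= 1 ;
  sol_C1 : C1_on (~` (v @^-1` Theta_star f g h d)) v ;
  sol_ninfty : v z @[z --> -oo%R] --> (1 : R) ;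
  sol_pinfty : v z @[z --> +oo%R] --> (0 : R) ;
  sol_flux : exists Phi : R -> R,
    [/\ continuous Phi,
        (forall I : interval R, open [set` I] -> C1_on [set` I] v ->
          forall z, z \in I ->
            Phi z = d (v z) * `|derive1 v z| `^ (p - 2) * derive1 v z),
        (Phi z @[z --> -oo%R] --> (0 : R)) /\
        (Phi z @[z --> +oo%R] --> (0 : R)),
        (forall z, v z = 0 \/ v z = 1 -> Phi z = 0)
      & (forall z1 z2,
          Phi z2 - Phi z1
          + oint (v z1) (v z2) (fun x => c * g x - f x)
          + oint z1 z2 (fun z => h (v z)) = 0)]
}.

Definition tws {R : realType} (p : R) (f g h d : R -> R) (c : R)
    (u : R -> R -> R) : Prop :=
  exists v : R -> R, solution p f g h d c v /\
    forall x t, u x t = v (x - c * t).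

Definition speeds {R : realType} (p : R) (f g h d : R -> R) : set R :=
  [set c | exists u : R -> R -> R, tws p f g h d c u].

(* Main.v *)
Require Import Defs.
From HB Require Import structures.
From mathcomp Require Import all_boot all_order all_algebra.
From mathcomp Require Import all_classical all_reals all_analysis.
From mathcomp Require Import measurable_realfun ess_sup_inf.
From mathcomp Require Import ring lra.

Set Implicit Arguments.
Unset Strict Implicit.
Unset Printing Implicit Defensive.

Import Order.TTheory GRing.Theory Num.Theory.
Import numFieldNormedType.Exports.

Local Open Scope classical_set_scope.
Local Open Scope ring_scope.

(** A front v is described by its flux y = d(v) |v'|^(p-1) taken as a function of
    the value of v. Dividing the second-order equation by v' = - (y/d)^(1/(p-1))
    gives the first-order problem

      y' = c g - f - kappa y^(-1/(p-1))  on ]0, 1[,   y > 0,   y 0 = y 1 = 0,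

    and c is a speed if and only if this problem is solvable (speedsP). In one
    direction (solution_front_profile) a front must be shown to be strictly
    decreasing with nonzero flux wherever 0 < v < 1; the argument is that the flux
    strictly decreases between two times at which v takes the same value. In the
    other (solution_of_front_profile) the inverse of v is a primitive of
    - (d/y)^(1/(p-1)), and the only delicate point is the balance law at the
    finitely many exceptional levels of v.

    For every c there is a profile with y 1 = 0, y > 0 on ]0, 1[ and y 0 >= 0
    (front_profile_exists): y^(p/(p-1)) satisfies an equation without singularity,
    solved backward from 1 by the theorem of Peano (peano_backward). Thus c is a
    speed as soon as a profile cannot start from a positive value, and there are
    two reasons why it cannot.

    The first is a barrier. If the averages of c g - f are at least A and those of
    kappa tau^(-1/(p-1)) at most M, a profile with y 0 > 0 never meets the line
    beta x when beta + M beta^(-1/(p-1)) <= A, although it has to, since y 1 = 0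
    (front_profile_starts_at0). The minimum over beta of the left side is the
    threshold p' (p-1)^(1/p) M^(1/p') (threshold_young, threshold_attained), so
    every c above the threshold is a speed (speed_above_threshold).

    The second is comparison with a profile y0 of another speed c0 that has
    y0 0 = 0 (front_profile_compare): y - y0 stays positive as long as
    y 0 + (c - c0) times the primitive of g does. This makes the infimum of the
    speeds a speed (min_speed_attained) and, when the primitive of g is
    nonnegative, every c above a speed a speed (speeds_upward).

    The lower bounds come from the behaviour of y at 0: if kappa^(p-1) >= l x and
    c g - f <= q near 0, the supremum s of y x / x there satisfies
    s + (l / s)^(1/(p-1)) <= q (front_profile_speed_bound). With l = 0 this gives
    c g 0 >= f 0, so f 0 / g 0 is a lower bound of the speeds. Finally, at the
    minimal speed the averages of c g - f cannot all exceed the threshold by a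
    margin, since they would still do so at slightly smaller speeds
    (min_speed_le_threshold). *)

(** * Calculus with finitely many exceptional points *)

Section Calculus.
Variable R : realType.
Implicit Types (f g : R -> R) (a b x l m : R) (S : set R).

Lemma is_derive_eps f x l :
  (forall e, 0 < e -> \forall t \near x, `|f t - f x - l * (t - x)| <= e * `|t - x|) ->
  is_derive x 1 f l.
Proof.
move=> H; apply/is_derive1_caratheodory.
exists (fun z => if z == x then l else (f z - f x) / (z - x)); split.
- move=> z; case: eqP => [->|/eqP zx]; first by rewrite !subrr mulr0.
  by rewrite divfK// subr_eq0.
- apply/cvgrPdist_le => /= e e0; rewrite eqxx.
  have := H e e0; apply: filterS => t; case: eqP => [->|/eqP tx].
    by move=> _; rewrite subrr normr0; exact: ltW.
  have t0 : 0 < `|t - x| by rewrite normr_gt0 subr_eq0.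
  rewrite -[X in X <= e](mulfK (lt0r_neq0 t0)) ler_pdivrMr// -normrM.
  rewrite -normrN; congr (`| _ | <= _).
  have : t - x != 0 by rewrite subr_eq0.
  by move=> h; field.
- by rewrite eqxx.
Qed.

Lemma is_derive_near f x l : is_derive x 1 f l ->
  forall e, 0 < e -> \forall t \near x, `|f t - f x - l * (t - x)| <= e * `|t - x|.
Proof.
move=> /is_derive1_caratheodory [g [fg gc gl]] e e0.
move/cvgrPdist_le : gc => /(_ _ e0); apply: filterS => t.
by rewrite fg -mulrBl normrM gl distrC => ?; rewrite ler_wpM2r.
Qed.

Lemma is_derive_cont f x l : is_derive x 1 f l -> {for x, continuous f}.
Proof.
by move=> fl; apply: differentiable_continuous; apply/derivable1_diffP.
Qed.

(** The comparison arguments below all follow a difference from a point where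
    its sign is known up to the first point where it vanishes. *)
Lemma first_zero f a b : a < b -> (forall x, a <= x <= b -> {for x, continuous f}) ->
  f a < 0 -> 0 <= f b ->
  exists t, [/\ a < t, t <= b, f t = 0 & forall s, a <= s -> s < t -> f s < 0].
Proof.
move=> ab cf fa fb.
pose A := [set s | a <= s <= b /\ forall r, a <= r -> r <= s -> f r < 0].
have Aa : A a.
  split; first by rewrite lexx ltW.
  by move=> r h1 h2; rewrite (_ : r = a)//; apply/eqP; rewrite eq_le h1 h2.
have ubA : ubound A b by move=> s [/andP[]].
have supA : has_sup A by split; [exists a|exists b].
pose t := sup A.
have at_ : a <= t by apply: ub_le_sup => //; exists b.
have tb : t <= b by apply: ge_sup => //; exists a.
have tneg s : a <= s -> s < t -> f s < 0.
  move=> as_ st; have [r [_ Ar] sr] := sup_adherent (eps := t - s) ltac:(by rewrite subr_gt0) supA.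
  by apply: Ar => //; apply: ltW; move: sr; rewrite subKr.
have ct : {for t, continuous f} by apply: cf; rewrite at_ tb.
have ft : f t = 0.
  apply/eqP; rewrite eq_le; apply/andP; split; rewrite leNgt; apply/negP => ft.
  - have at' : a < t by rewrite lt_neqAle at_ andbT; apply/eqP => e; rewrite -e in ft; lra.
    have /cvgrPdist_lt/(_ _ ft) := ct.
    move=> /nbhs_ballP[e /= e0 H].
    pose s := Num.max a (t - e / 2).
    have sa : a <= s by rewrite le_max lexx.
    have st : s < t by rewrite gt_max at'; lra.
    have : `|f t - f s| < f t.
      apply: H; rewrite /ball/= gtr0_norm ?subr_gt0//.
      have : t - e / 2 <= s by rewrite le_max lexx orbT.
      lra.
    move=> /ltr_normlP[_]; have := tneg s sa st; lra.
  - have tb' : t < b by rewrite lt_neqAle tb andbT; apply/eqP => e; rewrite e in ft; lra.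
    have /cvgrPdist_lt/(_ (- f t)) := ct.
    rewrite oppr_gt0 => /(_ ft) /nbhs_ballP[e /= e0 H].
    pose s := Num.min b (t + e / 2).
    have : A s.
      split.
        by rewrite ge_min lexx /= le_min (ltW ab)/=; lra.
      move=> r ar; rewrite le_min => /andP[rb rt].
      have [/tneg->//|tr] := ltP r t.
      have : `|f t - f r| < - f t.
        apply: H; rewrite /ball/= ler0_norm; lra.
      move=> /ltr_normlP[]; lra.
    move=> /(ub_le_sup (ex_intro _ b ubA)).
    rewrite -/t leNgt lt_min tb' /=; lra.
exists t; split => //.
by rewrite lt_neqAle at_ andbT; apply/eqP => e; rewrite -e in ft; lra.
Qed.

Lemma continuous_within_itvcc f a b :
  (forall x, a <= x <= b -> {for x, continuous f}) -> {within `[a, b], continuous f}.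
Proof.
move=> cf; apply: continuous_in_subspaceT => x; rewrite inE/= in_itv/=; exact: cf.
Qed.

(** Derivation and continuity rules for functions written pointwise, the form
    that the comparison lemmas below are applied to. *)
Lemma is_derive1_const c x : is_derive x 1 (fun=> c : R) 0.
Proof. exact: is_derive_cst. Qed.

Lemma is_derive1_add f g x l m : is_derive x 1 f l -> is_derive x 1 g m ->
  is_derive x 1 (fun t : R => f t + g t : R) (l + m).
Proof. by move=> ? ?; exact: (@is_deriveD _ _ _ f g). Qed.

Lemma is_derive1_sub f g x l m : is_derive x 1 f l -> is_derive x 1 g m ->
  is_derive x 1 (fun t : R => f t - g t : R) (l - m).
Proof. by move=> ? ?; exact: (@is_deriveB _ _ _ f g). Qed.

Lemma is_derive1_fun_comp f g x l m : is_derive (g x) 1 f l -> is_derive x 1 g m ->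
  is_derive x 1 (fun t : R => f (g t) : R) (l * m).
Proof. by move=> ? ?; exact: (@is_derive1_comp _ f g). Qed.

Lemma is_derive1_opp f x l : is_derive x 1 f l -> is_derive x 1 (fun t : R => - f t : R) (- l).
Proof. by move=> ?; exact: (@is_deriveN _ _ _ f). Qed.

Lemma is_derive1_scale f c x l : is_derive x 1 f l ->
  is_derive x 1 (fun t : R => c * f t : R) (c * l).
Proof. by move=> ?; exact: (@is_deriveZ _ _ _ f c). Qed.

Lemma continuous_at_add f g x : {for x, continuous f} -> {for x, continuous g} ->
  {for x, continuous (fun t : R => f t + g t : R)}.
Proof. by move=> ? ?; exact: (@continuousD _ _ _ f g). Qed.

Lemma continuous_at_sub f g x : {for x, continuous f} -> {for x, continuous g} ->
  {for x, continuous (fun t : R => f t - g t : R)}.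
Proof. by move=> ? ?; exact: (@continuousB _ _ _ f g). Qed.

Lemma continuous_at_opp f x : {for x, continuous f} -> {for x, continuous (fun t : R => - f t : R)}.
Proof. by move=> ?; exact: (@continuousN _ _ _ f). Qed.

Lemma continuous_at_mul f g x : {for x, continuous f} -> {for x, continuous g} ->
  {for x, continuous (fun t : R => f t * g t : R)}.
Proof. by move=> ? ?; exact: (@continuousM _ _ f g). Qed.

Lemma continuous_at_const c x : {for x, continuous (fun=> c : R)}.
Proof. exact: cst_continuous. Qed.

Lemma avoid_finite S a b : finite_set S -> a < b -> exists2 x, a < x < b & ~ S x.
Proof.
move=> /finite_seqP[s ->] /=; elim: s a => [|x s IH] a ab.
  by exists ((a + b) / 2) => //; apply/andP; split; lra.
have [/andP[ax xb]|xab] := boolP (a < x < b).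
  have [y /andP[xy yb] ys] := IH x xb.
  exists y; first by rewrite yb andbT; lra.
  by rewrite inE => /orP[/eqP E|//]; lra.
have [y yab ys] := IH a ab; exists y => //.
by rewrite inE => /orP[/eqP E|//]; move: xab; rewrite -E yab.
Qed.

(** Cutting the interval at the exceptional points reduces the statement to the
    mean value theorem; continuity glues the pieces. *)
Lemma nondecreasing_off f S a b : finite_set S -> a <= b ->
  (forall x, a <= x <= b -> {for x, continuous f}) ->
  (forall x, a < x < b -> ~ S x -> exists2 l, is_derive x 1 f l & 0 <= l) ->
  f a <= f b.
Proof.
move=> /finite_seqP[s ->] + + /=; elim: s a b => [|x s IH] a b ab cf df.
  have [l /= H1 H2] : exists2 l : R, 0 <= l & f b - f a = l * (b - a).
    move: ab; rewrite le_eqVlt => /orP[/eqP->|ab].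
      by exists 0 => //; rewrite !subrr mulr0.
    have [||c cab E] := @MVT _ f (fun x => 'D_1 f x) a b ab.
    - move=> x; rewrite in_itv/= => /andP[h1 h2].
      by have [||l [fl _] _] := df x; [rewrite h1 h2| |exact: derivableP].
    - exact: continuous_within_itvcc.
    move: cab; rewrite in_itv/= => cab; have [|l fl l0] := df c cab; first by [].
    by exists l => //; rewrite E (@derive_val _ _ _ _ _ _ _ fl).
  by rewrite -subr_ge0 H2 mulr_ge0// subr_ge0.
have [/andP[ax xb]|xab] := boolP (a < x < b).
  apply: (@le_trans _ _ (f x)); apply: IH; rewrite ?ltW//.
  - by move=> y /andP[h1 h2]; apply: cf; rewrite h1/=; lra.
  - move=> y /andP[h1 h2] ys; apply: df; first by rewrite h1/=; lra.
    by rewrite inE => /orP[/eqP E|//]; lra.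
  - by move=> y /andP[h1 h2]; apply: cf; rewrite h2 andbT; lra.
  - move=> y /andP[h1 h2] ys; apply: df; first by rewrite h2 andbT; lra.
    by rewrite inE => /orP[/eqP E|//]; lra.
apply: IH => // y yab ys; apply: df => //.
by rewrite inE => /orP[/eqP E|//]; move: xab; rewrite -E yab.
Qed.

Lemma le_incr_off f g S a b : finite_set S -> a <= b ->
  (forall x, a <= x <= b -> {for x, continuous f}) ->
  (forall x, a <= x <= b -> {for x, continuous g}) ->
  (forall x, a < x < b -> ~ S x ->
    exists l m, [/\ is_derive x 1 f l, is_derive x 1 g m & l <= m]) ->
  f b - f a <= g b - g a.
Proof.
move=> fS ab cf cg H.
have : (g \- f) a <= (g \- f) b.
  apply: (@nondecreasing_off _ S) => //.
    by move=> x xab; apply: continuousB; [exact: cg|exact: cf].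
  move=> x xab xS; have [l [m [fl gm lm]]] := H x xab xS.
  by exists (m - l); rewrite ?subr_ge0//; apply: is_deriveB.
rewrite /=; lra.
Qed.

Lemma is_derive_lin (k x : R) : is_derive x 1 ( *%R k) k.
Proof.
by apply: is_derive_eps => e e0; near=> t; rewrite -mulrBr subrr normr0 mulr_ge0// ltW.
Unshelve. all: by end_near.
Qed.

Lemma continuous_at_lin (k x : R) : {for x, continuous ( *%R k)}.
Proof. exact: is_derive_cont (is_derive_lin k x). Qed.

Lemma constant_off f S a b : finite_set S -> a <= b ->
  (forall x, a <= x <= b -> {for x, continuous f}) ->
  (forall x, a < x < b -> ~ S x -> is_derive x 1 f 0) -> f b = f a.
Proof.
move=> fS ab cf df.
have c0 x : a <= x <= b -> {for x, continuous (fun=> 0 : R)}.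
  by move=> _; exact: continuous_at_const.
have H1 : f b - f a <= 0 - 0.
  apply: (@le_incr_off f (fun=> 0) S) => // x xab Sx.
  by exists 0, 0; split; [exact: df|exact: is_derive1_const|].
have H2 : 0 - 0 <= f b - f a.
  apply: (@le_incr_off (fun=> 0) f S) => // x xab Sx.
  by exists 0, 0; split; [exact: is_derive1_const|exact: df|].
lra.
Qed.

Lemma increasing_off f S a b : finite_set S -> a < b ->
  (forall x, a <= x <= b -> {for x, continuous f}) ->
  (forall x, a < x < b -> ~ S x -> exists2 l, is_derive x 1 f l & 0 < l) ->
  f a < f b.
Proof.
move=> fS ab cf df.
have sub u w : a <= u -> u <= w -> w <= b -> f u <= f w.
  move=> au uw wb; apply: (@nondecreasing_off _ S) => //.
    by move=> x /andP[? ?]; apply: cf; apply/andP; split; lra.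
  move=> x /andP[? ?] Sx; have [||l ? l0] := df x => //; last by exists l => //; exact: ltW.
  by apply/andP; split; lra.
rewrite lt_neqAle (sub a b) ?lexx ?(ltW ab)// andbT; apply/eqP => E.
have cst x : a <= x -> x <= b -> f x = f a.
  move=> ax xb; apply/eqP; rewrite eq_le (sub a x)// andbT.
  by rewrite E sub.
have [x xab Sx] := avoid_finite fS ab.
have [l fl l0] := df x xab Sx.
case/andP: xab => ax xb.
have : is_derive x 1 f 0.
  apply: is_derive_eps => e e0; near=> t.
  have at_ : a < t by near: t; exact: lt_nbhsr.
  have tb : t < b by near: t; exact: lt_nbhsl.
  rewrite (cst t) ?(cst x) ?(ltW ax) ?(ltW xb) ?(ltW at_) ?(ltW tb)//.
  by rewrite mul0r !subrr normr0 mulr_ge0// ltW.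
move=> /(@derive_val _ _ _ _ _ _ _); rewrite (@derive_val _ _ _ _ _ _ _ fl) => l00.
by rewrite l00 ltxx in l0.
Unshelve. all: by end_near. Qed.

End Calculus.

(** * Primitives of functions on the line *)

Section Primitive.
Variable R : realType.
Notation mu := (@lebesgue_measure R).
Implicit Type m : R -> R.

(** Starting the integral at -oo makes the primitive of a function that vanishes
    outside ]0, 1[ continuous on the whole line, so that no boundary point of
    [0, 1] needs a separate treatment. *)
Definition prim m (x : R) := \int[mu]_(t in `]-oo, x]) m t.

Lemma integrable_sub m (D E : set R) : measurable D -> measurable E -> D `<=` E ->
  mu.-integrable E (EFin \o m) -> mu.-integrable D (EFin \o m).
Proof. by move=> mD mE DE; apply: integrableS. Qed.

Lemma primB m a b : mu.-integrable setT (EFin \o m) -> a <= b ->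
  prim m b - prim m a = \int[mu]_(t in `]a, b]) m t.
Proof.
move=> im ab; rewrite /prim Rintegral_itvB//.
exact: integrable_sub im.
Qed.

Lemma continuous_prim m : mu.-integrable setT (EFin \o m) -> continuous (prim m).
Proof.
move=> im x; apply/cvgrPdist_lt => /= e e0.
have [r [r0 H]] := integral_normr_continuous im e0.
have key a b : a <= b -> b - a < r -> `|prim m b - prim m a| < e.
  move=> ab abr; rewrite primB//; apply: (le_lt_trans _ (H [set` `]a, b]] _ _)) => //.
    by apply: le_normr_Rintegral => //; exact: integrable_sub im.
  by rewrite /= lebesgue_measure_itv/= lte_fin; case: ifPn => // _.
near=> t; have [xt|tx] := leP x t.
  rewrite distrC; apply: key => //.
  have : t < x + r by near: t; apply: lt_nbhsl; rewrite ltrDl.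
  lra.
apply: key; first exact: ltW.
have : x - r < t by near: t; apply: lt_nbhsr; rewrite ltrBlDr ltrDl.
lra.
Unshelve. all: by end_near. Qed.

Lemma is_derive_prim m x : mu.-integrable setT (EFin \o m) ->
  {for x, continuous m} -> is_derive x 1 (prim m) (m x).
Proof.
move=> im cm; have xx1 : x < x + 1 by rewrite ltrDl.
have imx : mu.-integrable `]-oo, x + 1] (EFin \o m) by exact: integrable_sub im.
have [dm <-] := continuous_FTC1 xx1 imx (ltNyr _) cm.
by rewrite derive1E; exact: derivableP.
Qed.

Lemma oint_primE m n a b : mu.-integrable setT (EFin \o m) ->
  (forall t, Num.min a b < t < Num.max a b -> n t = m t) ->
  oint a b n = prim m b - prim m a.
Proof.
move=> im; rewrite /oint.
have key u w : u <= w -> (forall t, u < t < w -> n t = m t) ->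
    \int[mu]_(x in `[u, w]) n x = prim m w - prim m u.
  move=> uw nm; rewrite primB// /Rintegral; congr fine.
  have mm : measurable_fun `]u, w[ m.
    by apply/measurable_EFinP; apply: measurable_funS (measurable_int _ im).
  rewrite [RHS]integral_itv_bndoo; last exact/measurable_EFinP.
  rewrite [LHS]integral_itv_bndoo.
    by apply: eq_integral => t; rewrite inE/= in_itv/= => tuw; rewrite nm.
  apply/measurable_EFinP.
  by apply: eq_measurable_fun mm => t; rewrite inE/= in_itv/= => tuw; rewrite nm.
case: leP => ab nm; first exact: key.
rewrite key ?opprB//; exact: ltW.
Qed.

Lemma integrable_patch m (D : set R) : measurable D ->
  mu.-integrable D (EFin \o m) -> mu.-integrable setT (EFin \o (m \_ D)).
Proof.
move=> mD im; have := (@integrable_mkcond _ _ _ mu D (EFin \o m) mD).1 im.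
by rewrite restrict_EFin.
Qed.

Lemma continuous_patch m (D : set R) x : open D -> D x ->
  {for x, continuous m} -> {for x, continuous (m \_ D)}.
Proof.
move=> oD Dx cm; rewrite /prop_for /continuous_at patchE mem_set//.
apply: cvg_trans cm; apply: near_eq_cvg.
have : nbhs x D by exact: open_nbhs_nbhs.
by apply: filterS => t Dt; rewrite patchE mem_set.
Qed.

Lemma patch_out m (D : set R) x : ~ D x -> (m \_ D) x = 0.
Proof. by move=> Dx; rewrite patchE memNset. Qed.

Lemma patch_in m (D : set R) x : D x -> (m \_ D) x = m x.
Proof. by move=> Dx; rewrite patchE mem_set. Qed.

Lemma integrable_bounded m (a b C : R) : measurable_fun `[a, b] m ->
  (forall x, a <= x <= b -> `|m x| <= C) ->
  mu.-integrable `[a, b] (EFin \o m).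
Proof.
move=> mm bm; apply: measurable_bounded_integrable => //.
  by rewrite /= lebesgue_measure_itv/=; case: ifPn => // _; rewrite -EFinD ltry.
exists C; split; first exact: num_real.
move=> M CM x /=; rewrite in_itv/= => xab; exact: le_trans (bm _ xab) (ltW CM).
Qed.

Lemma continuous_prim_scale_sub c m n x : mu.-integrable setT (EFin \o m) ->
  mu.-integrable setT (EFin \o n) ->
  {for x, continuous (fun t : R => c * prim n t - prim m t : R)}.
Proof.
move=> im iN; exact: (continuous_at_sub
  (continuous_at_mul (@continuous_at_const _ c x) (@continuous_prim n iN x))
  (@continuous_prim m im x)).
Qed.

Lemma is_derive_prim_scale_sub c m n x : mu.-integrable setT (EFin \o m) ->
  mu.-integrable setT (EFin \o n) -> {for x, continuous m} -> {for x, continuous n} ->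
  is_derive x 1 (fun t : R => c * prim n t - prim m t : R) (c * n x - m x).
Proof.
move=> im iN cm cn.
exact: (is_derive1_sub (is_derive1_scale c (is_derive_prim iN cn)) (is_derive_prim im cm)).
Qed.

End Primitive.

(** * Peano existence for a backward Cauchy problem *)

Lemma ultra_bounded_cvg (R : realType) (T : Type) (U : set_system T) (u : T -> R) (M : R) :
  UltraFilter U -> (forall n, `|u n| <= M) -> exists l : R, u x @[x --> U] --> l.
Proof.
move=> UU uM.
have FU : ProperFilter U by exact: ultra_proper.
have [|p [_ clp]] := @segment_compact R (- M) M (u x @[x --> U]) _.
  by apply: nearW => n /=; rewrite in_itv/= -ler_norml.
exists p; apply/cvgrPdist_lt => e e0.
have [//|UC] := in_ultra_setVsetC [set n | `|p - u n| < e] UU.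
have [||x [Ax Bx]] := clp (u @` (~` [set n | `|p - u n| < e])) (ball p e).
- by apply: (@filterS _ U _ _ _ _ UC) => n nC /=; exists n.
- by apply/nbhs_ballP; exists e.
- by case: Ax => n nC unx; exfalso; apply: nC; rewrite /= unx.
Qed.

Section Peano.
Variable R : realType.
Variables (b k G K r : R -> R) (S : set R) (C rho : R).
Hypothesis finS : finite_set S.
Hypothesis contG : continuous G.
Hypothesis contK : continuous K.
Hypothesis dG : forall x, ~ S x -> is_derive x 1 G (b x).
Hypothesis dK : forall x, ~ S x -> is_derive x 1 K (k x).
Hypothesis contb : forall x, ~ S x -> {for x, continuous b}.
Hypothesis contk : forall x, ~ S x -> {for x, continuous k}.
Hypothesis bC : forall x, ~ S x -> `|b x| <= C.
Hypothesis k0 : forall x, ~ S x -> 0 <= k x.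
Hypothesis b0 : forall x, x < 0 \/ 1 < x -> b x = 0.
Hypothesis k00 : forall x, 1 < x -> k x = 0.
Hypothesis contr : continuous r.
Hypothesis r_rho : forall y, `|r y| <= rho.

Let C0 : 0 <= C.
Proof.
have [x _ Sx] := avoid_finite finS (@ltr01 R).
exact: le_trans (normr_ge0 _) (bC Sx).
Qed.

Let rho0 : 0 <= rho.
Proof. exact: le_trans (normr_ge0 _) (r_rho 0). Qed.

(** The bound does not depend on the values of r along the curve: all the
    approximate solutions share one modulus of continuity. *)
Lemma integral_curve_modulus (Y : R -> R) (S' : set R) : finite_set S' -> continuous Y ->
  (forall s, ~ S' s -> ~ S s ->
    exists2 q, `|q| <= rho & is_derive s 1 Y (b s * q - k s)) ->
  forall s t, s <= t -> `|Y t - Y s| <= C * rho * (t - s) + (K t - K s).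
Proof.
move=> fS' cY dY s t st.
have fU : finite_set (S' `|` S) by rewrite finite_setU.
have dE x : ~ S x -> is_derive x 1 (fun x : R => C * rho * x + K x : R) (C * rho + k x).
  by move=> Sx; exact: (is_derive1_add (is_derive_lin (C * rho) x) (dK Sx)).
have cE x : {for x, continuous (fun x : R => C * rho * x + K x : R)}.
  by apply: continuous_at_add; [exact: continuous_at_lin|exact: contK].
have le1 : Y t - Y s <= C * rho * t + K t - (C * rho * s + K s).
  apply: (@le_incr_off _ Y (fun x : R => C * rho * x + K x) _ _ _ fU st)
    => [x _|x _|x _ Ux]; [exact: cY|exact: cE|].
  have Sx : ~ S x by move=> ?; apply: Ux; right.
  have [||q qr dq] := dY x; rewrite //; first by move=> ?; apply: Ux; left.
  do 2 eexists; split; [exact: dq|exact: dE|].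
  have : b x * q <= C * rho.
    apply: le_trans (ler_norm _) _; rewrite normrM ler_pM//; exact: bC.
  have := k0 Sx; lra.
have le2 : - Y t - - Y s <= C * rho * t + K t - (C * rho * s + K s).
  apply: (@le_incr_off _ (fun x => - Y x) (fun x : R => C * rho * x + K x) _ _ _ fU st)
    => [x _|x _|x _ Ux]; [|exact: cE|].
    by apply: continuous_at_opp; exact: cY.
  have Sx : ~ S x by move=> ?; apply: Ux; right.
  have [||q qr dq] := dY x; rewrite //; first by move=> ?; apply: Ux; left.
  do 2 eexists; split; [exact: is_derive1_opp dq|exact: dE|].
  have : - (b x * q) <= C * rho.
    apply: le_trans (ler_norm _) _; rewrite normrN normrM ler_pM//; exact: bC.
  lra.
rewrite ler_norml; apply/andP; split; lra.
Qed.

(** Approximate solutions in the manner of Tonelli: on [x, +oo[ the slope at s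
    uses the value of Y at a point at most e to the right of s, where a solution
    built from right to left is already known. *)
Definition delayed_solution (e x : R) (Y : R -> R) (S' : set R) :=
  [/\ finite_set S', continuous Y, (forall t, 1 <= t -> Y t = 0) &
    forall s, ~ S' s -> ~ S s -> exists t,
      (x <= s -> s <= t <= s + e) /\ is_derive s 1 Y (b s * r (Y t) - k s)].

Let tangent (y x : R) := fun t : R => y + (r y * (G t - G x) - (K t - K x)).

Let tangent_cont y x t : {for t, continuous (tangent y x)}.
Proof.
exact: (continuous_at_add (@continuous_at_const _ y t)
  (continuous_at_sub (continuous_at_mul (@continuous_at_const _ (r y) t)
    (continuous_at_sub (@contG t) (@continuous_at_const _ (G x) t)))
  (continuous_at_sub (@contK t) (@continuous_at_const _ (K x) t)))).
Qed.

Let tangent_deriv y x t : ~ S t -> is_derive t 1 (tangent y x) (b t * r y - k t).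
Proof.
move=> St; apply: is_derive_eq.
  exact: (is_derive1_add (is_derive1_const y t) (is_derive1_sub (is_derive1_scale (r y)
    (is_derive1_sub (dG St) (is_derive1_const (G x) t)))
    (is_derive1_sub (dK St) (is_derive1_const (K x) t)))).
rewrite /=; ring.
Qed.

Lemma delayed_solution1 e : 0 <= e -> delayed_solution e 1 (tangent 0 1) set0.
Proof.
move=> e0; split => //.
- by move=> t; exact: tangent_cont.
- move=> t t1; rewrite /tangent.
  have -> : G t = G 1.
    apply: (constant_off finS t1) => [x _|x /andP[x1 _] Sx]; first exact: contG.
    by rewrite -[0](b0 (or_intror x1)); exact: dG.
  have -> : K t = K 1.
    apply: (constant_off finS t1) => [x _|x /andP[x1 _] Sx]; first exact: contK.
    by rewrite -[0](k00 x1); exact: dK.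
  by rewrite !subrr mulr0 subrr addr0.
- move=> s _ Ss; have [s1|s1] := ltP 1 s.
    exists s; split; first by move=> _; rewrite lexx lerDl.
    have := tangent_deriv 0 1 Ss.
    by rewrite b0 ?mul0r//; right.
  exists 1; split; first by move=> h; rewrite s1 -[1]addr0 lerD.
  have -> : tangent 0 1 1 = 0 by rewrite /tangent !subrr mulr0 subrr addr0.
  exact: tangent_deriv.
Qed.

(** Freezing the argument of r at Y x integrates the equation explicitly on
    [x - e, x[. *)
Lemma delayed_solution_extend (e x : R) (Y : R -> R) (S' : set R) : 0 <= e -> x <= 1 ->
  delayed_solution e x Y S' ->
  delayed_solution e (x - e)
    (fun t : R => if t < x then tangent (Y x) x t else Y t) (S' `|` [set x]).
Proof.
move=> e0 x1 [fS' cY Y1 dY].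
set Z := (fun t => _).
have Zx : tangent (Y x) x x = Y x by rewrite /tangent !subrr mulr0 subrr addr0.
have nearL t : t < x -> \forall u \near t, Z u = tangent (Y x) x u.
  move=> tx; have : \forall u \near t, u < x by exact: lt_nbhsl.
  by apply: filterS => u ux; rewrite /Z ux.
have nearR t : x < t -> \forall u \near t, Z u = Y u.
  move=> tx; have : \forall u \near t, x < u by exact: lt_nbhsr.
  by apply: filterS => u ux; rewrite /Z ltNge (ltW ux).
split.
- by rewrite finite_setU; split.
- move=> t; apply/cvgrPdist_lt => d d0.
  have H1 : \forall u \near t, `|tangent (Y x) x t - tangent (Y x) x u| < d.
    have := @tangent_cont (Y x) x t; move/cvgrPdist_lt; exact.
  have H2 : \forall u \near t, `|Y t - Y u| < d.
    have := @cY t; move/cvgrPdist_lt; exact.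
  have [tx|xt|tx] := ltgtP t x.
  + have := nearL t tx; move: H1; apply: filterS2 => u + ->.
    by rewrite /Z tx.
  + have := nearR t xt; move: H2; apply: filterS2 => u + ->.
    by rewrite /Z (lt_gtF xt).
  + move: H1 H2; apply: filterS2 => u; rewrite /Z tx ltxx Zx.
    by case: ifP.
- move=> t t1; rewrite /Z ltNge (le_trans x1 t1)/=; exact: Y1.
- move=> s Us Ss; have sx : s != x by apply/eqP => sx; apply: Us; right.
  have S's : ~ S' s by move=> ?; apply: Us; left.
  have [{}sx|xs|] := ltgtP s x; last by move/eqP; rewrite (negbTE sx).
  + exists x; split; first by move=> h; apply/andP; split; lra.
    apply: (@near_eq_is_derive _ _ _ (tangent (Y x) x)).
      by have := nearL s sx; apply: filterS => u ->.
    rewrite /Z ltxx; exact: tangent_deriv.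
  + have [t [tP dt]] := dY s S's Ss; have /andP[st te] := tP (ltW xs).
    exists t; split; first by rewrite st te.
    apply: (@near_eq_is_derive _ _ _ Y).
      by have := nearR s xs; apply: filterS => u ->.
    by rewrite {1}/Z ltNge (le_trans (ltW xs) st).
Qed.

Lemma delayed_solution_exists (e : R) : 0 < e -> exists (Y : R -> R) (S' : set R),
  [/\ finite_set S', continuous Y, (forall t, 1 <= t -> Y t = 0) &
    forall s, ~ S' s -> ~ S s -> exists t,
      s <= t <= s + e /\ is_derive s 1 Y (b s * r (Y t) - k s)].
Proof.
move=> e0.
have ex n : exists Y S', delayed_solution e (1 - n%:R * e) Y S'.
  elim: n => [|n [Y [S' IH]]].
    by exists (tangent 0 1), set0; rewrite mul0r subr0; exact: (delayed_solution1 (ltW e0)).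
  do 2 eexists; rewrite -natr1 mulrDl mul1r opprD addrA.
  apply: (delayed_solution_extend (ltW e0) _ IH).
  by rewrite gerBl mulr_ge0// ltW.
have [Y [S' [fS' cY Y1 dY]]] := ex (Num.truncn e^-1).+1.
exists Y, S'; split => // s S's Ss; have [t [tP dt]] := dY s S's Ss.
have [s0|s0] := ltP s 0.
  exists s; split; first by rewrite lexx; lra.
  by move: dt; rewrite b0 ?mul0r//; left.
exists t; split => //; apply: tP; apply: le_trans s0.
rewrite subr_le0 -ler_pdivrMr// mul1r.
by rewrite ltW// truncnS_gt.
Qed.

(** Along an ultrafilter the delayed solutions converge at every point, and the
    common modulus passes to the limit L. At a point s where b and k are
    continuous, the modulus keeps Y n w close to L s for all w near s, so the
    slopes of Y n near s are uniformly close to b s * r (L s) - k s, and so are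
    the difference quotients of L. No uniform convergence is needed. *)
Theorem peano_backward : exists2 Y : R -> R, continuous Y &
  (forall t, 1 <= t -> Y t = 0) /\
  (forall s, ~ S s -> is_derive s 1 Y (b s * r (Y s) - k s)).
Proof.
have en (n : nat) : 0 < (n.+1%:R^-1 : R) by rewrite invr_gt0.
have /choice[Y /choice[S' YP]] := fun n => delayed_solution_exists (en n).
have mod n s t : s <= t -> `|Y n t - Y n s| <= C * rho * (t - s) + (K t - K s).
  have [fS' cY _ dY] := YP n.
  apply: integral_curve_modulus fS' cY _ s t => s S's Ss.
  by have [t [_ dt]] := dY s S's Ss; exists (r (Y n t)).
have bnd t : exists M, forall n, `|Y n t| <= M.
  have Y1 n : Y n 1 = 0 by have [_ _ + _] := YP n; apply.
  have [t1|t1] := leP t 1.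
    exists (C * rho * (1 - t) + (K 1 - K t)) => n.
    by have := mod n t 1 t1; rewrite Y1 sub0r normrN.
  exists (C * rho * (t - 1) + (K t - K 1)) => n.
  by have := mod n 1 t (ltW t1); rewrite Y1 subr0.
have [U [UU ooU]] := ultraFilterLemma (eventually_filter).
have FU : ProperFilter U by exact: ultra_proper.
have /choice[L YL] : forall t, exists l : R, Y n t @[n --> U] --> l.
  by move=> t; have [M MP] := bnd t; exact: (ultra_bounded_cvg UU MP).
have modL s t : s <= t -> `|L t - L s| <= C * rho * (t - s) + (K t - K s).
  move=> st; have cv : (fun n => `|Y n t - Y n s|) @ U --> `|L t - L s|.
    by apply: cvg_norm; apply: cvgB; exact: YL.
  by apply: (cvgr_to_le cv); apply: nearW => n; exact: mod.
have modulus_small (x d : R) : 0 < d -> \forall t \near x, forall s1 s2 : R,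
    s1 <= s2 -> `|s1 - x| <= `|t - x| -> `|s2 - x| <= `|t - x| ->
    C * rho * (s2 - s1) + (K s2 - K s1) <= d.
  move=> d0.
  have : {for x, continuous (fun t : R => C * rho * t + K t : R)}.
    exact: (continuous_at_add (@continuous_at_lin _ _ _) (@contK x)).
  have d2 : 0 < d / 2 by lra.
  move=> /cvgrPdist_lt/(_ _ d2)/nbhs_ballP[e /= e0 H].
  apply/nbhs_ballP; exists e => //= t; rewrite /ball/= distrC => xt s1 s2 s12 s1t s2t.
  have /ltr_normlP[A1 A2] := H s1 ltac:(by rewrite /ball/= distrC (le_lt_trans s1t)).
  have /ltr_normlP[B1 B2] := H s2 ltac:(by rewrite /ball/= distrC (le_lt_trans s2t)).
  lra.
exists L; first move=> x.
  apply/cvgrPdist_le => e e0; have := modulus_small x e e0.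
  apply: filterS => t tP; have [xt|tx] := leP x t.
    rewrite distrC; apply: le_trans (modL _ _ xt) _.
    by apply: tP; rewrite // subrr normr0.
  apply: le_trans (modL _ _ (ltW tx)) _.
  by apply: tP; rewrite ?(ltW tx)// subrr normr0.
split.
  move=> t t1; have cv := YL t; apply: (cvg_unique _ cv) => //.
  apply: (@cvg_trans _ (cst (0 : R) @ U)); last exact: cvg_cst.
  by apply: near_eq_cvg; apply: nearW => n; have [_ _ + _] := YP n => ->.
move=> s Ss; apply: is_derive_eps => e e0.
(* (b, k, q) |-> b * q - k is continuous at (b s, k s, r (L s)). *)
have [e1 [e10 e1P]] : exists e1 : R, 0 < e1 /\ forall b' k' q : R, `|b s - b'| <= e1 ->
    `|k s - k'| <= e1 -> `|r (L s) - q| <= e1 -> `|q| <= rho ->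
    `|b' * q - k' - (b s * r (L s) - k s)| <= e.
  have rc : 0 < rho + C + 1 by rewrite ltr_pwDr// addr_ge0.
  exists (e / (rho + C + 1)); split; first by rewrite divr_gt0.
  move=> b' k' q hb hk hq qr.
  have -> : b' * q - k' - (b s * r (L s) - k s) =
    - ((b s - b') * q) - b s * (r (L s) - q) + (k s - k') by ring.
  have -> : e = e / (rho + C + 1) * rho + C * (e / (rho + C + 1)) + e / (rho + C + 1).
    by field; rewrite gt_eqF.
  apply: le_trans (ler_normD _ _) _; apply: lerD => //.
  apply: le_trans (ler_normB _ _) _; rewrite normrN !normrM.
  by apply: lerD; apply: ler_pM => //; exact: bC.
have contrL := @contr (L s); move: contrL => /cvgrPdist_le/(_ _ e10)/nbhs_ballP[e2 /= e20 e2P].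
have e20' : 0 < e2 / 3 by lra.
have nb : \forall u \near s, `|b s - b u| <= e1 by have := contb Ss; move/cvgrPdist_le; exact.
have nk : \forall u \near s, `|k s - k u| <= e1 by have := contk Ss; move/cvgrPdist_le; exact.
have /nbhs_ballP[e3 /= e30 H3] : \forall u \near s, [/\ `|b s - b u| <= e1, `|k s - k u| <= e1 &
    forall s1 s2 : R, s1 <= s2 -> `|s1 - s| <= `|u - s| -> `|s2 - s| <= `|u - s| ->
    C * rho * (s2 - s1) + (K s2 - K s1) <= e2 / 3].
  by move: nb nk (modulus_small s _ e20'); apply: filterS3.
apply/nbhs_ballP; exists (e3 / 3) => /=; first by lra.
move=> t; rewrite /ball/= => st.
have YLs : \forall n \near U, `|L s - Y n s| <= e2 / 3.
  have := YL s; move/cvgrPdist_le; exact.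
have small : \forall n \near U, (n.+1%:R^-1 : R) <= e3 / 3.
  have e33 : 0 < e3 / 3 by lra.
  apply: ooU; have := near_infty_natSinv_lt (PosNum e33).
  by apply: filterS => n /ltW.
have cv : (fun n => `|Y n t - Y n s - (b s * r (L s) - k s) * (t - s)|) @ U -->
    `|L t - L s - (b s * r (L s) - k s) * (t - s)|.
  apply: cvg_norm; apply: cvgB; last exact: cvg_cst.
  by apply: cvgB; exact: YL.
apply: (cvgr_to_le cv); move: YLs small; apply: filterS2 => n Yns n3.
have [fS' cY _ dY] := YP n.
have slope u : `|u - s| <= `|t - s| -> ~ S' n u -> ~ S u ->
    exists l, is_derive u 1 (Y n) l /\ `|l - (b s * r (L s) - k s)| <= e.
  move=> us S'u Su; have [w [/andP[uw wu] dw]] := dY u S'u Su.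
  exists (b u * r (Y n w) - k u); split => //.
  rewrite distrC in st.
  have [h1 h2 _] := H3 u ltac:(rewrite /ball/= distrC; lra).
  apply: e1P; [exact: h1|exact: h2| |exact: r_rho].
  apply: e2P; rewrite /ball/=.
  have ws : `|w - s| < e3.
    have -> : w - s = (w - u) + (u - s) by ring.
    apply: le_lt_trans (ler_normD _ _) _; rewrite (ger0_norm (x := w - u)) ?subr_ge0//.
      apply: (@le_lt_trans _ _ (e3 / 3 + e3 / 3)); last by lra.
      apply: lerD; last exact: le_trans us (ltW st).
      by rewrite lerBlDl; apply: le_trans wu _; rewrite lerD2l.
  have [_ _ h3] := H3 w ltac:(by rewrite /ball/= distrC).
  have H4 : `|Y n s - Y n w| <= e2 / 3.
    have [sw|sw] := leP s w.
      rewrite distrC; apply: le_trans (mod n _ _ sw) _.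
      by apply: h3; rewrite // subrr normr0.
    apply: le_trans (mod n _ _ (ltW sw)) _.
    by apply: h3; rewrite ?(ltW sw)// subrr normr0.
  have -> : L s - Y n w = (L s - Y n s) + (Y n s - Y n w) by ring.
  apply: le_lt_trans (ler_normD _ _) _.
  apply: (@le_lt_trans _ _ (e2 / 3 + e2 / 3)); last by lra.
  exact: lerD.
have fU : finite_set (S' n `|` S) by rewrite finite_setU.
set l0 := b s * r (L s) - k s.
have key u v : `|u - s| <= `|t - s| -> `|v - s| <= `|t - s| -> u <= v ->
   `|Y n v - Y n u - l0 * (v - u)| <= e * (v - u).
  move=> us vs uv.
  have inb x : u < x < v -> `|x - s| <= `|t - s|.
    move=> /andP[ux xv]; rewrite ler_norml; move: us vs; rewrite !ler_norml.
    by move=> /andP[? ?] /andP[? ?]; apply/andP; split; lra.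
  have U1 : Y n v - Y n u <= (l0 + e) * v - (l0 + e) * u.
    apply: (@le_incr_off _ (Y n) ( *%R (l0 + e)) _ _ _ fU uv) => [x _|x _|x xuv Ux].
    - exact: cY.
    - exact: continuous_at_lin.
    have [||l [dl lP]] := @slope x (inb x xuv);
      [by move=> ?; apply: Ux; left|by move=> ?; apply: Ux; right|].
    exists l, (l0 + e); split; [exact: dl|exact: is_derive_lin|].
    by move: lP; rewrite ler_norml => /andP[_]; rewrite /l0; lra.
  have U2 : (l0 - e) * v - (l0 - e) * u <= Y n v - Y n u.
    apply: (@le_incr_off _ ( *%R (l0 - e)) (Y n) _ _ _ fU uv) => [x _|x _|x xuv Ux].
    - exact: continuous_at_lin.
    - exact: cY.
    have [||l [dl lP]] := @slope x (inb x xuv);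
      [by move=> ?; apply: Ux; left|by move=> ?; apply: Ux; right|].
    exists (l0 - e), l; split; [exact: is_derive_lin|exact: dl|].
    by move: lP; rewrite ler_norml => /andP[+ _]; rewrite /l0; lra.
  rewrite ler_norml; apply/andP; split; lra.
have ss : `|s - s| <= `|t - s| by rewrite subrr normr0.
have [le_st|lt_ts] := leP s t.
  by rewrite (ger0_norm (x := t - s)) ?subr_ge0//; exact: key.
rewrite (ltr0_norm (x := t - s)) ?subr_lt0// -normrN opprB.
have := key t s (lexx _) ss (ltW lt_ts).
by congr (`| _ | <= _); ring.
Qed.

End Peano.

(** * Powers and the threshold constant *)

Section Powers.
Variable R : realType.
Implicit Types (x y q s M : R).

Lemma continuous_powR x q : 0 < x -> {for x, continuous (fun t : R => t `^ q)}.
Proof. move=> x0; exact: (is_derive_cont (@is_derive1_powR _ q x x0)). Qed.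

Lemma ler_powRN x y q : 0 <= q -> 0 < x -> x <= y -> y `^ (- q) <= x `^ (- q).
Proof.
move=> q0 x0 xy; have y0 := lt_le_trans x0 xy.
rewrite !powRN lef_pV2 ?posrE ?powR_gt0//.
by apply: ge0_ler_powR; rewrite ?nnegrE ?(ltW x0) ?(ltW y0).
Qed.

Lemma powR_1B x q : 0 < x -> x `^ (1 - q) = x / x `^ q.
Proof.
by move=> x0; rewrite powRB ?(gt_eqF x0) ?implybT// powRr1// ltW.
Qed.

Lemma powRVl x q : 0 < x -> x^-1 `^ q = (x `^ q)^-1.
Proof. by move=> x0; rewrite -[x^-1]powR_inv1 ?ltW// -powRrM mulN1r powRN. Qed.

Lemma continuous_pos_powR q : 0 < q -> continuous (fun t : R => Num.max t 0 `^ q).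
Proof.
move=> q0 x; have [x0|x0|->] := ltgtP x 0.
- apply/cvgrPdist_lt => e e0.
  have : \forall t \near x, t < 0 by exact: lt_nbhsl.
  apply: filterS => t t0.
  by rewrite !max_r ?ltW// subrr normr0.
- apply/cvgrPdist_lt => e e0.
  have H1 : \forall t \near x, 0 < t by exact: lt_nbhsr.
  have H2 : \forall t \near x, `|x `^ q - t `^ q| < e.
    have := @continuous_powR x q x0; move/cvgrPdist_lt; exact.
  move: H1 H2; apply: filterS2 => t t0.
  by rewrite !max_l ?ltW.
- apply/cvgrPdist_lt => e e0.
  have d0 : 0 < e `^ q^-1 by rewrite powR_gt0.
  have : \forall t \near (0 : R), t < e `^ q^-1 by exact: lt_nbhsl.
  apply: filterS => t td.
  rewrite max_l// powR0 ?gt_eqF// sub0r normrN ger0_norm ?powR_ge0//.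
  rewrite -[ltRHS](powRr1 (ltW e0)) -(mulVf (lt0r_neq0 q0)) powRrM.
  apply: gt0_ltr_powR; rewrite ?nnegrE ?powR_ge0// ?le_max ?lexx ?orbT//.
  by rewrite gt_max td.
Qed.

End Powers.

Section Exponents.
Variables (R : realType) (p : R).
Hypothesis p1 : 1 < p.
Let a := (p - 1)^-1.
Let p' : R := conj_exp p.

Let p0 : 0 < p. Proof. exact: lt_trans ltr01 p1. Qed.
Let pm1 : 0 < p - 1. Proof. by rewrite subr_gt0. Qed.
Let a0 : 0 < a. Proof. by rewrite invr_gt0. Qed.

Lemma conj_exp_gt0 : 0 < conj_exp p.
Proof. by rewrite divr_gt0. Qed.

Lemma conj_expV : (conj_exp p)^-1 = 1 - p^-1.
Proof. by rewrite /conj_exp; field; rewrite !gt_eqF. Qed.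

Let aV : a * (conj_exp p)^-1 = p^-1.
Proof. by rewrite conj_expV /a; field; rewrite !gt_eqF. Qed.

(** Young's inequality for the exponents p and p' = conj_exp p, applied to the
    numbers whose powers p and p', divided by p and p', are the two summands on
    the right. *)
Lemma threshold_young (s M : R) : 0 < s -> 0 <= M ->
  conj_exp p * (p - 1) `^ p^-1 * M `^ (conj_exp p)^-1 <= s + M * s `^ (- a).
Proof.
move=> s0 M0.
have p'0 := conj_exp_gt0.
have Ms0 : 0 <= M * s `^ (- a) by rewrite mulr_ge0// powR_ge0.
pose X := (s * p) `^ p^-1; pose Z := (M * s `^ (- a) * p') `^ p'^-1.
have E1 : X `^ p / p = s.
  by rewrite -powRrM mulVf ?gt_eqF// powRr1 ?mulfK ?gt_eqF// mulr_ge0 ?ltW.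
have E2 : Z `^ p' / p' = M * s `^ (- a).
  by rewrite -powRrM mulVf ?gt_eqF// powRr1 ?mulfK ?gt_eqF// mulr_ge0 ?(ltW p'0).
have pp' : p^-1 + p'^-1 = 1 by rewrite /p' conj_expV; ring.
have X0 : 0 <= X by exact: powR_ge0.
have Z0 : 0 <= Z by exact: powR_ge0.
have := conjugate_powR X0 Z0 p0 p'0 pp'; rewrite E1 E2.
apply: le_trans; rewrite le_eqVlt; apply/orP; left; apply/eqP.
rewrite /X /Z.
have -> : (s * p) `^ p^-1 = s `^ p^-1 * p `^ p^-1 by rewrite powRM ?ltW.
have -> : (M * s `^ (- a) * p') `^ p'^-1 = M `^ p'^-1 * (s `^ p^-1)^-1 * p' `^ p'^-1.
  rewrite powRM// ?(ltW p'0)// powRM ?powR_ge0//.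
  by rewrite -powRrM mulNr aV powRN.
have -> : p' `^ p'^-1 = p / p `^ p^-1 * ((p - 1) `^ p^-1 / (p - 1)).
  rewrite {1}/p' {1}/conj_exp powRM ?invr_ge0 ?(ltW p0) ?(ltW pm1)//.
  by rewrite powRVl// /p' conj_expV !powR_1B// invf_div.
have sp : s `^ p^-1 != 0 by rewrite gt_eqF// powR_gt0.
have pp : p `^ p^-1 != 0 by rewrite gt_eqF// powR_gt0.
by rewrite /p' {1}/conj_exp; field; rewrite sp pp gt_eqF.
Qed.

(** Equality in Young's inequality holds where the derivative in s of the sum
    vanishes, that is for s `^ p' = a * M. *)
Lemma threshold_attained (M : R) : 0 < M -> exists2 s : R, 0 < s &
  s + M * s `^ (- a) = conj_exp p * (p - 1) `^ p^-1 * M `^ (conj_exp p)^-1.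
Proof.
move=> M0; exists ((a * M) `^ (conj_exp p)^-1); first by rewrite powR_gt0// mulr_gt0.
have aM0 : 0 < a * M by rewrite mulr_gt0.
rewrite -powRrM mulrN [_^-1 * a]mulrC aV powRN conj_expV !powR_1B//.
rewrite powRM ?(ltW a0) ?(ltW M0)// [a `^ _]powRVl//.
have Mp : M `^ p^-1 != 0 by rewrite gt_eqF// powR_gt0.
have pp : (p - 1) `^ p^-1 != 0 by rewrite gt_eqF// powR_gt0.
by rewrite /a /conj_exp; field; rewrite Mp pp gt_eqF.
Qed.

End Exponents.

(** * The singular first-order problem *)

(** The flux y = d(v) |v'|^(p-1) of a front, as a function of the value of v.
    Writing v' = - (y / d(v))^(1/(p-1)) turns the second-order equation of the
    front into this first-order equation with k = d^(1/(p-1)) h, singular where y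
    vanishes. The value at 0 is left free: the profiles with y 0 = 0 are those of
    the fronts. *)
Definition front_profile (R : realType) (p : R) (f g k : R -> R) (S : set R) (c : R)
    (y : R -> R) :=
  [/\ continuous y, y 1 = 0, forall x, 0 < x < 1 -> 0 < y x &
    forall x, 0 < x < 1 -> ~ S x ->
      is_derive x 1 y (c * g x - f x - k x * y x `^ (- (p - 1)^-1))].

Section SingularODE.
Variables (R : realType) (p : R) (f g k : R -> R) (S : set R) (C : R).
Notation mu := (@lebesgue_measure R).
Hypothesis p1 : 1 < p.
Hypothesis finS : finite_set S.
Hypothesis intf : mu.-integrable setT (EFin \o f).
Hypothesis intg : mu.-integrable setT (EFin \o g).
Hypothesis intk : mu.-integrable setT (EFin \o k).
Hypothesis contf : forall x, ~ S x -> {for x, continuous f}.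
Hypothesis contg : forall x, ~ S x -> {for x, continuous g}.
Hypothesis contk : forall x, ~ S x -> {for x, continuous k}.
Hypothesis fC : forall x, `|f x| <= C.
Hypothesis gC : forall x, `|g x| <= C.
Hypothesis k0 : forall x, 0 <= k x.
Hypothesis out : forall x, x < 0 \/ 1 < x -> [/\ f x = 0, g x = 0 & k x = 0].
Hypothesis k_low : forall a b, 0 < a -> b < 1 ->
  exists2 m, 0 < m & forall x, a <= x <= b -> m <= k x.

Let a := (p - 1)^-1.
Let pm1 : 0 < p - 1. Proof. by rewrite subr_gt0. Qed.
Let a0 : 0 < a. Proof. by rewrite invr_gt0. Qed.
Let p0 : 0 < p. Proof. exact: lt_trans ltr01 p1. Qed.
Let C0 : 0 <= C. Proof. exact: le_trans (normr_ge0 _) (fC 0). Qed.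

Let B c : R -> R := fun x => c * prim g x - prim f x.

Let contB c x : {for x, continuous (B c)}.
Proof.
exact: continuous_prim_scale_sub.
Qed.

Let derB c x : ~ S x -> is_derive x 1 (B c) (c * g x - f x).
Proof.
by move=> Sx; apply: is_derive_prim_scale_sub => //; [exact: contf|exact: contg].
Qed.

Let bC c x : `|c * g x - f x| <= `|c| * C + C.
Proof.
apply: le_trans (ler_normB _ _) _; apply: lerD => //.
by rewrite normrM ler_wpM2l.
Qed.

Let K1 : 0 <= prim k 1 - prim k 0.
Proof.
rewrite subr_ge0; apply: (nondecreasing_off finS ler01) => [x _|x _ Sx].
  exact: continuous_prim.
by exists (k x) => //; apply: is_derive_prim => //; exact: contk.
Qed.

(** For Y = y `^ p' the singular factor becomes the continuous Y `^ (1/p), to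
    which the Peano theorem applies once it is bounded; the truncation at N
    bounds it. Inside [0, 1] the truncation turns out to be inactive: a bound on
    the slope of Y gives Y <= A * N `^ (1/p) + K, which is at most N if N is
    large, as the exponent 1/p is less than 1. *)
Lemma desingularized_exists (c : R) : exists (N : R) (Y : R -> R), [/\ 0 < N, continuous Y,
   Y 1 = 0, (forall x, 0 <= x <= 1 -> Y x <= N) &
   forall x, ~ S x -> is_derive x 1 Y
     (conj_exp p * ((c * g x - f x) * Num.max (Num.min (Y x) N) 0 `^ p^-1 - k x))].
Proof.
set p' := conj_exp p; have p'0 : 0 < p' := conj_exp_gt0 p1.
set A := p' * (`|c| * C + C).
have A0 : 0 <= A by rewrite mulr_ge0 ?(ltW p'0)// addr_ge0// mulr_ge0.
set K := p' * (prim k 1 - prim k 0).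
have K0 : 0 <= K by rewrite mulr_ge0 ?(ltW p'0).
(* t is N `^ (1/p): it is chosen so that A * t + K <= t `^ p. *)
set t := Num.max 1 (A + K) `^ a.
have M1 : 1 <= Num.max 1 (A + K) by rewrite le_max lexx.
have t1 : 1 <= t.
  apply: (@le_trans _ _ (Num.max 1 (A + K) `^ 0)); first by rewrite powRr0.
  by apply: ler_powR; rewrite // (ltW a0).
have t0 : 0 < t := lt_le_trans ltr01 t1.
have tA : A * t + K <= t `^ p.
  rewrite -mulr_powRB1 ?(ltW t0)// {3}/t -powRrM mulVf ?gt_eqF// powRr1 ?(le_trans ler01)//.
  apply: (@le_trans _ _ (t * (A + K))).
    by rewrite mulrDr mulrC lerD2l ler_peMl.
  by rewrite ler_pM2l// le_max lexx orbT.
pose r y := Num.max (Num.min y (t `^ p)) 0 `^ p^-1.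
have rt y : `|r y| <= t.
  rewrite ger0_norm ?powR_ge0//.
  rewrite -[leRHS](powRr1 (ltW t0)) -(mulfV (lt0r_neq0 p0)) powRrM.
  apply: ge0_ler_powR; rewrite ?nnegrE ?invr_ge0 ?powR_ge0 ?(ltW p0) ?le_max ?lexx ?orbT//.
  by rewrite ge_max powR_ge0 ge_min lexx orbT.
have [||||||||||||Y cY [Y1 dY]] := @peano_backward R (fun x => p' * (c * g x - f x))
    (fun x => p' * k x) (fun x => p' * B c x) (fun x => p' * prim k x) r S A t finS.
- by move=> x; exact: (continuous_at_mul (@continuous_at_const _ p' x) (@contB c x)).
- move=> x; exact: (continuous_at_mul (@continuous_at_const _ p' x) (@continuous_prim _ _ intk x)).
- by move=> x Sx; exact: (is_derive1_scale p' (@derB c x Sx)).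
- by move=> x Sx; exact: (is_derive1_scale p' (is_derive_prim intk (contk Sx))).
- move=> x Sx; exact: (continuous_at_mul (@continuous_at_const _ p' x)
    (continuous_at_sub (continuous_at_mul (@continuous_at_const _ c x) (contg Sx)) (contf Sx))).
- move=> x Sx; exact: (continuous_at_mul (@continuous_at_const _ p' x) (contk Sx)).
- by move=> x _; rewrite normrM gtr0_norm// ler_pM2l.
- by move=> x _; rewrite mulr_ge0// ltW.
- by move=> x /out[-> -> _]; rewrite mulr0 subr0 mulr0.
- by move=> x x1; have [_ _ ->] := out (or_intror x1); rewrite mulr0.
- move=> x; apply: (@continuous_comp _ _ _ (fun y => Num.min y (t `^ p))
    (fun u => Num.max u 0 `^ p^-1)).
    by apply: continuous_min; [exact: cvg_id|exact: cvg_cst].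
  by apply: continuous_pos_powR; rewrite invr_gt0.
- exact: rt.
exists (t `^ p), Y; split => //; first by rewrite powR_gt0.
- exact: Y1.
- move=> x /andP[x0 x1].
  have kx : prim k 0 <= prim k x.
    apply: (nondecreasing_off finS x0) => [s _|s _ Ss]; first exact: continuous_prim.
    by exists (k s) => //; apply: is_derive_prim => //; exact: contk.
  have H : (- (A * t) * 1 - p' * prim k 1) - (- (A * t) * x - p' * prim k x) <= Y 1 - Y x.
    apply: (@le_incr_off _ (fun s : R => - (A * t) * s - p' * prim k s : R) Y _ _ _ finS x1)
      => [s _|s _|s _ Ss].
    - exact: (continuous_at_sub (@continuous_at_lin _ _ s)
        (continuous_at_mul (@continuous_at_const _ p' s) (@continuous_prim _ _ intk s))).
    - exact: cY.
    do 2 eexists; split; [|exact: dY|].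
      exact: (is_derive1_sub (is_derive_lin _ s)
        (is_derive1_scale p' (is_derive_prim intk (contk Ss)))).
    rewrite lerD2r lerNl -mulNr; apply: le_trans (ler_norm _) _.
    rewrite normrM normrN; apply: ler_pM => //.
    by rewrite normrM gtr0_norm// ler_pM2l.
  have AtN : A * t * (1 - x) <= A * t.
    apply: ler_piMr; first by apply: mulr_ge0 => //; exact: (ltW t0).
    by rewrite lerBlDr lerDl.
  have pk : p' * (prim k 1 - prim k x) <= K by rewrite /K ler_pM2l// lerD2l lerN2.
  rewrite Y1// in H; lra.
- by move=> x Sx; apply: is_derive_eq (dY x Sx) _; rewrite /r; ring.
Qed.

Let k_gt0 x : 0 < x < 1 -> 0 < k x.
Proof.
move=> /andP[x0 x1]; have [m m0 mk] := k_low x0 x1.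
by apply: lt_le_trans m0 (mk _ _); rewrite lexx.
Qed.

(** Positivity of Y inside ]0, 1[ is where the sign of k matters. As long as Y is
    nonpositive the truncated root vanishes, so Y' = - p' k < 0; and Y cannot
    leave the nonpositive values, because the sink still dominates at small
    positive values of Y. So a nonpositive value inside would force Y 1 < 0. *)
Theorem front_profile_exists c : exists y, front_profile p f g k S c y /\ 0 <= y 0.
Proof.
have p'0 := conj_exp_gt0 p1.
have [N [Y [N0 cY Y1 YN dY]]] := desingularized_exists c.
set p' := conj_exp p in p'0 dY *.
have pV0 : 0 < p^-1 by rewrite invr_gt0.
have Ypos x0 : 0 < x0 < 1 -> 0 < Y x0.
  move=> /andP[x00 x01]; rewrite ltNge; apply/negP => Yx0.
  have Yneg t : x0 <= t -> t <= 1 -> Y t <= 0.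
    move=> x0t; rewrite le_eqVlt => /orP[/eqP->|t1]; first by rewrite Y1.
    rewrite leNgt; apply/negP => Yt.
    have [m m0 mk] := k_low x00 t1.
    (* up to the level e the drift is too weak to overcome the sink *)
    set D := `|c| * C + C + 1.
    have D0 : 0 < D by rewrite ltr_wpDl// addr_ge0// mulr_ge0.
    set e := Num.min (Y t) ((m / D) `^ p).
    have e0 : 0 < e by rewrite lt_min Yt powR_gt0// divr_gt0.
    have De : D * e `^ p^-1 <= m.
      rewrite mulrC -ler_pdivlMr//.
      rewrite -[leRHS]powRr1 ?divr_ge0 ?(ltW m0) ?(ltW D0)// -(mulfV (lt0r_neq0 p0)) powRrM.
      apply: ge0_ler_powR; rewrite ?nnegrE ?powR_ge0 ?(ltW e0) ?(ltW pV0)//.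
      by rewrite ge_min lexx orbT.
    have x0t' : x0 < t.
      by rewrite lt_neqAle x0t andbT; apply/eqP => E; move: Yx0; rewrite E leNgt Yt.
    have [|||s [x0s st Ys Yneg]] := @first_zero _ (fun x : R => Y x - e) x0 t x0t'.
    - by move=> x _; exact: (continuous_at_sub (@cY x) (@continuous_at_const _ e x)).
    - by rewrite subr_lt0; exact: le_lt_trans Yx0 e0.
    - by rewrite subr_ge0 ge_min lexx.
    have : 0 - 0 <= Y x0 - Y s.
      have -> : Y x0 - Y s = - Y s - - Y x0 by rewrite opprK addrC.
      apply: (@le_incr_off _ (fun=> 0) (fun x => - Y x) _ _ _ finS (ltW x0s))
        => [x _|x _|x /andP[x0x xs] Sx].
      - exact: continuous_at_const.
      - exact: (continuous_at_opp (@cY x)).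
      do 2 eexists; split; [exact: is_derive1_const|exact: (is_derive1_opp (dY x Sx))|].
      rewrite -mulrN mulr_ge0 ?(ltW p'0)// opprB subr_ge0.
      have kx : m <= k x by apply: mk; rewrite (ltW x0x)/= ltW// (lt_le_trans xs).
      apply: le_trans kx; apply: le_trans De; apply: le_trans (ler_norm _) _.
      rewrite normrM; apply: ler_pM => //.
        by apply: le_trans (bC _ _) _; rewrite lerDl.
      rewrite ger0_norm ?powR_ge0//.
      apply: ge0_ler_powR; rewrite ?nnegrE ?le_max ?lexx ?orbT ?(ltW e0) ?(ltW pV0)//.
      rewrite ge_max (ltW e0) andbT ge_min; apply/orP; left.
      by rewrite -subr_le0 ltW// Yneg// ltW.
    rewrite subrr subr_ge0 leNgt => /negP; apply.
    have -> : Y s = e by apply/eqP; rewrite -subr_eq0 Ys.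
    exact: le_lt_trans Yx0 e0.
  have : - Y x0 < - Y 1.
    apply: (increasing_off (f := fun x => - Y x) finS x01) => [x _|x /andP[x0x x1] Sx].
      exact: (continuous_at_opp (@cY x)).
    eexists; first exact: (is_derive1_opp (dY x Sx)).
    rewrite [Num.max _ 0]max_r; last first.
      by rewrite ge_min Yneg ?(ltW x0x) ?(ltW x1).
    rewrite powR0 ?gt_eqF// mulr0 sub0r mulrN opprK mulr_gt0// k_gt0//.
    by rewrite (lt_trans x00 x0x).
  by rewrite Y1 oppr0 oppr_lt0 ltNge Yx0.
have p'V0 : 0 < p'^-1 by rewrite invr_gt0.
exists (fun x => Num.max (Y x) 0 `^ p'^-1); split; last exact: powR_ge0.
split.
- move=> x; apply: (@continuous_comp _ _ _ Y (fun u => Num.max u 0 `^ p'^-1)).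
    exact: cY.
  exact: (continuous_pos_powR p'V0).
- by rewrite Y1 maxxx powR0// gt_eqF.
- by move=> x x01; rewrite powR_gt0// lt_max Ypos.
- move=> x x01 Sx; have Yx := Ypos x x01.
  have YxN : Y x <= N by case/andP: x01 => x0 x1; apply: YN; rewrite !ltW.
  apply: (@near_eq_is_derive _ _ _ ((fun u => u `^ p'^-1) \o Y)).
    have : \forall t \near x, 0 < Y t.
      have := @cY x; move/cvgrPdist_lt/(_ _ Yx); apply: filterS => t.
      by move/ltr_normlP => -[_]; rewrite ltrBlDr -ltrBlDl subrr.
    by apply: filterS => t Yt; rewrite /= max_l// ltW.
  apply: is_derive_eq; first exact: (is_derive1_comp (is_derive1_powR p'^-1 Yx) (dY x Sx)).
  rewrite min_l// max_l ?(ltW Yx)//.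
  have aV : a * p'^-1 = p^-1.
    by rewrite /p' /conj_exp /a; field; rewrite !gt_eqF.
  rewrite -powRrM mulrN [_ * a]mulrC aV powRN /p' conj_expV//.
  have -> : 1 - p^-1 - 1 = - p^-1 by ring.
  rewrite powRN.
  have Yp : Y x `^ p^-1 != 0 by rewrite gt_eqF// powR_gt0.
  rewrite /conj_exp; field.
  by rewrite Yp !gt_eqF.
Qed.

(** While y0 stays below y its sink term k y0^(-a) is the larger one, so y - y0
    grows at least as fast as (c - c0) * prim g. If this quantity never makes up
    for y 0 > 0, the two profiles cannot meet, whereas both vanish at 1. *)
Theorem front_profile_compare (c c0 : R) (y y0 : R -> R) :
  front_profile p f g k S c y -> front_profile p f g k S c0 y0 -> y0 0 = 0 ->
  ~ (forall x, 0 <= x <= 1 -> 0 < y 0 + (c - c0) * (prim g x - prim g 0)).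
Proof.
move=> [cy y1 ypos dy] [cy0 y01 y0pos dy0] y00 H.
have L0 : 0 < y 0 by have := H 0; rewrite lexx ler01 subrr mulr0 addr0; exact.
have [|||t [t0 t1 ut uneg]] := @first_zero _ (fun x => y0 x - y x) 0 1 ltr01.
- by move=> x _; exact: (continuous_at_sub (@cy0 x) (@cy x)).
- by rewrite y00 sub0r oppr_lt0.
- by rewrite y01 y1 subrr.
have : (c - c0) * prim g t - (c - c0) * prim g 0 <= (y t - y0 t) - (y 0 - y0 0).
  apply: (@le_incr_off _ (fun x => (c - c0) * prim g x) (fun x => y x - y0 x) _ _ _ finS (ltW t0))
    => [x _|x _|x /andP[x0 xt] Sx].
  - exact: (continuous_at_mul (@continuous_at_const _ (c - c0) x) (@continuous_prim _ _ intg x)).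
  - exact: (continuous_at_sub (@cy x) (@cy0 x)).
  have x01 : 0 < x < 1 by rewrite x0 (lt_le_trans xt).
  do 2 eexists; split.
  - exact: (is_derive1_scale _ (is_derive_prim intg (contg Sx))).
  - exact: (is_derive1_sub (dy x x01 Sx) (dy0 x x01 Sx)).
  have yy : y0 x <= y x by rewrite -subr_le0 ltW// uneg// ltW.
  have := ler_wpM2l (k0 x) (ler_powRN (ltW a0) (y0pos _ x01) yy).
  rewrite -/a; lra.
have := H t; rewrite (ltW t0) t1 => /(_ isT).
rewrite y00; lra.
Qed.

(** The line x |-> beta * x is a barrier. A profile with y 0 > 0 must cross it
    before x = 1, as y 1 = 0. Up to the first crossing y is above the line, hence
    the sink integrates to at most beta^(-a) * M * x and the profile is at least
    y 0 + (A - M * beta^(-a)) * x > beta * x: there is no crossing. *)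
Theorem front_profile_starts_at0 (c A M beta : R) (y : R -> R) :
  front_profile p f g k S c y -> 0 <= y 0 -> 0 < beta ->
  beta + M * beta `^ (- a) <= A ->
  (forall x, 0 < x < 1 -> A * x <= c * (prim g x - prim g 0) - (prim f x - prim f 0)) ->
  (forall x, 0 < x < 1 ->
     mu.-integrable `]0, x[ (EFin \o (fun s => k s * s `^ (- a))) /\
     \int[mu]_(s in `]0, x[) (k s * s `^ (- a)) <= M * x) ->
  y 0 = 0.
Proof.
move=> [cy y1 ypos dy] y0 b0 bA HA HM; apply/eqP; rewrite eq_le y0 andbT leNgt; apply/negP => L0.
have [|||t [t0 t1 ut uneg]] := @first_zero _ (fun x => beta * x - y x) 0 1 ltr01.
- by move=> x _; exact: (continuous_at_sub (@continuous_at_lin _ beta x) (@cy x)).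
- by rewrite mulr0 sub0r oppr_lt0.
- by rewrite mulr1 y1 subr0 ltW.
have {}t1 : t < 1.
  rewrite lt_neqAle t1 andbT; apply/eqP => E; move: ut.
  by rewrite E mulr1 y1 subr0 => /eqP; rewrite gt_eqF.
have t01 : 0 < t < 1 by rewrite t0.
have [intn nM] := HM t t01.
pose n := (fun s => k s * s `^ (- a)) \_ `]0, t[.
have intn' : mu.-integrable setT (EFin \o n) by exact: integrable_patch.
have : (B c t - beta `^ (- a) * prim n t) - (B c 0 - beta `^ (- a) * prim n 0) <= y t - y 0.
  apply: (@le_incr_off _ (fun x => B c x - beta `^ (- a) * prim n x) y _ _ _ finS (ltW t0))
    => [x _|x _|x /andP[x0 xt] Sx].
  - exact: (continuous_at_sub (@contB c x)
      (continuous_at_mul (@continuous_at_const _ (beta `^ (- a)) x)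
        (@continuous_prim _ _ intn' x))).
  - exact: cy.
  have x01 : 0 < x < 1 by rewrite x0 (lt_trans xt).
  have cn : {for x, continuous n}.
    apply: continuous_patch; [exact: interval_open|by rewrite /= in_itv/= x0|].
    exact: (continuous_at_mul (contk Sx) (@continuous_powR _ x (- a) x0)).
  do 2 eexists; split.
  - exact: (is_derive1_sub (@derB c x Sx)
      (is_derive1_scale (beta `^ (- a)) (is_derive_prim intn' cn))).
  - exact: dy.
  rewrite lerD2l lerN2 /n patch_in/=; last by rewrite in_itv/= x0.
  rewrite -/a mulrCA; apply: ler_wpM2l => //.
  rewrite -powRM ?(ltW x0) ?(ltW b0)//.
  apply: ler_powRN; [exact: ltW|by rewrite mulr_gt0|].
  by rewrite -subr_le0 ltW// uneg// ltW.
have -> : y t = beta * t by apply/esym/eqP; rewrite -subr_eq0 ut.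
have nE : prim n t - prim n 0 <= M * t.
  apply: le_trans nM; rewrite primB ?(ltW t0)// le_eqVlt; apply/orP; left; apply/eqP.
  rewrite -Rintegral_itv_bndo_bndc; last exact: integrable_sub intn'.
  by apply: eq_Rintegral => s; rewrite inE => /= ts; rewrite /n patch_in.
have bn : beta `^ (- a) * (prim n t - prim n 0) <= beta `^ (- a) * (M * t).
  by rewrite ler_wpM2l// powR_ge0.
have := HA t t01; have : (beta + M * beta `^ (- a)) * t <= A * t by rewrite ler_pM2r.
rewrite /B; lra.
Qed.

(** Let s be the supremum of y x / x near 0, which is finite since y' <= q. From
    y x <= s * x the sink at x is at least (l x)^a (s x)^(-a) = l^a s^(-a), so
    y x <= (q - l^a s^(-a)) * x and therefore s + l^a s^(-a) <= q. The left side
    is bounded below by Young's inequality. *)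
Theorem front_profile_speed_bound (c q l delta : R) (y : R -> R) :
  front_profile p f g k S c y -> y 0 = 0 -> 0 <= l -> 0 < delta -> delta < 1 ->
  (forall x, 0 < x < delta -> ~ S x -> c * g x - f x <= q /\ l * x <= k x `^ (p - 1)) ->
  conj_exp p * (p - 1) `^ p^-1 * l `^ p^-1 <= q.
Proof.
move=> [cy y1 ypos dy] y0 l0 d0 d1 H.
have lin (s x : R) : 0 < x < delta ->
    (forall u, 0 < u < x -> ~ S u -> c * g u - f u - k u * y u `^ (- a) <= s) -> y x <= s * x.
  move=> /andP[x0 xd] Hs.
  have : y x - y 0 <= s * x - s * 0.
    apply: (@le_incr_off _ y ( *%R s) _ _ _ finS (ltW x0)) => [u _|u _|u /andP[u0 ux] Su].
    - exact: cy.
    - exact: continuous_at_lin.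
    do 2 eexists; split; [apply: dy => //|exact: is_derive_lin|by apply: Hs; rewrite // u0].
    by rewrite u0 (lt_trans ux)// (lt_trans xd).
  by rewrite y0 mulr0 !subr0.
have pos x : 0 < x < delta -> 0 < y x.
  by move=> /andP[x0 xd]; apply: ypos; rewrite x0 (lt_trans xd).
pose T := [set y x / x | x in `]0, delta[%classic].
have ubT : ubound T q.
  move=> z [x /=]; rewrite in_itv/= => xd <-; have /andP[x0 _] := xd.
  rewrite ler_pdivrMr//; apply: lin => // u ux' Su; have /andP[u0 ux] := ux'.
  have ud : 0 < u < delta by rewrite u0 (lt_trans ux)//; case/andP: xd.
  have [h1 _] := H u ud Su.
  by rewrite lerBlDr; apply: le_trans h1 _; rewrite lerDl mulr_ge0// powR_ge0.
have d2 : 0 < delta / 2 < delta by apply/andP; split; lra.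
have T2 : T (y (delta / 2) / (delta / 2)) by exists (delta / 2) => //=; rewrite in_itv.
have hasT : has_sup T.
  by split; [exists (y (delta / 2) / (delta / 2)); exact: T2|exists q; exact: ubT].
set s := sup T.
have s0 : 0 < s.
  apply: lt_le_trans (ub_le_sup hasT.2 T2).
  by rewrite divr_gt0 ?pos//; case/andP: d2.
have ys x : 0 < x < delta -> y x <= s * x.
  move=> xd; have /andP[x0 _] := xd; rewrite -ler_pdivrMr//.
  by apply: (ub_le_sup hasT.2); exists x => //=; rewrite in_itv.
have key x : 0 < x < delta -> y x <= (q - l `^ a * s `^ (- a)) * x.
  move=> xd; apply: lin => // u ux' Su; have /andP[u0 ux] := ux'.
  have ud : 0 < u < delta by rewrite u0 (lt_trans ux)//; case/andP: xd.
  have [h1 h2] := H u ud Su.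
  apply: lerB => //.
  have -> : l `^ a * s `^ (- a) = (l * u) `^ a * (s * u) `^ (- a).
    rewrite !powRM ?(ltW u0) ?(ltW s0)// !powRN.
    have ua : u `^ a != 0 by rewrite gt_eqF// powR_gt0.
    have sa : s `^ a != 0 by rewrite gt_eqF// powR_gt0.
    by field; rewrite ua sa.
  apply: ler_pM; rewrite ?powR_ge0//.
    rewrite -[leRHS]powRr1// -(mulfV (lt0r_neq0 pm1)) powRrM.
    by apply: ge0_ler_powR; rewrite ?nnegrE ?mulr_ge0 ?powR_ge0 ?(ltW a0) ?(ltW u0).
  by apply: ler_powRN; [exact: ltW|exact: pos|exact: ys].
have : s <= q - l `^ a * s `^ (- a).
  apply: ge_sup; first by case: hasT.
  move=> z [x /=]; rewrite in_itv/= => xd <-; have /andP[x0 _] := xd.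
  by rewrite ler_pdivrMr//; exact: key.
have := threshold_young p1 s0 (powR_ge0 l a).
rewrite -powRrM -/a.
have -> : a / conj_exp p = p^-1.
  by rewrite /conj_exp /a; field; rewrite !gt_eqF.
lra.
Qed.

End SingularODE.

(** * The coefficients *)

Section Coefficients.
Variable R : realType.
Notation mu := (@lebesgue_measure R).
Implicit Types (m : R -> R) (x C M a b : R).

Lemma Linfty01_measurable m : Linfty01 m -> measurable_fun setT (m \_ `]0, 1[).
Proof. by move=> /sub_Lfun_mfun; rewrite inE. Qed.

Lemma Linfty01_ae m : Linfty01 m ->
  exists M, \forall x \ae mu, `|(m \_ `]0, 1[) x| <= M.
Proof.
move=> /sub_Lfun_finLfun; rewrite inE/= /finite_norm unlock/=.
have -> : (0 < mu setT)%E.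
  apply: (@lt_le_trans _ _ (mu `[0, 1])); last by apply: le_measure; rewrite ?inE.
  by rewrite /= lebesgue_measure_itv/= lte_fin ltr01 oppr0 adde0 lte01.
exact: ess_supr_bounded.
Qed.

(** The set where |m| exceeds M is negligible, and a neighbourhood of a point
    where a continuous function exceeds M is not. *)
Lemma le_at_continuity m x M : {for x, continuous m} ->
  (\forall x \ae mu, `|m x| <= M) -> `|m x| <= M.
Proof.
move=> cm [N [mN N0 HN]]; rewrite leNgt; apply/negP => Mx.
have : \forall t \near x, M < `|m t|.
  have : {for x, continuous (fun t => `|m t| : R)}.
    by apply: (@continuous_comp _ _ _ m (fun u => `|u| : R)) => //; exact: norm_continuous.
  move/cvgrPdist_lt => /(_ (`|m x| - M)); rewrite subr_gt0 => /(_ Mx).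
  by apply: filterS => t /ltr_normlP[_]; lra.
move=> /nbhs_ballP[e /= e0 He].
have : (mu (ball x e) <= mu N)%E.
  apply: le_measure; rewrite ?inE//; first exact: measurable_ball.
  by move=> t /He Mt; apply: HN => /=; apply/negP; rewrite -ltNge.
rewrite N0 lebesgue_measure_ball ?(ltW e0)// lee_fin.
by rewrite leNgt mulrn_wgt0.
Qed.

Lemma hatC_bounded m : finite_set (disc m) -> Linfty01 m ->
  exists C, forall x, 0 < x < 1 -> `|m x| <= C.
Proof.
move=> /finite_seqP[s sE] Lm; have [M HM] := Linfty01_ae Lm.
have cont_le x : 0 < x < 1 -> ~ disc m x -> `|m x| <= M.
  move=> x01 nd; have x01' : `]0, 1[%classic x by rewrite /= in_itv.
  rewrite -(patch_in m x01'); apply: le_at_continuity => //.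
  apply: continuous_patch; [exact: interval_open|exact: x01'|].
  by apply: contrapT => ncm; apply: nd; split.
exists (Num.max M (\big[Num.max/0]_(t <- s) `|m t|)) => x x01.
rewrite le_max; have [xs|xs] := boolP (x \in s).
  by apply/orP; right; exact: (Order.TotalTheory.le_bigmax_seq 0 x xpredT (fun t => `|m t|) xs).
apply/orP; left; apply: cont_le => //; rewrite sE /=; exact/negP.
Qed.

Lemma ereal_inf_gt0 m a b : (0 < ereal_inf [set (m x)%:E | x in `[a, b]])%E ->
  exists2 M, 0 < M & forall x, a <= x <= b -> M <= m x.
Proof.
move=> H; have lb x : a <= x <= b -> (ereal_inf [set (m x)%:E | x in `[a, b]] <= (m x)%:E)%E.
  by move=> xab; apply: ereal_inf_lbound; exists x => //=; rewrite in_itv.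
have [E|N] := eqVneq (ereal_inf [set (m x)%:E | x in `[a, b]]) +oo%E.
  by exists 1 => // x /lb; rewrite E leye_eq.
exists (fine (ereal_inf [set (m x)%:E | x in `[a, b]])).
  by apply: fine_gt0; rewrite H ltey.
move=> x /lb; rewrite -lee_fin fineK// ge0_fin_numE ?ltey//; exact: ltW.
Qed.

Lemma ereal_sup_lty m a b : a <= b -> (ereal_sup [set (m x)%:E | x in `[a, b]] < +oo)%E ->
  exists M, forall x, a <= x <= b -> m x <= M.
Proof.
move=> ab H; have ub x : a <= x <= b -> ((m x)%:E <= ereal_sup [set (m x)%:E | x in `[a, b]])%E.
  by move=> xab; apply: ereal_sup_ubound; exists x => //=; rewrite in_itv.
exists (fine (ereal_sup [set (m x)%:E | x in `[a, b]])) => x /ub.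
rewrite -lee_fin fineK// fin_numE -ltey H andbT -ltNye.
apply: lt_le_trans (ub a _); last by rewrite lexx.
exact: ltNyr.
Qed.

End Coefficients.

(** That d has no removable discontinuity makes the flux formula hold on every
    interval of smoothness of a front, as such an interval cannot then cross a
    discontinuity of d. *)
Record standing (R : realType) (p : R) (f g h d : R -> R) : Prop := Standing {
  st_p : 1 < p;
  st_f : hatC_closed f; st_g : hatC_closed g; st_h : hatC_closed h; st_d : hatC_open d;
  st_fb : Linfty01 f; st_gb : Linfty01 g; st_hb : Linfty01 h;
  st_nrd : no_removable d;
  st_dlu : forall a b : R, 0 < a -> a < b -> b < 1 ->
    (0 < ereal_inf [set (d x)%:E | x in `[a, b]])%E /\
    (ereal_sup [set (d x)%:E | x in `[a, b]] < +oo)%E;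
  st_h01 : h 0 = 0 /\ h 1 = 0;
  st_hl : forall a b : R, 0 < a -> a < b -> b < 1 ->
    (0 < ereal_inf [set (h x)%:E | x in `[a, b]])%E;
  st_k : (@lebesgue_measure R).-integrable `]0, 1[ (EFin \o kappa p d h) }.

(** Extending by 0 makes the primitives of the coefficients continuous on the
    whole line and confines the differential equation to [0, 1]. *)
Definition on01 (R : realType) (m : R -> R) : R -> R := m \_ `]0, 1[.

Section Standing.
Variables (R : realType) (p : R) (f g h d : R -> R).
Hypothesis H : standing p f g h d.
Notation mu := (@lebesgue_measure R).
Notation T := (Theta_star f g h d).
Implicit Types (m : R -> R) (a b x C : R).

Lemma finite_Theta_star : finite_set T.
Proof.
case: (st_f H) (st_g H) (st_h H) (st_d H) => [ff _ _] [fg _ _] [fh _ _] fd.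
rewrite /Theta_star /Theta !finite_setU; do !split => //.
Qed.

Lemma continuous_outside x : 0 < x < 1 -> ~ T x ->
  [/\ {for x, continuous f}, {for x, continuous g}, {for x, continuous h}
    & {for x, continuous d}].
Proof.
move=> x01 Tx; split; apply: contrapT => nc; apply: Tx; left.
- by left; left; right; split.
- by left; right; split.
- by right; split.
- by left; left; left; split.
Qed.

Lemma d_bounds a b : 0 < a -> b < 1 ->
  exists l u : R, [/\ 0 < l, 0 < u & forall x, a <= x <= b -> l <= d x <= u].
Proof.
move=> a0 b1.
pose a' := Num.min a (1 / 2); pose b' := Num.max b (3 / 4).
have a'0 : 0 < a' by rewrite lt_min a0 divr_gt0.
have b'1 : b' < 1 by rewrite gt_max b1/=; lra.
have a'b' : a' < b' by rewrite gt_min; apply/orP; right; rewrite lt_max; apply/orP; right; lra.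
have [/ereal_inf_gt0[m m0 mP] /(ereal_sup_lty (ltW a'b'))[M MP]] := st_dlu H a'0 a'b' b'1.
exists m, (Num.max M 1); split => //; first by rewrite lt_max ltr01 orbT.
move=> x /andP[ax xb].
have xab : a' <= x <= b' by rewrite ge_min ax/= le_max xb.
by rewrite mP// le_max MP.
Qed.

Lemma h_low a b : 0 < a -> b < 1 ->
  exists2 l : R, 0 < l & forall x, a <= x <= b -> l <= h x.
Proof.
move=> a0 b1.
pose a' := Num.min a (1 / 2); pose b' := Num.max b (3 / 4).
have a'0 : 0 < a' by rewrite lt_min a0 divr_gt0.
have b'1 : b' < 1 by rewrite gt_max b1/=; lra.
have a'b' : a' < b' by rewrite gt_min; apply/orP; right; rewrite lt_max; apply/orP; right; lra.
have /ereal_inf_gt0[m m0 mP] := st_hl H a'0 a'b' b'1.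
exists m => // x /andP[ax xb]; apply: mP.
by rewrite ge_min ax/= le_max xb.
Qed.

Lemma d_gt0 x : 0 < x < 1 -> 0 < d x.
Proof.
move=> /andP[x0 x1]; have [m [M [m0 _ mM]]] := d_bounds x0 x1.
have := mM x; rewrite lexx => /(_ isT) /andP[+ _]; exact: lt_le_trans.
Qed.

Lemma h_gt0 x : 0 < x < 1 -> 0 < h x.
Proof.
move=> /andP[x0 x1]; have [m m0 mM] := h_low x0 x1.
by apply: lt_le_trans m0 _; apply: mM; rewrite lexx.
Qed.

Lemma on01_in m x : 0 < x < 1 -> on01 m x = m x.
Proof. by move=> x01; rewrite /on01 patch_in//= in_itv. Qed.

Lemma on01_out m x : ~ (0 < x < 1) -> on01 m x = 0.
Proof. by move=> x01; rewrite /on01 patch_out//= in_itv. Qed.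

Lemma on01_h x : 0 <= x <= 1 -> on01 h x = h x.
Proof.
move=> /andP[]; rewrite le_eqVlt => /orP[/eqP<- _|x0].
  by rewrite on01_out ?(st_h01 H).1// ltxx.
rewrite le_eqVlt => /orP[/eqP->|x1]; last by rewrite on01_in ?x0.
by rewrite on01_out ?(st_h01 H).2// ltxx andbF.
Qed.

Lemma bounds : exists C, [/\ forall x, `|on01 f x| <= C, forall x, `|on01 g x| <= C
  & forall x, `|on01 h x| <= C].
Proof.
case: (st_f H) (st_g H) (st_h H) => [ff _ _] [fg _ _] [fh _ _].
have [Cf HCf] := hatC_bounded ff (st_fb H).
have [Cg HCg] := hatC_bounded fg (st_gb H).
have [Ch HCh] := hatC_bounded fh (st_hb H).
have key m M C : (forall x, 0 < x < 1 -> `|m x| <= M) -> 0 <= C -> M <= C ->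
    forall x, `|on01 m x| <= C.
  move=> mM C0 MC x; have [x01|x01] := pselect (0 < x < 1).
    by rewrite on01_in// (le_trans (mM _ x01)).
  by rewrite on01_out// normr0.
exists (Num.max (Num.max Cf Cg) (Num.max Ch 0)); split.
- by apply: key HCf _ _; rewrite !le_max lexx ?orbT.
- by apply: key HCg _ _; rewrite !le_max lexx ?orbT.
- by apply: key HCh _ _; rewrite !le_max lexx ?orbT.
Qed.

Lemma continuous_on01 m x : ~ T x -> (0 < x < 1 -> {for x, continuous m}) ->
  {for x, continuous (on01 m)}.
Proof.
move=> Tx cm; have [x01|x01] := pselect (0 < x < 1).
  by apply: continuous_patch; [exact: interval_open|rewrite /= in_itv|exact: cm].
have : x < 0 \/ 1 < x.
  have [x0|x0|x0] := ltgtP x 0; [by left| |by exfalso; apply: Tx; right; left].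
  have [x1|x1|x1] := ltgtP x 1; [by exfalso; apply: x01; rewrite x0|by right|].
  by exfalso; apply: Tx; right; right.
move=> xo; apply/cvgrPdist_lt => e e0.
rewrite on01_out//; case: xo => xo.
  have : \forall t \near x, t < 0 by exact: lt_nbhsl.
  apply: filterS => t t0; rewrite on01_out ?subrr ?normr0//.
  by rewrite (lt_gtF t0).
have : \forall t \near x, 1 < t by exact: lt_nbhsr.
apply: filterS => t t0; rewrite on01_out ?subrr ?normr0//.
by rewrite (lt_gtF t0) andbF.
Qed.

Lemma integrable_on01 m C : Linfty01 m -> (forall x, `|on01 m x| <= C) ->
  mu.-integrable setT (EFin \o on01 m).
Proof.
move=> /Linfty01_measurable mm mC.
have -> : on01 m = (on01 m) \_ `[0, 1].
  apply/funext => x; rewrite patchE; case: ifPn => //.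
  rewrite notin_setE/= in_itv/= => xn.
  by rewrite on01_out// => /andP[x0 x1]; apply: xn; rewrite !ltW.
apply: integrable_patch => //; apply: (@integrable_bounded _ _ _ _ C) => //.
exact: measurable_funS mm.
Qed.

Lemma integrable_kappa : mu.-integrable setT (EFin \o on01 (kappa p d h)).
Proof. by apply: integrable_patch => //; exact: st_k H. Qed.

Lemma continuous_kappa x : 0 < x < 1 -> ~ T x -> {for x, continuous (kappa p d h)}.
Proof.
move=> x01 Tx; have [_ _ ch cd] := continuous_outside x01 Tx.
apply: (continuous_at_mul (f := fun x => d x `^ (p - 1)^-1)) ch.
apply: (@continuous_comp _ _ _ d (fun u => u `^ (p - 1)^-1)) => //.
exact: (continuous_powR (d_gt0 x01)).
Qed.

Lemma kappa_low a b : 0 < a -> b < 1 ->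
  exists2 l : R, 0 < l & forall x, a <= x <= b -> l <= on01 (kappa p d h) x.
Proof.
move=> a0 b1; have [m m0 mP] := h_low a0 b1.
have [md [Md [md0 _ mdP]]] := d_bounds a0 b1.
exists (md `^ (p - 1)^-1 * m); first by rewrite mulr_gt0// powR_gt0.
move=> x xab; have x01 : 0 < x < 1.
  by case/andP: xab => ax xb; rewrite (lt_le_trans a0)// (le_lt_trans xb).
rewrite on01_in// /kappa; apply: ler_pM; rewrite ?powR_ge0 ?(ltW m0) ?mP//.
have /andP[h1 _] := mdP x xab.
apply: ge0_ler_powR; rewrite ?nnegrE ?(ltW md0) ?(ltW (d_gt0 x01))//.
by rewrite invr_ge0 subr_ge0 ltW// (st_p H).
Qed.

Lemma kappa_ge0 x : 0 <= on01 (kappa p d h) x.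
Proof.
have [x01|x01] := pselect (0 < x < 1); last by rewrite on01_out.
by rewrite on01_in// mulr_ge0 ?powR_ge0// ltW// h_gt0.
Qed.

Lemma integrable_speed c : mu.-integrable setT (EFin \o (fun t => c * on01 g t - on01 f t)).
Proof.
have [C [fC gC _]] := bounds.
have := integrableB measurableT
  (integrableZl measurableT c (integrable_on01 (st_gb H) gC)) (integrable_on01 (st_fb H) fC).
by apply: eq_integrable.
Qed.

Lemma prim_speed c x :
  prim (fun t => c * on01 g t - on01 f t) x = c * prim (on01 g) x - prim (on01 f) x.
Proof.
have [C [fC gC _]] := bounds.
have sub m : mu.-integrable setT (EFin \o m) -> mu.-integrable `]-oo, x] (EFin \o m).
  exact: integrable_sub.
have ig := sub _ (integrable_on01 (st_gb H) gC).
rewrite /prim RintegralB//; last exact: sub _ (integrable_on01 (st_fb H) fC).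
  by rewrite RintegralZl.
have := integrableZl _ c ig; exact.
Qed.

Lemma oint_speed c a b : 0 <= a <= 1 -> 0 <= b <= 1 ->
  oint a b (fun t => c * g t - f t) =
  (c * prim (on01 g) b - prim (on01 f) b) - (c * prim (on01 g) a - prim (on01 f) a).
Proof.
move=> /andP[a0 a1] /andP[b0 b1]; rewrite -!prim_speed; apply: oint_primE.
  exact: integrable_speed.
move=> t; rewrite gt_min lt_max => /andP[h1 h2].
have t01 : 0 < t < 1.
  apply/andP; split.
    by case/orP: h1; [exact: le_lt_trans a0|exact: le_lt_trans b0].
  by case/orP: h2 => h2; [exact: lt_le_trans h2 a1|exact: lt_le_trans h2 b1].
by rewrite !on01_in.
Qed.

Lemma continuous_drift c x :
  {for x, continuous (fun t : R => c * prim (on01 g) t - prim (on01 f) t : R)}.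
Proof.
have [C [fC gC _]] := bounds.
exact: continuous_prim_scale_sub (integrable_on01 (st_fb H) fC) (integrable_on01 (st_gb H) gC).
Qed.

Lemma is_derive_drift c x : ~ T x ->
  is_derive x 1 (fun t : R => c * prim (on01 g) t - prim (on01 f) t : R)
    (c * on01 g x - on01 f x).
Proof.
move=> Tx; have [C [fC gC _]] := bounds.
apply: (is_derive_prim_scale_sub c (integrable_on01 (st_fb H) fC) (integrable_on01 (st_gb H) gC)).
  by apply: (continuous_on01 Tx) => x01; have [] := continuous_outside x01 Tx.
by apply: (continuous_on01 Tx) => x01; have [] := continuous_outside x01 Tx.
Qed.

Section Travelling.
Variable v : R -> R.
Hypothesis vc : continuous v.
Hypothesis v01 : forall z, 0 <= v z <= 1.

Lemma reaction_ge0 z : 0 <= h (v z).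
Proof.
have := v01 z; move: (v z) => x x01; have [xo|xo] := pselect (0 < x < 1).
  by apply: ltW; exact: h_gt0.
by rewrite -on01_h// on01_out.
Qed.

(** On a bounded window h o v is bounded and measurable, although v may stay at
    levels where h is discontinuous; Q is its primitive there. On the whole line
    it is not known to be integrable. *)
Lemma reaction_window a b : exists Q : R -> R, [/\ continuous Q,
  (forall z1 z2, a <= z1 <= b -> a <= z2 <= b -> oint z1 z2 (fun z => h (v z)) = Q z2 - Q z1),
  (forall z, a < z < b -> {for z, continuous (fun z => h (v z))} ->
     is_derive z 1 Q (h (v z))) &
  forall z1 z2 l : R, a <= z1 -> z1 <= z2 -> z2 <= b ->
    (forall z, z1 <= z <= z2 -> l <= h (v z)) -> l * (z2 - z1) <= Q z2 - Q z1].
Proof.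
have [C [_ _ hC]] := bounds.
have hvE : (fun z => h (v z)) = on01 h \o v.
  by apply/funext => z /=; rewrite on01_h.
have mh : measurable_fun setT (fun z => h (v z)).
  rewrite hvE; apply: measurableT_comp; first exact: Linfty01_measurable (st_hb H).
  exact: continuous_measurable_fun.
pose w := (fun z => h (v z)) \_ `[a, b].
have iw : mu.-integrable setT (EFin \o w).
  apply: integrable_patch => //; apply: (@integrable_bounded _ _ _ _ C).
    exact: measurable_funS mh.
  by move=> x _; rewrite -on01_h.
exists (prim w); split.
- exact: continuous_prim.
- move=> z1 z2 /andP[h1 h2] /andP[h3 h4]; apply: oint_primE => // t.
  rewrite gt_min lt_max => /andP[h5 h6]; rewrite /w patch_in//= in_itv/=.
  apply/andP; split.
    by case/orP: h5 => ?; apply: ltW; [exact: le_lt_trans h1 _|exact: le_lt_trans h3 _].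
  by case/orP: h6 => h6; apply: ltW; [exact: lt_le_trans h6 h2|exact: lt_le_trans h6 h4].
- move=> z /andP[az zb] cz; have -> : h (v z) = w z.
    by rewrite /w patch_in//= in_itv/= !ltW.
  apply: is_derive_prim => //.
  apply/cvgrPdist_lt => e e0.
  have H1 : \forall t \near z, a < t by exact: lt_nbhsr.
  have H2 : \forall t \near z, t < b by exact: lt_nbhsl.
  have H3 : \forall t \near z, `|h (v z) - h (v t)| < e by move/cvgrPdist_lt : cz; exact.
  move: H1 H2 H3; apply: filterS3 => t h1 h2.
  by rewrite /w !patch_in//= in_itv/= !ltW.
- move=> z1 z2 m az1 z12 z2b mh'; rewrite primB//.
  have -> : m * (z2 - z1) = \int[mu]_(x in `]z1, z2]) (cst m x).
    rewrite Rintegral_cst//= lebesgue_measure_itv/= lte_fin.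
    move: z12; rewrite le_eqVlt => /orP[/eqP->|->//].
    by rewrite ltxx subrr.
  apply: le_Rintegral => //.
  + apply: (@integrable_sub _ _ _ `[z1, z2]) => //.
      by apply: subset_itvr; rewrite bnd_simp.
    by apply: (@integrable_bounded _ _ _ _ `|m|) => //; exact: measurable_cst.
  + exact: integrable_sub iw.
  + move=> z /=; rewrite in_itv/= => /andP[h1 h2].
    rewrite /w patch_in/=; first by apply: mh'; rewrite (ltW h1).
    by rewrite in_itv/= (le_trans az1 (ltW h1)) (le_trans h2).
Qed.

End Travelling.

End Standing.

(** * From a front to its first-order profile *)

Section Crossing.
Variable R : realType.
Implicit Types (u : R -> R) (a x l : R).

Lemma derive_ge0_left u a x l : is_derive x 1 u l -> a < x -> u x = 0 ->
  (forall s, a <= s -> s < x -> u s < 0) -> 0 <= l.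
Proof.
move=> dl ax ux uneg; rewrite leNgt; apply/negP => l0.
have e0 : 0 < - l / 2 by lra.
have /nbhs_ballP[r /= r0 Hr] := is_derive_near dl e0.
pose s := Num.max a (x - r / 2).
have sx : s < x by rewrite gt_max ax/=; lra.
have as_ : a <= s by rewrite le_max lexx.
have rs : x - r / 2 <= s by rewrite le_max lexx orbT.
have sr : ball x r s by rewrite /ball/= gtr0_norm; lra.
have := Hr s sr; rewrite (ltr0_norm (x := s - x)) ?subr_lt0//.
rewrite ux subr0 opprB ler_norml => /andP[+ _].
have := uneg s as_ sx => us.
have : 0 < (- l) * (x - s) by rewrite mulr_gt0; lra.
lra.
Qed.

Lemma ninfty_near (P : R -> Prop) : (\forall z \near -oo%R, P z) ->
  exists M, forall z, z < M -> P z.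
Proof. by case=> M [_ HM]; exists M. Qed.

Lemma pinfty_near (P : R -> Prop) : (\forall z \near +oo%R, P z) ->
  exists M, forall z, M < z -> P z.
Proof. by case=> M [_ HM]; exists M. Qed.

End Crossing.

Section FromSolution.
Variables (R : realType) (p : R) (f g h d : R -> R) (c : R) (v Phi : R -> R).
Hypothesis H : standing p f g h d.
Notation T := (Theta_star f g h d).
Hypothesis vc : continuous v.
Hypothesis v01 : forall z, 0 <= v z <= 1.
Hypothesis vC1 : C1_on (~` (v @^-1` T)) v.
Hypothesis v_ninfty : v z @[z --> -oo%R] --> (1 : R).
Hypothesis v_pinfty : v z @[z --> +oo%R] --> (0 : R).
Hypothesis Phic : continuous Phi.
Hypothesis PhiE : forall I : interval R, open [set` I] -> C1_on [set` I] v ->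
  forall z, z \in I -> Phi z = d (v z) * `|derive1 v z| `^ (p - 2) * derive1 v z.
Hypothesis Phi_ninfty : Phi z @[z --> -oo%R] --> (0 : R).
Hypothesis Phi_pinfty : Phi z @[z --> +oo%R] --> (0 : R).
Hypothesis Phi01 : forall z, v z = 0 \/ v z = 1 -> Phi z = 0.
Hypothesis Phi_balance : forall z1 z2, Phi z2 - Phi z1
  + oint (v z1) (v z2) (fun x => c * g x - f x) + oint z1 z2 (fun z => h (v z)) = 0.

Let B x := c * prim (on01 g) x - prim (on01 f) x.

Let p1 : 1 < p := st_p H.

Let finT : finite_set T := finite_Theta_star H.

Lemma balance_window a b : exists Q : R -> R, [/\ continuous Q,
  (forall z1 z2, a <= z1 <= b -> a <= z2 <= b ->
     Phi z2 - Phi z1 + (B (v z2) - B (v z1)) + (Q z2 - Q z1) = 0),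
  (forall z, a < z < b -> {for z, continuous (fun z => h (v z))} ->
     is_derive z 1 Q (h (v z))) &
  forall z1 z2 l : R, a <= z1 -> z1 <= z2 -> z2 <= b ->
    (forall z, z1 <= z <= z2 -> l <= h (v z)) -> l * (z2 - z1) <= Q z2 - Q z1].
Proof.
have [Q [cQ QE dQ lowQ]] := reaction_window H vc v01 a b.
exists Q; split => // z1 z2 z1ab z2ab.
by rewrite -(Phi_balance z1 z2) QE// (oint_speed H).
Qed.

Lemma flux_regular z : ~ T (v z) -> exists l, is_derive z 1 v l /\
  Phi z = d (v z) * `|l| `^ (p - 2) * l.
Proof.
move=> Tz; pose A := ~` (v @^-1` T).
have oA : open A.
  apply: closed_openC; apply: closed_comp => [x _|]; first exact: vc.
  exact: compact_closed (finite_compact finT).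
have /nbhs_ballP[e /= e0 He] : nbhs z A by apply: open_nbhs_nbhs.
have zI : z \in `]z - e, z + e[ by rewrite in_itv/=; apply/andP; split; lra.
have C1I : C1_on [set` `]z - e, z + e[] v.
  move=> t /=; rewrite in_itv/= => /andP[t1 t2]; apply: vC1; apply: He.
  by rewrite /ball/= ltr_norml; apply/andP; split; lra.
exists (derive1 v z); split.
  by rewrite derive1E; apply: derivableP; exact: (vC1 Tz).1.
exact: (PhiE (interval_open _ _) C1I zI).
Qed.

Lemma mid_nbhs z : 0 < v z < 1 -> exists r k : R, [/\ 0 < r, 0 < k &
  forall t, `|t - z| <= r -> 0 < v t < 1 /\ k <= h (v t)].
Proof.
move=> /andP[vz0 vz1].
have H1 : \forall t \near z, v z / 2 < v t.
  have := @vc z; move/cvgrPdist_lt => /(_ (v z / 2)); rewrite divr_gt0// => /(_ isT).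
  by apply: filterS => t /ltr_normlP[_]; lra.
have H2 : \forall t \near z, v t < (1 + v z) / 2.
  have := @vc z; move/cvgrPdist_lt => /(_ ((1 - v z) / 2)).
  rewrite divr_gt0 ?subr_gt0// => /(_ isT).
  by apply: filterS => t /ltr_normlP[]; lra.
have : \forall t \near z, v z / 2 < v t /\ v t < (1 + v z) / 2.
  by move: H1 H2; apply: filterS2.
move=> /nbhs_ballP[r /= r0 Hr].
have z20 : 0 < v z / 2 by lra.
have z21 : (1 + v z) / 2 < 1 by lra.
have [k k0 hk] := h_low H z20 z21.
exists (r / 2), k; split => //; first by lra.
move=> t tr; have [h1 h2] := Hr t ltac:(rewrite /ball/= distrC; lra).
split; first by apply/andP; split; lra.
by apply: hk; rewrite !ltW.
Qed.

Lemma reaction_increment_gt0 a b Q z1 z2 :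
  (forall z1 z2 l : R, a <= z1 -> z1 <= z2 -> z2 <= b ->
    (forall z, z1 <= z <= z2 -> l <= h (v z)) -> l * (z2 - z1) <= Q z2 - Q z1) ->
  a <= z1 -> z1 < z2 -> z2 <= b -> 0 < v z1 < 1 -> 0 < Q z2 - Q z1 :> R.
Proof.
move=> lowQ az1 z12 z2b /mid_nbhs[r [k [r0 k0 Hr]]].
pose s := Num.min z2 (z1 + r).
have z1s : z1 < s by rewrite lt_min z12 ltrDl.
have sz2 : s <= z2 by rewrite ge_min lexx.
have s1 : s <= z1 + r by rewrite ge_min lexx orbT.
have A1 : k * (s - z1) <= Q s - Q z1.
  apply: lowQ => //; [exact: ltW|exact: le_trans z2b|].
  move=> z /andP[h1 h2]; apply: (Hr z _).2; rewrite ger0_norm; lra.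
have A2 : 0 * (z2 - s) <= Q z2 - Q s.
  apply: lowQ => //; first exact: le_trans (ltW z1s).
  by move=> z _; exact: (reaction_ge0 H).
have : 0 < k * (s - z1) by rewrite mulr_gt0// subr_gt0.
rewrite mul0r in A2; lra.
Qed.

(** Suppose that v rises, and let m be a regular level in between. As v starts
    from 1 it first crosses m downwards, where Phi <= 0, and later upwards, where
    Phi >= 0. But between two points of the same level the balance reduces to the
    loss of flux caused by the reaction: Phi must strictly decrease. *)
Lemma front_nonincreasing z1 z2 : z1 <= z2 -> v z2 <= v z1.
Proof.
rewrite le_eqVlt => /orP[/eqP->//|z12]; rewrite leNgt; apply/negP => v12.
have [m /andP[m1 m2] Tm] := avoid_finite finT v12.
have m0 : 0 < m by apply: le_lt_trans m1; case/andP: (v01 z1).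
have m1' : m < 1 by apply: lt_le_trans m2 _; case/andP: (v01 z2).
have [M HM] : exists M, forall z, z < M -> m < v z.
  apply: ninfty_near; move/cvgrPdist_lt : v_ninfty => /(_ (1 - m)).
  by rewrite subr_gt0 => /(_ m1'); apply: filterS => z /ltr_normlP[_]; lra.
pose z0 := Num.min (M - 1) (z1 - 1).
have z01 : z0 < z1 by rewrite gt_min; apply/orP; right; lra.
have z0M : z0 < M by rewrite gt_min; apply/orP; left; lra.
have [|||a0 [za0 az1 ua uneg]] := @first_zero _ (fun z => m - v z) z0 z1 z01.
- by move=> x _; exact: (continuous_at_sub (@continuous_at_const _ m x) (@vc x)).
- by rewrite subr_lt0; exact: HM.
- by rewrite subr_ge0 ltW.
have va : v a0 = m by apply/eqP; rewrite eq_sym -subr_eq0 ua.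
have [|||t [z1t tz2 ut tneg]] := @first_zero _ (fun z => v z - m) z1 z2 z12.
- by move=> x _; exact: (continuous_at_sub (@vc x) (@continuous_at_const _ m x)).
- by rewrite subr_lt0.
- by rewrite subr_ge0 ltW.
have vt : v t = m by apply/eqP; rewrite -subr_eq0 ut.
have [la [dla Pa]] := @flux_regular a0 ltac:(by rewrite va).
have [lt [dlt Pt]] := @flux_regular t ltac:(by rewrite vt).
have la0 : la <= 0.
  have := @derive_ge0_left _ (fun z => m - v z) z0 a0 (0 - la)
    (is_derive1_sub (is_derive1_const m a0) dla) za0 ua uneg; lra.
have lt0 : 0 <= lt.
  have := @derive_ge0_left _ (fun z => v z - m) z1 t (lt - 0)
    (is_derive1_sub dlt (is_derive1_const m t)) z1t ut tneg; lra.
have dm : 0 < d m by apply: (d_gt0 H); rewrite m0.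
have Pa0 : Phi a0 <= 0.
  by rewrite Pa va mulr_ge0_le0// mulr_ge0 ?powR_ge0// ltW.
have Pt0 : 0 <= Phi t.
  by rewrite Pt vt !mulr_ge0 ?powR_ge0// ltW.
have a0t : a0 < t by exact: le_lt_trans az1 z1t.
have [Q [cQ QE dQ lowQ]] := balance_window a0 t.
have := QE a0 t; rewrite !lexx (ltW a0t) => /(_ isT isT).
have := reaction_increment_gt0 lowQ (lexx _) a0t (lexx _).
rewrite va vt m0 m1' subrr => /(_ isT); lra.
Qed.

(** On a plateau the flux would vanish identically, while the reaction keeps
    consuming it. *)
Lemma front_not_flat z1 z2 : z1 < z2 -> 0 < v z1 < 1 -> v z1 <> v z2.
Proof.
move=> z12 vz1 E.
have cst t : z1 < t < z2 -> v t = v z1.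
  move=> /andP[h1 h2]; apply/eqP; rewrite eq_le front_nonincreasing ?(ltW h1)//.
  by rewrite E front_nonincreasing// ltW.
have near_cst t : z1 < t < z2 -> \forall s \near t, z1 < s < z2.
  move=> /andP[h1 h2].
  have H1 : \forall s \near t, z1 < s by exact: lt_nbhsr.
  have H2 : \forall s \near t, s < z2 by exact: lt_nbhsl.
  by move: H1 H2; apply: filterS2 => s -> ->.
have dv t : z1 < t < z2 -> is_derive t 1 v 0.
  move=> tI; apply: (near_eq_is_derive (f := (fun=> v z1) : R -> R)).
  by have := near_cst t tI; apply: filterS => s sI; rewrite cst.
have d1v t : z1 < t < z2 -> derive1 v t = 0.
  by move=> tI; rewrite derive1E; have [_ ->] := dv t tI.
have C1 : C1_on [set` `]z1, z2[] v.
  move=> t /=; rewrite in_itv/= => tI; split; first by have [] := dv t tI.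
  apply/cvgrPdist_lt => e e0; have := near_cst t tI; apply: filterS => s sI.
  by rewrite !d1v// subrr normr0.
have P0 t : z1 < t < z2 -> Phi t = 0.
  by move=> tI; rewrite (PhiE (interval_open _ _) C1) ?in_itv//= d1v// mulr0.
pose t1 := z1 + (z2 - z1) / 3; pose t2 := z1 + (z2 - z1) * 2 / 3.
have t1I : z1 < t1 < z2 by rewrite /t1; apply/andP; split; lra.
have t2I : z1 < t2 < z2 by rewrite /t2; apply/andP; split; lra.
have t12 : t1 < t2 by rewrite /t1 /t2; lra.
have [Q [cQ QE dQ lowQ]] := balance_window t1 t2.
have := QE t1 t2; rewrite !lexx (ltW t12) => /(_ isT isT).
have := reaction_increment_gt0 lowQ (lexx _) t12 (lexx _).
rewrite !P0// !cst// vz1 => /(_ isT); lra.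
Qed.

Lemma front_decreasing z1 z2 : z1 < z2 -> 0 < v z1 < 1 \/ 0 < v z2 < 1 -> v z2 < v z1.
Proof.
move=> z12 vI; rewrite lt_neqAle front_nonincreasing ?(ltW z12)// andbT.
apply/eqP => E; apply: (front_not_flat z12) => //.
by case: vI => //; rewrite E.
Qed.

Lemma flux_regular_le0 z : 0 < v z < 1 -> ~ T (v z) -> exists l, [/\ is_derive z 1 v l,
  l <= 0 & Phi z = - (d (v z) * (- l) `^ (p - 1))].
Proof.
move=> vz Tz; have [l [dl Pl]] := flux_regular Tz.
have l0 : l <= 0.
  rewrite leNgt; apply/negP => l0; have l2 : 0 < l / 2 by lra.
  have /nbhs_ballP[r /= r0 Hr] := is_derive_near dl l2.
  have zr : ball z r (z + r / 2) by rewrite /ball/= ltr0_norm; lra.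
  have := Hr _ zr; have -> : z + r / 2 - z = r / 2 by ring.
  rewrite (gtr0_norm (x := r / 2)) ?divr_gt0// ler_norml => /andP[+ _].
  have : v (z + r / 2) <= v z by apply: front_nonincreasing; lra.
  have : 0 < l * r by rewrite mulr_gt0.
  lra.
exists l; split => //; rewrite Pl ler0_norm// -mulrA -mulrN; congr (_ * _).
move: l0; rewrite le_eqVlt => /orP[/eqP->|l0].
  by rewrite mulr0 oppr0 powR0 ?oppr0// gt_eqF// subr_gt0.
have -> : p - 1 = (p - 2) + 1 by ring.
rewrite (@powRD _ (- l) (p - 2) 1); last by rewrite oppr_eq0 (lt_eqF l0) implybT.
by rewrite powRr1 ?mulrN ?opprK// oppr_ge0 ltW.
Qed.

(** Strict monotonicity: near z0 the finitely many exceptional levels can be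
    met at z0 only. *)
Lemma near_regular z0 : 0 < v z0 < 1 -> exists2 r, 0 < r &
  forall z, `|z - z0| <= r -> z != z0 -> 0 < v z < 1 /\ ~ T (v z).
Proof.
move=> vz0; have [r [k [r0 k0 Hr]]] := mid_nbhs vz0.
have fD : finite_set (T `\ v z0) by apply: finite_setD.
have cD : open (~` (T `\ v z0)).
  by apply: closed_openC; exact: compact_closed (finite_compact fD).
have : \forall z \near z0, (~` (T `\ v z0)) (v z).
  apply: (@vc z0); apply: open_nbhs_nbhs; split => //.
  by move=> [_]; apply.
move=> /nbhs_ballP[e /= e0 He].
exists (Num.min r (e / 2)); first by rewrite lt_min r0 divr_gt0.
move=> z; rewrite le_min => /andP[zr ze] zz0.
have [vz _] := Hr z zr; split => // Tz.
have := He z ltac:(rewrite /ball/= distrC; lra); apply; split => // E.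
have [lt|lt|E'] := ltgtP z z0; last by rewrite E' eqxx in zz0.
  by have := front_decreasing lt (or_introl vz); rewrite E ltxx.
by have := front_decreasing lt (or_intror vz); rewrite E ltxx.
Qed.

Let B_lipschitz : exists2 C, 0 < C & forall x x', x <= x' -> B x' - B x <= C * (x' - x).
Proof.
have [C [fC gC _]] := bounds H.
have C0 : 0 <= C := le_trans (normr_ge0 _) (fC 0).
exists (`|c| * C + C + 1); first by rewrite ltr_wpDl// addr_ge0// mulr_ge0.
move=> x x' xx'; rewrite mulrBr.
apply: (@le_incr_off _ B ( *%R (`|c| * C + C + 1)) _ _ _ finT xx') => [y _|y _|y _ Ty].
- exact: continuous_drift H c y.
- exact: continuous_at_lin.
do 2 eexists; split; [exact: (is_derive_drift H c Ty)|exact: is_derive_lin|].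
apply: le_trans (ler_norm _) _; apply: le_trans (ler_normB _ _) _.
have h1 := fC y; have h2 : `|c * on01 g y| <= `|c| * C by rewrite normrM ler_wpM2l.
lra.
Qed.

(** If Phi z0 = 0 then the slope of v tends to 0 on the left of z0. On a short
    interval [z, z0] the convective term of the balance is then at most half of
    the reaction term k (z0 - z), which nothing compensates since Phi z <= 0. The
    level v z0 itself may be exceptional, so the slope at z0 is not available. *)
Lemma flux_lt0 z0 : 0 < v z0 < 1 -> Phi z0 < 0.
Proof.
move=> vz0; have [r1 r10 reg] := near_regular vz0.
have [r2 [k [r20 k0 Hk]]] := mid_nbhs vz0.
pose r := Num.min r1 r2; have r0 : 0 < r by rewrite lt_min r10.
have rr1 : r <= r1 by rewrite ge_min lexx.
have rr2 : r <= r2 by rewrite ge_min lexx orbT.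
have left_reg z : z0 - r <= z -> z < z0 -> [/\ 0 < v z < 1, ~ T (v z) & exists l,
    [/\ is_derive z 1 v l, l <= 0 & Phi z = - (d (v z) * (- l) `^ (p - 1))]].
  move=> zr zz0; have [||vz Tz] := reg z.
  - by rewrite ltr0_norm; lra.
  - by rewrite lt_eqF.
  by split => //; exact: flux_regular_le0.
have Phi_le0 z : z0 - r <= z -> z < z0 -> Phi z <= 0.
  move=> zr zz0; have [vz _ [l [_ _ ->]]] := left_reg z zr zz0.
  by rewrite oppr_le0 mulr_ge0 ?powR_ge0// ltW// (d_gt0 H).
rewrite ltNge; apply/negP => Phi0.
have Phiz0 : Phi z0 = 0.
  apply/eqP; rewrite eq_le Phi0 andbT leNgt; apply/negP => P0.
  have := @Phic z0; move/cvgrPdist_lt => /(_ _ P0) /nbhs_ballP[e /= e0 He].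
  pose z := Num.max (z0 - r) (z0 - e / 2).
  have zz0 : z < z0 by rewrite gt_max; apply/andP; split; lra.
  have zr : z0 - r <= z by rewrite le_max lexx.
  have ze : z0 - e / 2 <= z by rewrite le_max lexx orbT.
  have := He z ltac:(rewrite /ball/= gtr0_norm; lra).
  by move=> /ltr_normlP[_]; have := Phi_le0 z zr zz0; lra.
have [C C0 BC] := B_lipschitz.
have zr0 : z0 - r < z0 by lra.
have [vr _ _] := left_reg _ (lexx _) zr0.
have [dm [dM [dm0 dM0 dmM]]] := d_bounds H (a := v z0) (b := v (z0 - r))
  ltac:(by case/andP: vz0) ltac:(by case/andP: vr).
(* slopes below eps make the convective term at most half of the reaction *)
pose eps := k / (2 * C).
have eps0 : 0 < eps by rewrite divr_gt0// mulr_gt0.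
have De0 : 0 < dm * eps `^ (p - 1) by rewrite mulr_gt0// powR_gt0.
have := @Phic z0; move/cvgrPdist_lt => /(_ _ De0) /nbhs_ballP[e /= e0 He].
pose z := Num.max (z0 - r) (z0 - e / 2).
have zz0 : z < z0 by rewrite gt_max; apply/andP; split; lra.
have zr : z0 - r <= z by rewrite le_max lexx.
have ze : z0 - e / 2 <= z by rewrite le_max lexx orbT.
have slope s : z <= s -> s < z0 -> exists l, is_derive s 1 v l /\ - l <= eps.
  move=> zs sz0; have sr : z0 - r <= s by exact: le_trans zs.
  have [vs _ [l [dl l0 Pl]]] := left_reg s sr sz0; exists l; split => //.
  rewrite leNgt; apply/negP => el.
  have := He s ltac:(rewrite /ball/= gtr0_norm; lra).
  rewrite Phiz0 sub0r Pl opprK ger0_norm; last first.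
    by rewrite mulr_ge0 ?powR_ge0// ltW// (d_gt0 H).
  rewrite ltNge => /negP; apply.
  apply: ler_pM; rewrite ?powR_ge0 ?(ltW dm0)//.
    by have /andP[] := dmM (v s) ltac:(by rewrite !front_nonincreasing// ltW).
  apply: ge0_ler_powR; rewrite ?nnegrE ?subr_ge0 ?(ltW p1) ?(ltW eps0) ?(ltW el)//.
  by rewrite oppr_ge0.
have vup : - v z0 - - v z <= eps * z0 - eps * z.
  refine (@le_incr_off _ (fun s => - v s) ( *%R eps) set0 z z0 (@finite_set0 R) (ltW zz0) _ _ _)
    => [s _|s _|s /andP[zs sz0] _].
  - exact: (continuous_at_opp (@vc s)).
  - exact: continuous_at_lin.
  have [l [dl le]] := slope s (ltW zs) sz0.
  by exists (- l), eps; split; [exact: is_derive1_opp|exact: is_derive_lin|].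
have [Q [cQ QE dQ lowQ]] := balance_window z z0.
have := QE z z0; rewrite !lexx (ltW zz0) => /(_ isT isT).
have := lowQ z z0 k (lexx _) (ltW zz0) (lexx _).
have hk s : z <= s <= z0 -> k <= h (v s).
  move=> /andP[s1 s2]; apply: (Hk s _).2; rewrite ler0_norm; lra.
move=> /(_ hk); rewrite Phiz0.
have := BC _ _ (front_nonincreasing (ltW zz0)).
have := Phi_le0 z zr zz0.
have Ce : C * (v z - v z0) <= C * (eps * (z0 - z)) by rewrite ler_pM2l//; lra.
have E2 : C * (eps * (z0 - z)) = k * (z0 - z) / 2.
  by rewrite /eps; field; rewrite gt_eqF.
have : 0 < k * (z0 - z) by rewrite mulr_gt0// subr_gt0.
lra.
Qed.

Lemma front_surjective x : 0 < x < 1 -> exists z, v z = x.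
Proof.
move=> /andP[x0 x1].
have [M HM] : exists M, forall z, z < M -> x < v z.
  apply: ninfty_near; move/cvgrPdist_lt : v_ninfty => /(_ (1 - x)).
  by rewrite subr_gt0 => /(_ x1); apply: filterS => z /ltr_normlP[_]; lra.
have [N HN] : exists N, forall z, N < z -> v z < x.
  apply: pinfty_near; move/cvgrPdist_lt : v_pinfty => /(_ x x0).
  by apply: filterS => z /ltr_normlP[]; lra.
pose z1 := Num.max (M + 1) (N + 1).
have h1 : M - 1 < z1 by rewrite lt_max; apply/orP; left; lra.
have h2 : N < z1 by rewrite lt_max; apply/orP; right; lra.
have [|||t [_ _ ut _]] := @first_zero _ (fun z => x - v z) (M - 1) z1 h1.
- by move=> s _; exact: (continuous_at_sub (@continuous_at_const _ x s) (@vc s)).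
- by rewrite subr_lt0; apply: HM; lra.
- by rewrite subr_ge0 ltW// HN.
by exists t; apply/eqP; rewrite eq_sym -subr_eq0 ut.
Qed.

(** By strict monotonicity this is the inverse of v on ]0, 1[. *)
Let zeta x : R := xget 0 [set z | v z = x].

Let zetaK x : 0 < x < 1 -> v (zeta x) = x.
Proof.
by move=> /front_surjective[z vz]; rewrite /zeta; case: xgetP => // /(_ z).
Qed.

Let Kzeta z : 0 < v z < 1 -> zeta (v z) = z.
Proof.
move=> vz; have := zetaK vz; move: (zeta (v z)) => w vw.
have [lt|lt|//] := ltgtP w z.
  by have := front_decreasing lt (or_intror vz); rewrite vw ltxx.
by have := front_decreasing lt (or_introl vz); rewrite vw ltxx.
Qed.

Let y : R -> R := fun x => if 0 < x < 1 then - Phi (zeta x) else 0.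

Let y_front z : y (v z) = - Phi z.
Proof.
rewrite /y; case: ifPn => [/Kzeta->//|vz].
rewrite Phi01 ?oppr0//; have /andP[v0 v1] := v01 z.
move: vz; rewrite !lt_neqAle v0 v1 !andbT negb_and !negbK => /orP[/eqP E|/eqP E].
  by left.
by right.
Qed.

Let y_out x : ~ (0 < x < 1) -> y x = 0.
Proof. by rewrite /y; case: ifP. Qed.

(** At 0 and 1 no inverse of v is available. Instead: the points z with
    |Phi z| >= e form a compact set, because Phi vanishes at infinity, so the
    values of v on them form a closed set, which misses 0 and 1. *)
Let continuous_y : continuous y.
Proof.
move=> x0; apply/cvgrPdist_lt => e e0.
have [x01|x01] := pselect (0 < x0 < 1).
  have vz := zetaK x01; set z0 := zeta x0 in vz.
  have := @Phic z0; move/cvgrPdist_lt => /(_ _ e0) /nbhs_ballP[r /= r0 Hr].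
  have vz0 : 0 < v z0 < 1 by rewrite vz.
  have A1 : v (z0 + r / 2) < x0 by rewrite -vz; apply: front_decreasing; [lra|left].
  have A2 : x0 < v (z0 - r / 2) by rewrite -[X in X < _]vz; apply: front_decreasing; [lra|right].
  have H1 : \forall x \near x0, v (z0 + r / 2) < x by exact: lt_nbhsr.
  have H2 : \forall x \near x0, x < v (z0 - r / 2) by exact: lt_nbhsl.
  have H3 : \forall x \near x0, 0 < x < 1.
    case/andP: x01 => a1 a2.
    have H31 : \forall x \near x0, 0 < x by exact: lt_nbhsr.
    have H32 : \forall x \near x0, x < 1 by exact: lt_nbhsl.
    by move: H31 H32; apply: filterS2 => x -> ->.
  move: H1 H2 H3; apply: filterS3 => x h1 h2 xI.
  rewrite /y x01 xI -opprD normrN; apply: Hr.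
  have vx := zetaK xI; rewrite /ball/= ltr_norml; apply/andP; split.
    rewrite ltrBrDl ltNge; apply/negP => le.
    have : v (zeta x) <= v (z0 + r / 2) by apply: front_nonincreasing; lra.
    by rewrite vx leNgt h1.
  rewrite ltNge; apply/negP => le.
  have : v (z0 - r / 2) <= v (zeta x) by apply: front_nonincreasing; lra.
  by rewrite vx leNgt h2.
have [Z HZ] : exists Z, forall z, Z < `|z| -> `|Phi z| < e.
  have [M HM] : exists M, forall z, z < M -> `|Phi z| < e.
    apply: ninfty_near; move/cvgrPdist_lt : Phi_ninfty => /(_ e e0).
    by apply: filterS => z; rewrite sub0r normrN.
  have [N HN] : exists N, forall z, N < z -> `|Phi z| < e.
    apply: pinfty_near; move/cvgrPdist_lt : Phi_pinfty => /(_ e e0).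
    by apply: filterS => z; rewrite sub0r normrN.
  exists (Num.max (- M) N) => z; rewrite gt_max => /andP[h1 h2].
  have [z0|z0] := leP 0 z; first by apply: HN; move: h2; rewrite ger0_norm.
  by apply: HM; move: h1; rewrite ltr0_norm// ltrN2.
pose A := `[- Z, Z] `&` [set z | e <= `|Phi z|].
have cA : compact (v @` A).
  apply: continuous_compact; first exact/continuous_subspaceT.
  apply: compact_closedI; first exact: segment_compact.
  apply: (@closed_comp _ _ (fun z => `|Phi z|) [set u | e <= u]); last exact: closed_ge.
  move=> z _; apply: (@continuous_comp _ _ _ Phi (fun u => `|u| : R)); first exact: Phic.
  exact: norm_continuous.
have nA : ~ (v @` A) x0.
  move=> [z [_ /= ez] vz]; move: ez; rewrite -[Phi z]opprK -y_front vz y_out//.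
  by rewrite oppr0 normr0 leNgt e0.
have : nbhs x0 (~` (v @` A)).
  apply: open_nbhs_nbhs; split => //.
  by apply: closed_openC; exact: compact_closed cA.
apply: filterS => x nAx; rewrite y_out// sub0r normrN.
have [xI|xI] := pselect (0 < x < 1); last by rewrite y_out// normr0.
rewrite ltNge; apply/negP => ey; apply: nAx.
exists (zeta x); last exact: zetaK.
move: ey; rewrite /y xI normrN => ey; split => //=.
rewrite in_itv/= -ler_norml leNgt; apply/negP => /HZ.
by rewrite ltNge ey.
Qed.

(** The derivative of - Phi o zeta: differentiating the balance in z and dividing
    by the slope l of v gives c g - f + h / l, and l is recovered from y as
    - (y / d)^(1/(p-1)). *)
Let derivative_y x : 0 < x < 1 -> ~ T x ->
  is_derive x 1 y (c * on01 g x - on01 f x - on01 (kappa p d h) x * y x `^ (- (p - 1)^-1)).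
Proof.
move=> x01 Tx; have vz := zetaK x01; set z := zeta x in vz.
have vz01 : 0 < v z < 1 by rewrite vz.
have Tz : ~ T (v z) by rewrite vz.
have [l [dl l0 Pl]] := flux_regular_le0 vz01 Tz.
have P0 := flux_lt0 vz01.
have lneg : l < 0.
  rewrite lt_neqAle l0 andbT; apply/eqP => E; move: P0.
  by rewrite Pl E oppr0 powR0 ?mulr0 ?oppr0 ?ltxx// gt_eqF// subr_gt0.
have [r [k [r0 k0 Hr]]] := mid_nbhs vz01.
have near_mid : \forall t \near z, 0 < v t < 1.
  apply/nbhs_ballP; exists r => //= t; rewrite /ball/= distrC => tr.
  by have [] := Hr t (ltW tr).
have dzeta : is_derive (v z) 1 zeta l^-1.
  apply: is_derive_inverse; last by rewrite lt_eqF.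
  - apply: (@filterS _ (nbhs z) _ _ _ _ near_mid) => t tI; exact: Kzeta.
  - by apply: (@filterS _ (nbhs z) _ _ _ _ near_mid) => t _; exact: vc.
have [Q [cQ QE dQ lowQ]] := balance_window (z - 1) (z + 1).
have [cf cg ch cd] := continuous_outside x01 Tx.
have dPhi : is_derive z 1 Phi (- ((c * on01 g (v z) - on01 f (v z)) * l) - h (v z)).
  apply: (near_eq_is_derive (f := fun t => (Phi z + B (v z) + Q z) - B (v t) - Q t : R)).
    have H1 : \forall t \near z, z - 1 < t by apply: lt_nbhsr; lra.
    have H2 : \forall t \near z, t < z + 1 by apply: lt_nbhsl; lra.
    move: H1 H2; apply: filterS2 => t h1 h2.
    have := QE z t ltac:(by apply/andP; split; lra) ltac:(by apply/andP; split; lra).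
    lra.
  have zI : z - 1 < z < z + 1 by apply/andP; split; lra.
  have dQz := dQ z zI ltac:(by apply: continuous_comp; [exact: vc|rewrite vz]).
  have dBv : is_derive z 1 (fun t => B (v t)) ((c * on01 g (v z) - on01 f (v z)) * l).
    exact: (is_derive1_fun_comp (is_derive_drift H c Tz) dl).
  have := is_derive1_sub (is_derive1_sub (is_derive1_const (Phi z + B (v z) + Q z) z) dBv) dQz.
  by rewrite sub0r.
have dPhi' : is_derive (zeta (v z)) 1 Phi (- ((c * on01 g (v z) - on01 f (v z)) * l) - h (v z)).
  by rewrite Kzeta.
rewrite vz in dPhi' dzeta.
have := is_derive1_opp (is_derive1_comp dPhi' dzeta).
move=> dy; apply: (near_eq_is_derive (f := fun t => - (Phi \o zeta) t)).
  case/andP: x01 => a1 a2.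
  have H1 : \forall t \near x, 0 < t by exact: lt_nbhsr.
  have H2 : \forall t \near x, t < 1 by exact: lt_nbhsl.
  by move: H1 H2; apply: filterS2 => t h1 h2; rewrite /y h1 h2.
apply: is_derive_eq dy _.
have yx : y x = d x * (- l) `^ (p - 1) by rewrite -vz y_front Pl opprK vz.
have pm1 : p - 1 != 0 by rewrite subr_eq0 gt_eqF.
have nl0 : 0 < - l by rewrite oppr_gt0.
have ya : y x `^ (- (p - 1)^-1) = (d x `^ (p - 1)^-1)^-1 * (- l)^-1.
  rewrite yx powRM ?powR_ge0 ?(ltW (d_gt0 H x01))// -powRrM mulrN mulfV//.
  by rewrite powRN powR_inv1// ltW.
have da : d x `^ (p - 1)^-1 != 0 by rewrite gt_eqF// powR_gt0// (d_gt0 H x01).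
rewrite ya [on01 (kappa p d h) x]on01_in// /kappa.
by field; rewrite da lt_eqF.
Qed.

Lemma front_profile_of_solution : exists y : R -> R,
  front_profile p (on01 f) (on01 g) (on01 (kappa p d h)) T c y /\ y 0 = 0.
Proof.
exists y; split; last by rewrite y_out// ltxx.
split; [exact: continuous_y|by rewrite y_out// ltxx andbF| |exact: derivative_y].
move=> x x01; rewrite -(zetaK x01) y_front oppr_gt0; apply: flux_lt0.
by rewrite zetaK.
Qed.

End FromSolution.

Lemma solution_front_profile (R : realType) (p : R) (f g h d : R -> R) (c : R) (v : R -> R) :
  standing p f g h d -> solution p f g h d c v -> exists y : R -> R,
  front_profile p (on01 f) (on01 g) (on01 (kappa p d h)) (Theta_star f g h d) c y /\ y 0 = 0.
Proof.
move=> H [vc v01 vC1 vm vp [Phi [Pc PE [Pm Pp] P01 PI]]].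
exact: (front_profile_of_solution H vc v01 vC1 vm vp Pc PE Pm Pp P01 PI).
Qed.

(** * From a first-order profile to a front *)

Lemma derive_at_min (R : realType) (u : R -> R) (z l : R) : is_derive z 1 u l ->
  (forall t, u z <= u t) -> l = 0.
Proof.
move=> dl umin; apply/eqP; rewrite eq_le; apply/andP; split; rewrite leNgt; apply/negP => l0.
- have l2 : 0 < l / 2 by lra.
  have /nbhs_ballP[r /= r0 Hr] := is_derive_near dl l2.
  have zr : ball z r (z - r / 2) by rewrite /ball/= gtr0_norm; lra.
  have := Hr _ zr; have -> : z - r / 2 - z = - (r / 2) by ring.
  rewrite normrN (gtr0_norm (x := r / 2)) ?divr_gt0// ler_norml => /andP[_ +].
  have := umin (z - r / 2); have : 0 < l * r by rewrite mulr_gt0.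
  lra.
- have l2 : 0 < - l / 2 by lra.
  have /nbhs_ballP[r /= r0 Hr] := is_derive_near dl l2.
  have zr : ball z r (z + r / 2) by rewrite /ball/= ltr0_norm; lra.
  have := Hr _ zr; have -> : z + r / 2 - z = r / 2 by ring.
  rewrite (gtr0_norm (x := r / 2)) ?divr_gt0// ler_norml => /andP[_ +].
  have := umin (z + r / 2); have : 0 < - l * r by rewrite mulr_gt0// oppr_gt0.
  lra.
Qed.

Section FromProfile.
Variables (R : realType) (p : R) (f g h d : R -> R) (c : R) (y : R -> R).
Hypothesis H : standing p f g h d.
Notation T := (Theta_star f g h d).
Notation mu := (@lebesgue_measure R).
Hypothesis yP : front_profile p (on01 f) (on01 g) (on01 (kappa p d h)) T c y.
Hypothesis y0 : y 0 = 0.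

Let p1 : 1 < p := st_p H.
Let a := (p - 1)^-1.
Let a0 : 0 < a. Proof. by rewrite invr_gt0 subr_gt0. Qed.
Let yc : continuous y. Proof. by case: yP. Qed.
Let y1 : y 1 = 0. Proof. by case: yP. Qed.
Let ypos x : 0 < x < 1 -> 0 < y x. Proof. by case: yP => _ _ + _; apply. Qed.
Let finT : finite_set T := finite_Theta_star H.

(** The front solves v' = - 1 / psi(v), as its flux is y(v); so z is recovered as
    a function zeta of the value of v by integrating - psi. *)
Let psi x := d x `^ a * y x `^ (- a).

Let psi_gt0 x : 0 < x < 1 -> 0 < psi x.
Proof.
by move=> x01; rewrite mulr_gt0// powR_gt0//; [exact: (d_gt0 H)|exact: ypos].
Qed.

Let psi_flux x : 0 < x < 1 -> d x * (psi x)^-1 `^ (p - 1) = y x.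
Proof.
move=> x01; have dx := d_gt0 H x01; have yx := ypos x01.
have dV : (d x)^-1 `^ a = (d x `^ a)^-1 by rewrite -powR_inv1 ?(ltW dx)// -powRrM mulN1r powRN.
have -> : (psi x)^-1 = (y x * (d x)^-1) `^ a.
  by rewrite (powRM _ (ltW yx)) ?invr_ge0 ?(ltW dx)// dV /psi powRN invfM invrK mulrC.
rewrite -powRrM mulVf ?subr_eq0 ?(gt_eqF p1)// powRr1.
  by rewrite mulrCA mulfV ?mulr1// gt_eqF.
by rewrite mulr_ge0 ?invr_ge0 ?ltW.
Qed.

Let psi_cont x : 0 < x < 1 -> {for x, continuous d} -> {for x, continuous psi}.
Proof.
move=> x01 cd; apply: (continuous_at_mul (f := fun x => d x `^ a) (g := fun x => y x `^ (- a))).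
- apply: (@continuous_comp _ _ _ d (fun u => u `^ a)) => //.
  exact: (continuous_powR (d_gt0 H x01)).
- apply: (@continuous_comp _ _ _ y (fun u => u `^ (- a))); first exact: yc.
  exact: (continuous_powR (ypos x01)).
Qed.

Let psi_bound l u : 0 < l -> u < 1 -> exists2 M, 0 < M & forall x, l <= x <= u -> psi x <= M.
Proof.
move=> l0 u1; have [lu|ul] := leP l u; last first.
  by exists 1 => // x /andP[h1 h2]; have := le_trans h1 h2; rewrite leNgt ul.
have [dm [dM [dm0 dM0 dmM]]] := d_bounds H l0 u1.
have [x0 x0I ymin] := EVT_min lu (continuous_subspaceT yc).
have x01 : 0 < x0 < 1.
  by move: x0I; rewrite in_itv/= => /andP[h1 h2]; rewrite (lt_le_trans l0)//= (le_lt_trans h2).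
exists (dM `^ a * y x0 `^ (- a)); first by rewrite mulr_gt0// powR_gt0// ypos.
move=> x xI; have x01' : 0 < x < 1.
  by case/andP: xI => h1 h2; rewrite (lt_le_trans l0)//= (le_lt_trans h2).
apply: ler_pM; rewrite ?powR_ge0//.
  have /andP[_ dx] := dmM x xI.
  by apply: ge0_ler_powR; rewrite ?nnegrE ?(ltW a0) ?(ltW dM0) ?(ltW (d_gt0 H x01')).
apply: ler_powRN; [exact: ltW|exact: ypos|apply: ymin; by rewrite in_itv].
Qed.

(** The function d is not assumed measurable: measurability of psi comes from
    that of kappa, through psi = kappa / h * y^(-a). *)
Let psi_integrable l u : 0 < l -> u < 1 -> mu.-integrable setT (EFin \o (psi \_ `[l, u])).
Proof.
move=> l0 u1; have [M M0 HM] := psi_bound l0 u1.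
have sub : `[l, u] `<=` `]0, 1[.
  move=> x /=; rewrite !in_itv/= => /andP[h1 h2].
  by rewrite (lt_le_trans l0)//= (le_lt_trans h2).
have psiE x : `[l, u]%classic x -> psi x = kappa p d h x * (on01 h x `^ (-1) * y x `^ (- a)).
  move=> /sub /=; rewrite in_itv/= => x01.
  rewrite on01_in// powR_inv1 ?(ltW (h_gt0 H x01))// /psi /kappa -/a.
  by field; rewrite gt_eqF// (h_gt0 H).
have mk : measurable_fun `[l, u] (kappa p d h).
  have /integrableP[/measurable_EFinP mk _] := st_k H.
  exact: measurable_funS mk.
have mh : measurable_fun `[l, u] (fun x => on01 h x `^ (-1)).
  have mh := measurableT_comp (@measurable_powR R (-1)) (Linfty01_measurable (st_hb H)).
  exact: measurable_funS mh.
have my : measurable_fun `[l, u] (fun x => y x `^ (- a)).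
  have my := measurableT_comp (@measurable_powR R (- a)) (continuous_measurable_fun yc).
  exact: measurable_funS my.
apply: integrable_patch => //; apply: (@integrable_bounded _ _ _ _ M).
  have := measurable_funM mk (measurable_funM mh my).
  by apply: eq_measurable_fun => x; rewrite inE => xI; rewrite psiE.
move=> x xI; rewrite ger0_norm ?HM//; apply/ltW/psi_gt0.
by case/andP: xI => h1 h2; rewrite (lt_le_trans l0)//= (le_lt_trans h2).
Qed.

(** The choice of 1 / 2 fixes the translation of the front: v 0 = 1 / 2. *)
Let zeta x := - oint (1 / 2) x psi.

Let zeta_local x : 0 < x < 1 -> exists l u K, [/\ 0 < l, u < 1, l < x < u &
  forall t, l <= t <= u -> zeta t = K - prim (psi \_ `[l, u]) t].
Proof.
move=> /andP[x0 x1].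
pose l := Num.min (x / 2) (1 / 2); pose u := Num.max ((1 + x) / 2) (1 / 2).
have l0 : 0 < l by rewrite lt_min; apply/andP; split; lra.
have u1 : u < 1 by rewrite gt_max; apply/andP; split; lra.
have lx : l < x by rewrite gt_min; apply/orP; left; lra.
have xu : x < u by rewrite lt_max; apply/orP; left; lra.
have l2 : l <= 1 / 2 by rewrite ge_min lexx orbT.
have u2 : 1 / 2 <= u by rewrite le_max lexx orbT.
exists l, u, (prim (psi \_ `[l, u]) (1 / 2)); split => //; first by rewrite lx.
move=> t /andP[lt tu]; rewrite /zeta (@oint_primE _ (psi \_ `[l, u])) ?opprB//.
  exact: psi_integrable.
move=> s; rewrite gt_min lt_max => /andP[h1 h2]; rewrite patch_in//= in_itv/=.
apply/andP; split.
  by case/orP: h1 => h1; apply: ltW; [exact: le_lt_trans h1|exact: le_lt_trans h1].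
by case/orP: h2 => h2; apply: ltW; [exact: lt_le_trans h2 _|exact: lt_le_trans h2 _].
Qed.

Let near_itv (l x u : R) : l < x < u -> \forall t \near x, l < t < u.
Proof.
move=> /andP[lx xu].
have H1 : \forall t \near x, l < t by exact: lt_nbhsr.
have H2 : \forall t \near x, t < u by exact: lt_nbhsl.
by move: H1 H2; apply: filterS2 => t -> ->.
Qed.

Let zeta_cont x : 0 < x < 1 -> {for x, continuous zeta}.
Proof.
move=> /zeta_local[l [u [K [l0 u1 lxu zE]]]].
have cp := continuous_at_sub (@continuous_at_const _ K x)
  (@continuous_prim _ _ (psi_integrable l0 u1) x).
apply/cvgrPdist_lt => e e0.
have zx : zeta x = K - prim (psi \_ `[l, u]) x.
  by apply: zE; case/andP: lxu => h1 h2; rewrite !ltW.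
have H1 : \forall t \near x, `|(K - prim (psi \_ `[l, u]) x) - (K - prim (psi \_ `[l, u]) t)| < e.
  by move/cvgrPdist_lt : cp; exact.
move: H1 (near_itv lxu); apply: filterS2 => t.
by rewrite zx => ? /andP[h1 h2]; rewrite zE// !ltW.
Qed.

Let zeta_derive x : 0 < x < 1 -> {for x, continuous d} -> is_derive x 1 zeta (- psi x).
Proof.
move=> x01 cd; have [l [u [K [l0 u1 lxu zE]]]] := zeta_local x01.
apply: (near_eq_is_derive (f := fun t => K - prim (psi \_ `[l, u]) t : R)).
  by apply: filterS (near_itv lxu) => t /andP[h1 h2]; rewrite zE// !ltW.
have xI : `[l, u]%classic x by case/andP: lxu => h1 h2; rewrite /= in_itv/= !ltW.
have cpsi : {for x, continuous (psi \_ `[l, u])}.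
  have cp := psi_cont x01 cd; apply/cvgrPdist_lt => e e0.
  have H1 : \forall t \near x, `|psi x - psi t| < e by move/cvgrPdist_lt : cp; exact.
  move: H1 (near_itv lxu); apply: filterS2 => t ? /andP[h1 h2].
  by rewrite !patch_in//= in_itv/= !ltW.
have := is_derive1_sub (is_derive1_const K x) (is_derive_prim (psi_integrable l0 u1) cpsi).
by rewrite sub0r patch_in.
Qed.

Let continuous_d x : 0 < x < 1 -> ~ T x -> {for x, continuous d}.
Proof. by move=> x01 Tx; have [] := continuous_outside x01 Tx. Qed.

Let zeta_decreasing x x' : 0 < x -> x < x' -> x' < 1 -> zeta x' < zeta x.
Proof.
move=> x0 xx' x'1; rewrite -ltrN2.
apply: (increasing_off (f := fun t => - zeta t) finT xx') => [t /andP[h1 h2]|t /andP[h1 h2] Tt].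
  by apply: continuous_at_opp; apply: zeta_cont; rewrite (lt_le_trans x0)//= (le_lt_trans h2).
have t01 : 0 < t < 1 by rewrite (lt_trans x0)//= (lt_trans h2).
exists (- - psi t); first exact: is_derive1_opp (zeta_derive t01 (continuous_d t01 Tt)).
by rewrite opprK psi_gt0.
Qed.

(** The generalized inverse of zeta. The range of zeta may be bounded on either
    side; there v is continued by the constants 1 and 0, the latter being why 0
    is added to the set. *)
Let above z := [set x | 0 < x < 1 /\ z < zeta x] `|` [set 0].
Let v z := sup (above z).

Let above_sup z : has_sup (above z).
Proof.
split; first by exists 0; right.
by exists 1 => x [[/andP[_ /ltW]]//|->]; exact: ler01.
Qed.

Let v01 z : 0 <= v z <= 1.
Proof.
apply/andP; split; first by apply: (ub_le_sup (above_sup z).2); right.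
apply: ge_sup; first by case: (above_sup z).
by move=> x [[/andP[_ /ltW]]//|->]; exact: ler01.
Qed.

Let v_ge z x : 0 < x < 1 -> z < zeta x -> x <= v z.
Proof. by move=> x01 zx; apply: (ub_le_sup (above_sup z).2); left. Qed.

Let v_le z x : 0 < x < 1 -> zeta x <= z -> v z <= x.
Proof.
move=> /andP[x0 x1] zx; apply: ge_sup; first by case: (above_sup z).
move=> x' [[/andP[x'0 x'1] zx']|->]; last exact: ltW.
rewrite leNgt; apply/negP => xx'.
by have := zeta_decreasing x0 xx' x'1; rewrite ltNge (le_trans zx (ltW zx')).
Qed.

Let v_nonincreasing z z' : z <= z' -> v z' <= v z.
Proof.
move=> zz'; apply: sup_le => //; last by case: (above_sup z').
  move=> x [[x01 z'x]|->]; apply/downP.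
    by exists x => //; left; split => //; exact: le_lt_trans z'x.
  by exists 0 => //; right.
Qed.

Let zetaK x : 0 < x < 1 -> v (zeta x) = x.
Proof.
move=> /andP[x0 x1]; apply/eqP; rewrite eq_le v_le ?x0//= leNgt; apply/negP => vx.
pose x' := Num.max ((v (zeta x) + x) / 2) (x / 2).
have x'0 : 0 < x' by rewrite lt_max; apply/orP; right; lra.
have x'x : x' < x by rewrite gt_max; apply/andP; split; lra.
have vx' : v (zeta x) < x' by rewrite lt_max; apply/orP; left; lra.
have : x' <= v (zeta x).
  by apply: v_ge; [rewrite x'0 (lt_trans x'x)|exact: zeta_decreasing].
by rewrite leNgt vx'.
Qed.

Let v_lt z m : v z < m -> m < 1 -> zeta m < z.
Proof.
move=> vm m1; have v0 := andP (v01 z).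
have m0 : 0 < m by case: v0 => v0 _; exact: le_lt_trans v0 vm.
pose m' := (v z + m) / 2.
have h1 : v z < m' by rewrite /m'; lra.
have h2 : m' < m by rewrite /m'; lra.
have h3 : 0 < m' by case: v0 => v0 _; rewrite /m'; lra.
apply: (@lt_le_trans _ _ (zeta m')); first exact: zeta_decreasing.
rewrite leNgt; apply/negP => zm'.
have : m' <= v z by apply: v_ge => //; rewrite h3 (lt_trans h2).
by rewrite leNgt h1.
Qed.

Let lt_v z m : m < v z -> 0 < m -> z < zeta m.
Proof.
move=> mv m0; rewrite ltNge; apply/negP => zm.
have : v z <= m.
  apply: v_le => //; rewrite m0/=; apply: lt_le_trans mv _; by case/andP: (v01 z).
by rewrite leNgt mv.
Qed.

Let Kzeta z : 0 < v z < 1 -> zeta (v z) = z.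
Proof.
move=> vz; have cz := zeta_cont vz; set m := v z in vz cz *.
have /andP[m0 m1] := vz.
apply/eqP; rewrite eq_le; apply/andP; split; rewrite leNgt; apply/negP => zm.
- move/cvgrPdist_lt : cz => /(_ (zeta m - z)); rewrite subr_gt0 => /(_ zm).
  move=> /nbhs_ballP[e /= e0 He].
  pose m' := Num.min (m + e / 2) ((m + 1) / 2).
  have mm' : m < m' by rewrite lt_min; apply/andP; split; lra.
  have m'1 : m' < 1 by rewrite gt_min; apply/orP; right; lra.
  have m'e : m' <= m + e / 2 by rewrite ge_min lexx.
  have := He m' ltac:(rewrite /ball/= ltr0_norm; lra).
  have := v_lt mm' m'1; move=> h1 /ltr_normlP[_]; lra.
- move/cvgrPdist_lt : cz => /(_ (z - zeta m)); rewrite subr_gt0 => /(_ zm).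
  move=> /nbhs_ballP[e /= e0 He].
  pose m' := Num.max (m - e / 2) (m / 2).
  have mm' : m' < m by rewrite gt_max; apply/andP; split; lra.
  have m'0 : 0 < m' by rewrite lt_max; apply/orP; right; lra.
  have m'e : m - e / 2 <= m' by rewrite le_max lexx.
  have := He m' ltac:(rewrite /ball/= gtr0_norm; lra).
  have := lt_v mm' m'0; move=> h1 /ltr_normlP[]; lra.
Qed.

Let vc : continuous v.
Proof.
move=> z; apply/cvgrPdist_lt => e e0.
have up : \forall t \near z, v t < v z + e.
  have [v1|v1] := leP 1 (v z).
    apply: (@nearW _ (nbhs z)) => t; have /andP[_ vt] := v01 t; lra.
  pose m := Num.min (v z + e / 2) ((v z + 1) / 2).
  have vm : v z < m by rewrite lt_min; apply/andP; split; lra.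
  have m1 : m < 1 by rewrite gt_min; apply/orP; right; lra.
  have me : m <= v z + e / 2 by rewrite ge_min lexx.
  have m0 : 0 < m by case/andP: (v01 z) => v0 _; exact: le_lt_trans v0 vm.
  have : \forall t \near z, zeta m < t by apply: lt_nbhsr; exact: v_lt.
  apply: filterS => t mt; have : v t <= m by apply: v_le; [rewrite m0|exact: ltW].
  lra.
have dn : \forall t \near z, v z - e < v t.
  have [v1|v1] := leP (v z) 0.
    apply: (@nearW _ (nbhs z)) => t; have /andP[vt _] := v01 t; lra.
  pose m := Num.max (v z - e / 2) (v z / 2).
  have vm : m < v z by rewrite gt_max; apply/andP; split; lra.
  have m0 : 0 < m by rewrite lt_max; apply/orP; right; lra.
  have me : v z - e / 2 <= m by rewrite le_max lexx.
  have m1 : m < 1 by case/andP: (v01 z) => _ v1'; exact: lt_le_trans vm v1'.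
  have : \forall t \near z, t < zeta m by apply: lt_nbhsl; exact: lt_v.
  apply: filterS => t mt; have : m <= v t by apply: v_ge => //; rewrite m0.
  lra.
move: up dn; apply: filterS2 => t h1 h2.
by rewrite ltr_norml; apply/andP; split; lra.
Qed.

Let v_pinfty : v z @[z --> +oo%R] --> (0 : R).
Proof.
apply/cvgrPdist_lt => e e0.
pose m := Num.min (e / 2) (1 / 2).
have m0 : 0 < m by rewrite lt_min; apply/andP; split; lra.
have m1 : m < 1 by rewrite gt_min; apply/orP; right; lra.
have me : m <= e / 2 by rewrite ge_min lexx.
exists (zeta m); split; first exact: num_real.
move=> z zm; have /andP[vz _] := v01 z; rewrite sub0r normrN ger0_norm//.
by have : v z <= m by [apply: v_le; [rewrite m0|exact: ltW]]; lra.
Qed.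

Let v_ninfty : v z @[z --> -oo%R] --> (1 : R).
Proof.
apply/cvgrPdist_lt => e e0.
pose m := Num.max (1 - e / 2) (1 / 2).
have m0 : 0 < m by rewrite lt_max; apply/orP; right; lra.
have m1 : m < 1 by rewrite gt_max; apply/andP; split; lra.
have me : 1 - e / 2 <= m by rewrite le_max lexx.
exists (zeta m); split; first exact: num_real.
move=> z zm; have /andP[_ vz] := v01 z; rewrite ger0_norm ?subr_ge0//.
have : m <= v z by apply: v_ge => //; rewrite m0.
lra.
Qed.

Let v_derive z : 0 < v z < 1 -> {for v z, continuous d} -> is_derive z 1 v (- (psi (v z))^-1).
Proof.
move=> vz cd; rewrite -invrN -{1}(Kzeta vz).
have near01 : \forall x \near v z, 0 < x < 1 by exact: near_itv.
have := zeta_derive vz cd => dz.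
apply: is_derive_inverse; last by rewrite oppr_eq0 gt_eqF// psi_gt0.
- by apply: (@filterS _ (nbhs (v z)) _ _ _ _ near01) => x; exact: zetaK.
- by apply: (@filterS _ (nbhs (v z)) _ _ _ _ near01) => x; exact: zeta_cont.
Qed.

Let near_regular z : ~ T (v z) -> \forall t \near z, 0 < v t < 1 /\ ~ T (v t).
Proof.
move=> Tz; have : \forall t \near z, (~` T) (v t).
  apply: (@vc z); apply: open_nbhs_nbhs; split => //.
  by apply: closed_openC; exact: compact_closed (finite_compact finT).
apply: filterS => t Tt; split => //; have /andP[v0 v1] := v01 t.
apply/andP; split; rewrite lt_neqAle.
  by rewrite v0 andbT; apply/eqP => E; apply: Tt; right; left.
by rewrite v1 andbT; apply/eqP => E; apply: Tt; right; right.
Qed.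

Let v_C1 : C1_on (~` (v @^-1` T)) v.
Proof.
move=> z Tz; have [vz _] := nbhs_singleton (near_regular Tz).
have near_d1 : \forall t \near z, derive1 v t = - (psi (v t))^-1.
  have := near_regular Tz; apply: filterS => t [vt Tt].
  by rewrite derive1E; have [_ ->] := v_derive vt (continuous_d vt Tt).
split; first by have [] := v_derive vz (continuous_d vz Tz).
have cp : {for z, continuous (fun t => - (psi (v t))^-1 : R)}.
  apply: continuous_at_opp; apply: (@continuous_comp _ _ _ (psi \o v) (fun u => u^-1 : R)).
    by apply: continuous_comp; [exact: vc|exact: psi_cont vz (continuous_d vz Tz)].
  by apply: inv_continuous; rewrite gt_eqF//=; exact: psi_gt0.
apply/cvgrPdist_lt => e e0; rewrite (nbhs_singleton near_d1).
move/cvgrPdist_lt : cp => /(_ e e0) cp.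
by move: near_d1 cp; apply: filterS2 => t ->.
Qed.

Let Phi z := - y (v z).

Let Phi_cont : continuous Phi.
Proof.
move=> z; apply: continuous_at_opp; apply: continuous_comp; [exact: vc|exact: yc].
Qed.

Let flux_at z : 0 < v z < 1 -> {for v z, continuous d} ->
  Phi z = d (v z) * `|derive1 v z| `^ (p - 2) * derive1 v z.
Proof.
move=> vz cd; rewrite derive1E; have [_ ->] := v_derive vz cd.
have psi0 := psi_gt0 vz.
have q0 : 0 < (psi (v z))^-1 by rewrite invr_gt0.
rewrite normrN gtr0_norm// mulrN -mulrA.
have -> : (psi (v z))^-1 `^ (p - 2) * (psi (v z))^-1 = (psi (v z))^-1 `^ (p - 1).
  have -> : p - 1 = (p - 2) + 1 by ring.
  rewrite (@powRD _ _ (p - 2) 1) ?powRr1 ?(ltW q0)//.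
  by rewrite (gt_eqF q0) implybT.
by rewrite psi_flux.
Qed.

(** If v is C1 across a level m then v' has a nonzero limit there, hence so has
    d = y / |v'|^(p-1): a discontinuity of d at m would be removable. *)
Let d_cont_of_C1 z : 0 < v z < 1 -> derivable v z 1 -> {for z, continuous (derive1 v)} ->
  {for v z, continuous d}.
Proof.
move=> vz _ c1; apply: contrapT => nd.
have Dm : disc d (v z) by split.
apply: (st_nrd H Dm).
set m := v z in vz nd Dm *.
have zm : zeta m = z by exact: Kzeta.
have czm := zeta_cont vz.
have near01 : \forall x \near m, 0 < x < 1 by exact: near_itv.
have fD : finite_set (T `\ m) by apply: finite_setD.
have nearT : \forall x \near m, (~` (T `\ m)) x.
  apply: open_nbhs_nbhs; split; last by move=> [_]; apply.
  by apply: closed_openC; exact: compact_closed (finite_compact fD).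
have reg : \forall x \near m, x != m ->
    [/\ 0 < x < 1, {for x, continuous d} & derive1 v (zeta x) = - (psi x)^-1].
  move: near01 nearT; apply: filterS2 => x x01 nT xm.
  have Tx : ~ T x by move=> Tx; apply: nT; split => //; exact/eqP.
  split => //; first exact: continuous_d.
  have vx : v (zeta x) = x := zetaK x01.
  have := @v_derive (zeta x); rewrite vx => /(_ x01 (continuous_d x01 Tx)).
  by rewrite derive1E => -[_ ->].
pose D x := `|derive1 v (zeta x)|.
have cD : {for m, continuous D}.
  apply: (@continuous_comp _ _ _ (fun x => derive1 v (zeta x)) (fun u => `|u| : R)).
    apply: (@continuous_comp _ _ _ zeta (derive1 v)); first exact: czm.
    by rewrite zm.
  exact: norm_continuous.
have /andP[m0 m1] := vz.
pose l := m / 2; pose u := (1 + m) / 2.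
have l0 : 0 < l by rewrite /l; lra.
have u1 : u < 1 by rewrite /u; lra.
have lmu : l < m < u by rewrite /l /u; apply/andP; split; lra.
have [M M0 HM] := psi_bound l0 u1.
have D0 : M^-1 <= D m.
  rewrite leNgt; apply/negP => DM.
  have H1 : \forall x \near m, D x < M^-1.
    move/cvgrPdist_lt : cD => /(_ (M^-1 - D m)); rewrite subr_gt0 => /(_ DM).
    by apply: filterS => x /ltr_normlP[+ _]; rewrite opprB ltrD2r.
  have : \forall x \near m, x != m -> False.
    move: H1 reg (near_itv lmu); apply: filterS3 => x Dx regx /andP[lx xu] xm.
    have [x01 _ E] := regx xm; move: Dx; rewrite /D E normrN.
    rewrite ger0_norm ?invr_ge0 ?(ltW (psi_gt0 x01))//.
    rewrite ltf_pV2 ?posrE ?psi_gt0// ltNge HM//.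
    by rewrite !ltW.
  move=> /nbhs_ballP[e /= e0 He].
  have := He (m + e / 2); rewrite /ball/= => /(_ _ _); apply.
    by rewrite opprD addNKr normrN gtr0_norm ?divr_gt0// ltr_pdivrMr// ltr_pMr// ltr1n.
  by rewrite gt_eqF// ltrDl divr_gt0.
have Dm0 : 0 < D m by apply: lt_le_trans D0; rewrite invr_gt0.
pose G x := y x * (D x `^ (p - 1))^-1.
have cG : {for m, continuous G}.
  apply: (continuous_at_mul (f := y)); first exact: yc.
  apply: (@continuous_comp _ _ _ (fun x => D x `^ (p - 1)) (fun u => u^-1 : R)).
    apply: (@continuous_comp _ _ _ D (fun u => u `^ (p - 1))); first exact: cD.
    exact: continuous_powR.
  by apply: inv_continuous; rewrite gt_eqF// powR_gt0.
apply/cvg_ex; exists (G m); apply/cvgrPdist_lt => e e0.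
have key : \forall x \near m, x != m -> `|G m - d x| < e.
  move/cvgrPdist_lt : cG => /(_ e e0) cG'.
  move: cG' reg; apply: filterS2 => x Gx regx xm.
  have [x01 _ E] := regx xm.
  suff -> : d x = G x by [].
  rewrite /G /D E normrN ger0_norm ?invr_ge0 ?(ltW (psi_gt0 x01))//.
  rewrite -(psi_flux x01) mulfK// gt_eqF// powR_gt0// invr_gt0.
  exact: psi_gt0.
exact: key.
Qed.

(** Where v reaches 0 or 1 it has an extremum, so its derivative vanishes. *)
Let flux_formula (I : interval R) : open [set` I] -> C1_on [set` I] v ->
  forall z, z \in I -> Phi z = d (v z) * `|derive1 v z| `^ (p - 2) * derive1 v z.
Proof.
move=> _ C1 z zI; have [dv c1] := C1 z zI.
have isd : is_derive z 1 v (derive1 v z) by split; [exact: dv|exact: esym (derive1E v z)].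
have [vz|vz] := pselect (0 < v z < 1).
  by apply: flux_at => //; exact: d_cont_of_C1.
suff [-> ->] : derive1 v z = 0 /\ Phi z = 0 by rewrite mulr0.
have /andP[v0 v1] := v01 z.
have [E|E] : v z = 0 \/ v z = 1.
  move: v0; rewrite le_eqVlt => /orP[/eqP<-|v0]; first by left.
  move: v1; rewrite le_eqVlt => /orP[/eqP->|v1]; first by right.
  by exfalso; apply: vz; rewrite v0.
- split; last by rewrite /Phi E y0 oppr0.
  by apply: (derive_at_min isd) => t; rewrite E; case/andP: (v01 t).
- split; last by rewrite /Phi E y1 oppr0.
  apply: oppr_inj; rewrite oppr0; apply: (derive_at_min (is_derive1_opp isd)) => t.
  by rewrite E lerN2; case/andP: (v01 t).
Qed.

Let B x := c * prim (on01 g) x - prim (on01 f) x.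

(** The times at which v crosses an exceptional level, and the two times, if any,
    at which it reaches 0 and leaves 1; elsewhere the balance can be
    differentiated. *)
Let balance_exceptions := zeta @` T `|` [set inf [set z | v z = 0]; sup [set z | v z = 1]].

Let finite_exceptions : finite_set balance_exceptions.
Proof. by rewrite /balance_exceptions !finite_setU; split => //; exact: finite_image. Qed.

Let locally_stuck z r : (r = 0 \/ r = 1) -> v z = r -> ~ balance_exceptions z ->
  \forall t \near z, v t = r.
Proof.
move=> [->|->] vz nE.
- pose A := [set z | v z = 0].
  have lbA : has_inf A.
    split; first by exists z.
    exists (zeta (1 / 2)) => t /= vt; rewrite leNgt; apply/negP => tz.
    have : 1 / 2 <= v t by apply: v_ge => //; apply/andP; split; lra.
    rewrite vt; lra.
  have infz : inf A < z.
    rewrite lt_neqAle; apply/andP; split; last by apply: ge_inf => //; case: lbA.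
    by apply/eqP => E; apply: nE; right; left.
  have [w Aw wz] := inf_adherent (eps := z - inf A) ltac:(by rewrite subr_gt0) lbA.
  have {}wz : w < z by move: wz; rewrite subrKC.
  have : \forall t \near z, w < t by exact: lt_nbhsr.
  apply: filterS => t wt; apply/eqP; rewrite eq_le.
  have /andP[-> _] := v01 t; rewrite andbT -Aw; exact: v_nonincreasing (ltW wt).
- pose A := [set z | v z = 1].
  have ubA : has_sup A.
    split; first by exists z.
    exists (zeta (1 / 2)) => t /= vt; rewrite leNgt; apply/negP => tz.
    have : v t <= 1 / 2 by apply: v_le; [apply/andP; split; lra|exact: ltW].
    rewrite vt; lra.
  have supz : z < sup A.
    rewrite lt_neqAle; apply/andP; split; last by apply: ub_le_sup => //; case: ubA.
    by apply/eqP => E; apply: nE; right; right.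
  have [w Aw wz] := sup_adherent (eps := sup A - z) ltac:(by rewrite subr_gt0) ubA.
  have {}wz : z < w by move: wz; rewrite subKr.
  have : \forall t \near z, t < w by exact: lt_nbhsl.
  apply: filterS => t wt; apply/eqP; rewrite eq_le.
  have /andP[_ ->] := v01 t; rewrite /= -Aw; exact: v_nonincreasing (ltW wt).
Qed.

Let balance_le z1 z2 : z1 <= z2 -> Phi z2 - Phi z1
  + oint (v z1) (v z2) (fun x => c * g x - f x) + oint z1 z2 (fun z => h (v z)) = 0.
Proof.
move=> z12; have [Q [cQ QE dQ _]] := reaction_window H vc v01 (z1 - 1) (z2 + 1).
rewrite QE ?(oint_speed H)//; last 2 first.
  by apply/andP; split; lra.
  by apply/andP; split; lra.
suff : Phi z2 + B (v z2) + Q z2 = Phi z1 + B (v z1) + Q z1 by rewrite /B; lra.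
pose W t := Phi t + B (v t) + Q t.
apply: (@constant_off _ W balance_exceptions _ _ finite_exceptions z12) => [t _|t /andP[t1 t2] nE].
  apply: continuous_at_add; last exact: cQ.
  apply: continuous_at_add; first exact: Phi_cont.
  by apply: (@continuous_comp _ _ _ v B); [exact: vc|exact: (continuous_drift H)].
have tI : z1 - 1 < t < z2 + 1 by apply/andP; split; lra.
have [vt|vt] := pselect (0 < v t < 1).
  have Tt : ~ T (v t) by move=> Tt; apply: nE; left; exists (v t) => //; exact: Kzeta.
  have [_ _ ch cd] := continuous_outside vt Tt.
  have dv := v_derive vt cd.
  have dQt := dQ t tI ltac:(by apply: continuous_comp; [exact: vc|]).
  have dy : is_derive (v t) 1 y
      (c * on01 g (v t) - on01 f (v t) - on01 (kappa p d h) (v t) * y (v t) `^ (- a)).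
    by case: yP => _ _ _; apply.
  have dPhi := is_derive1_opp (is_derive1_fun_comp dy dv).
  have dBv := is_derive1_fun_comp (is_derive_drift H c Tt) dv.
  have dW := is_derive1_add (is_derive1_add dPhi dBv) dQt.
  apply: (is_derive_eq (f := W) dW).
  rewrite !on01_in// /psi /kappa -/a powRN.
  have dn : d (v t) `^ a != 0 by rewrite gt_eqF// powR_gt0// (d_gt0 H).
  have yn : y (v t) `^ a != 0 by rewrite gt_eqF// powR_gt0// ypos.
  by field; rewrite dn yn.
have [r [r01 vr]] : exists r, (r = 0 \/ r = 1) /\ v t = r.
  have /andP[v0 v1] := v01 t; exists (v t); split => //.
  move: v0; rewrite le_eqVlt => /orP[/eqP<-|v0]; first by left.
  move: v1; rewrite le_eqVlt => /orP[/eqP->|v1]; first by right.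
  by exfalso; apply: vt; rewrite v0.
have stuck := locally_stuck r01 vr nE.
have hr : h r = 0 by case: r01 => ->; [exact: (st_h01 H).1|exact: (st_h01 H).2].
have ch : {for t, continuous (fun z => h (v z))}.
  apply/cvgrPdist_lt => e e0; apply: filterS stuck => s ->.
  by rewrite vr subrr normr0.
have := dQ t tI ch; rewrite vr hr => dQt.
apply: (near_eq_is_derive (f := fun s => (- y r + B r) + Q s : R)).
  by apply: filterS stuck => s sE; rewrite /W /Phi sE.
by have := is_derive1_add (is_derive1_const (- y r + B r) t) dQt; rewrite addr0.
Qed.

Let balance z1 z2 : Phi z2 - Phi z1
  + oint (v z1) (v z2) (fun x => c * g x - f x) + oint z1 z2 (fun z => h (v z)) = 0.
Proof.
have [z12|/ltW z21] := leP z1 z2; first exact: balance_le.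
have [Q [cQ QE dQ _]] := reaction_window H vc v01 z2 z1.
have := balance_le z21.
rewrite !QE ?(oint_speed H) ?lexx ?z21//; lra.
Qed.

Lemma solution_of_front_profile : exists v, solution p f g h d c v.
Proof.
exists v; split => //; exists Phi; split => //.
- split.
    have -> : (0 : R) = - y 1 by rewrite y1 oppr0.
    by apply: cvgN; apply: (@cvg_comp _ _ _ v y) v_ninfty (@yc 1).
  have -> : (0 : R) = - y 0 by rewrite y0 oppr0.
  by apply: cvgN; apply: (@cvg_comp _ _ _ v y) v_pinfty (@yc 0).
- by move=> z [E|E]; rewrite /Phi E ?y0 ?y1 oppr0.
Qed.

End FromProfile.

(** * The set of speeds *)

Section Speeds.
Variables (R : realType) (p : R) (f g h d : R -> R).
Hypothesis H : standing p f g h d.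
Notation T := (Theta_star f g h d).
Notation mu := (@lebesgue_measure R).
Notation profile := (front_profile p (on01 f) (on01 g) (on01 (kappa p d h)) T).

Let p1 : 1 < p := st_p H.

Let cf x : ~ T x -> {for x, continuous (on01 f)}.
Proof. by move=> Tx; apply: (continuous_on01 Tx) => x01; have [] := continuous_outside x01 Tx. Qed.

Let cg x : ~ T x -> {for x, continuous (on01 g)}.
Proof. by move=> Tx; apply: (continuous_on01 Tx) => x01; have [] := continuous_outside x01 Tx. Qed.

Let ck x : ~ T x -> {for x, continuous (on01 (kappa p d h))}.
Proof. by move=> Tx; apply: (continuous_on01 Tx) => x01; exact: (continuous_kappa H x01 Tx). Qed.

Let out x : x < 0 \/ 1 < x ->
  [/\ on01 f x = 0, on01 g x = 0 & on01 (kappa p d h) x = 0].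
Proof.
move=> xo; have nx : ~ (0 < x < 1).
  move=> /andP[h1 h2].
  by case: xo => h3; [have := lt_trans h1 h3|have := lt_trans h2 h3]; rewrite ltxx.
by rewrite !on01_out.
Qed.

Lemma speedsP c : speeds p f g h d c <-> exists y, profile c y /\ y 0 = 0.
Proof.
split.
  by move=> [u [v [sv _]]]; exact: solution_front_profile H sv.
move=> [y [yP y0]]; have [v sv] := solution_of_front_profile H yP y0.
by exists (fun x t => v (x - c * t)); exists v.
Qed.

Lemma profile_exists c : exists y, profile c y /\ 0 <= y 0.
Proof.
have [C [fC gC _]] := bounds H.
exact: (front_profile_exists p1 (finite_Theta_star H) (integrable_on01 (st_fb H) fC)
  (integrable_on01 (st_gb H) gC) (integrable_kappa H) cf cg ck fC gC (kappa_ge0 H) out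
  (kappa_low H)).
Qed.

Lemma profile_compare c c0 y y0 : profile c y -> profile c0 y0 -> y0 0 = 0 ->
  ~ (forall x, 0 <= x <= 1 ->
     0 < y 0 + (c - c0) * (prim (on01 g) x - prim (on01 g) 0)).
Proof.
have [C [fC gC _]] := bounds H.
exact: (front_profile_compare p1 (finite_Theta_star H)
  (integrable_on01 (st_gb H) gC) cg (kappa_ge0 H)).
Qed.

Lemma mean_g_bound : exists2 C, 0 < C & forall x, 0 <= x <= 1 ->
  `|prim (on01 g) x - prim (on01 g) 0| <= C * x.
Proof.
have [C [_ gC _]] := bounds H.
have C0 : 0 <= C := le_trans (normr_ge0 _) (gC 0).
exists (C + 1); first by rewrite ltr_wpDl.
move=> x /andP[x0 x1].
have ig := integrable_on01 (st_gb H) gC.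
rewrite primB//; apply: le_trans (le_normr_Rintegral _ _) _ => //.
  exact: integrable_sub ig.
apply: (@le_trans _ _ (\int[mu]_(t in `]0, x]) (cst C t))).
  apply: le_Rintegral => //.
  - by apply: integrable_norm => //; exact: integrable_sub ig.
  - apply: (@integrable_sub _ _ _ `[0, x]) => //.
      by apply: subset_itvr; rewrite bnd_simp.
    apply: (@integrable_bounded _ _ _ _ C) => //.
    by move=> t _; rewrite ger0_norm.
rewrite Rintegral_cst//= lebesgue_measure_itv/= lte_fin.
case: ifPn => [x00|_]; last by rewrite mulr0 mulr_ge0// addr_ge0.
by rewrite oppr0 adde0 /= ler_wpM2r// lerDl.
Qed.

Lemma inf_avg_le c x : 0 < x < 1 -> (inf_avg f g c <=
  (x^-1 * (c * (prim (on01 g) x - prim (on01 g) 0) - (prim (on01 f) x - prim (on01 f) 0)))%:E)%E.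
Proof.
move=> x01; apply: ereal_inf_lbound; exists x; first by rewrite /= in_itv.
case/andP: x01 => x0 x1; rewrite (oint_speed H) ?lexx ?ler01 ?(ltW x0) ?(ltW x1)//.
by congr ((_ * _)%:E); ring.
Qed.

Lemma inf_avg_ge c A : (forall x, 0 < x < 1 -> A * x <=
   c * (prim (on01 g) x - prim (on01 g) 0) - (prim (on01 f) x - prim (on01 f) 0)) ->
  (A%:E <= inf_avg f g c)%E.
Proof.
move=> HA; apply: le_ereal_inf_tmp => z [x /=]; rewrite in_itv/= => x01 <-.
have /andP[x0 x1] := x01.
rewrite (oint_speed H) ?lexx ?ler01 ?(ltW x0) ?(ltW x1)// lee_fin ler_pdivlMl//.
have := HA x x01; lra.
Qed.

(** A strict inequality between the two sides forces both to be finite, which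
    gives an arithmetic form of it in R. *)
Lemma threshold_fin c : (threshold p d h < inf_avg f g c)%E -> exists M A : R,
  [/\ 0 <= M, sup_avg p d h = M%:E, inf_avg f g c = A%:E
    & conj_exp p * (p - 1) `^ p^-1 * M `^ (conj_exp p)^-1 < A].
Proof.
move=> thc; have p'0 := conj_exp_gt0 p1.
have p'V0 : (conj_exp p)^-1 != 0 by rewrite invr_neq0// gt_eqF.
have K0 : 0 < conj_exp p * (p - 1) `^ p^-1 by rewrite mulr_gt0// powR_gt0// subr_gt0.
have half : 0 < (1 / 2 : R) < 1 by apply/andP; split; lra.
have S0 : (0 <= sup_avg p d h)%E.
  apply: (@le_trans _ _ ((1 / 2)^-1%:E * \int[mu]_(t in `]0%R, (1 / 2 : R)%R[)
    (kappa p d h t / t `^ (p - 1)^-1)%:E)%E); last first.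
    by apply: ereal_sup_ubound; exists (1 / 2) => //; rewrite /= in_itv.
  apply: mule_ge0; first by rewrite lee_fin invr_ge0; case/andP: half => /ltW.
  apply: integral_ge0 => t /=; rewrite in_itv/= => /andP[t0 t1].
  rewrite lee_fin divr_ge0 ?powR_ge0//.
  have t01 : 0 < t < 1 by rewrite t0/=; lra.
  by have := kappa_ge0 H t; rewrite on01_in.
move: thc (inf_avg_le c half); rewrite /threshold.
case: (sup_avg p d h) S0 => [M||]//.
- rewrite lee_fin => M0; rewrite poweR_EFin -EFinM.
  case: (inf_avg f g c) => [A||]//.
  by rewrite lte_fin => HA _; exists M, A.
- move=> _; rewrite poweRyr// gt0_muley ?lte_fin//.
  by rewrite ltNge leey.
Qed.

(** The slope beta of the barrier is the one at which the threshold constant is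
    attained; for M = 0 that point degenerates and the slope A itself will do. *)
Lemma speed_above_threshold c : (threshold p d h < inf_avg f g c)%E -> speeds p f g h d c.
Proof.
move=> /threshold_fin[M [A [M0 SM IA MA]]].
have [y [yP y0]] := profile_exists c.
apply/speedsP; exists y; split => //.
have [C [fC gC _]] := bounds H.
have [beta b0 bA] : exists2 b : R, 0 < b & b + M * b `^ (- (p - 1)^-1) <= A.
  move: M0; rewrite le_eqVlt => /orP[/eqP M0|M0].
    exists A; last by rewrite -M0 mul0r addr0.
    apply: le_lt_trans MA; rewrite mulr_ge0 ?powR_ge0//.
    by rewrite mulr_ge0 ?powR_ge0// ltW// conj_exp_gt0.
  have [b b0 bE] := threshold_attained p1 M0.
  by exists b => //; rewrite bE ltW.
apply: (front_profile_starts_at0 p1 (finite_Theta_star H) (integrable_on01 (st_fb H) fC)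
  (integrable_on01 (st_gb H) gC) cf cg ck (kappa_ge0 H) yP y0 b0 bA).
- move=> x x01; have := inf_avg_le c x01; rewrite IA lee_fin.
  by case/andP: x01 => x0 _; rewrite ler_pdivlMl// mulrC.
- move=> x x01; have /andP[x0 x1] := x01.
  have sub : `]0, x[ `<=` `]0, 1[ by apply: subset_itvl; rewrite bnd_simp ltW.
  have nE s : `]0, x[%classic s ->
      kappa p d h s / s `^ (p - 1)^-1 = on01 (kappa p d h) s * s `^ (- (p - 1)^-1).
    by move=> /sub /=; rewrite in_itv/= => s01; rewrite on01_in// powRN.
  have n0 s : 0 <= on01 (kappa p d h) s * s `^ (- (p - 1)^-1).
    by rewrite mulr_ge0 ?powR_ge0// (kappa_ge0 H).
  have mn : measurable_fun `]0, x[ (fun s => on01 (kappa p d h) s * s `^ (- (p - 1)^-1)).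
    apply: measurable_funM.
      have /integrableP[/measurable_EFinP mk _] := integrable_kappa H.
      exact: measurable_funS mk.
    exact: measurable_funS (@measurable_powR R (- (p - 1)^-1)).
  have le : (\int[mu]_(s in `]0%R, x[) (on01 (kappa p d h) s * s `^ (- (p - 1)^-1))%:E
      <= (M * x)%:E)%E.
    have : (x^-1%:E * \int[mu]_(t in `]0%R, x[) (kappa p d h t / t `^ (p - 1)^-1)%:E
        <= M%:E)%E.
      by rewrite -SM; apply: ereal_sup_ubound; exists x.
    rewrite lee_pdivrMl// -EFinM [x * M]mulrC; apply: le_trans.
    rewrite le_eqVlt; apply/orP; left; apply/eqP; apply: eq_integral => s.
    by rewrite inE => sI; rewrite nE.
  split.
    apply/integrableP; split; first exact/measurable_EFinP.
    apply: le_lt_trans (ltry (M * x)); apply: le_trans le.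
    rewrite le_eqVlt; apply/orP; left; apply/eqP; apply: eq_integral => s _.
    by rewrite /= ger0_norm.
  rewrite -lee_fin /Rintegral fineK//.
  rewrite ge0_fin_numE; first exact: le_lt_trans le (ltry _).
  by apply: integral_ge0 => s _; rewrite lee_fin.
Qed.

Lemma at_right0_near (P : R -> Prop) : (\forall x \near 0^'+, P x) ->
  exists2 delta : R, 0 < delta & forall x, 0 < x < delta -> P x.
Proof.
move=> /nbhs_ballP[e /= e0 He]; exists e => // x /andP[x0 xe]; apply: He => //.
by rewrite /ball/= sub0r normrN gtr0_norm.
Qed.

Lemma speed_lower_bound c l : speeds p f g h d c -> 0 <= l ->
  (\forall x \near 0^'+, l <= kappa p d h x `^ (p - 1) / x) ->
  conj_exp p * (p - 1) `^ p^-1 * l `^ p^-1 <= c * g 0 - f 0.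
Proof.
move=> /speedsP[y [yP y0]] l0 Hl; apply/ler_addgt0Pr => e e0.
have [_ f0 _] := st_f H; have [_ g0 _] := st_g H.
have Hq : \forall x \near 0^'+, c * g x - f x <= c * g 0 - f 0 + e.
  have cv : (c * g x - f x) @[x --> 0^'+] --> (c * g 0 - f 0).
    by apply: cvgB => //; apply: cvgM => //; exact: cvg_cst.
  move/cvgrPdist_lt : cv => /(_ e e0); apply: filterS => x /ltr_normlP[]; lra.
have : \forall x \near 0^'+,
    l <= kappa p d h x `^ (p - 1) / x /\ c * g x - f x <= c * g 0 - f 0 + e.
  by move: Hl Hq; apply: filterS2.
move=> /at_right0_near[delta d0 Hd].
pose delta' := Num.min delta (1 / 2).
have d'0 : 0 < delta' by rewrite lt_min d0; lra.
have d'1 : delta' < 1 by rewrite gt_min; apply/orP; right; lra.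
apply: (front_profile_speed_bound p1 (finite_Theta_star H) (kappa_ge0 H) yP y0 l0 d'0 d'1).
move=> x /andP[x0 xd'] _; have xd : x < delta by apply: lt_le_trans xd' _; rewrite ge_min lexx.
have x01 : 0 < x < 1 by rewrite x0 (lt_trans xd').
have [h1 h2] := Hd x ltac:(by rewrite x0).
by rewrite !on01_in//; split => //; rewrite -ler_pdivlMr.
Qed.

(** If the bound failed, ell would exceed l0 = (q / K) `^ p, so that some l > l0
    would bound kappa^(p-1) / x from below near 0, against the lower bound for
    the real number l. *)
Lemma speed_ell c : speeds p f g h d c ->
  ((conj_exp p * (p - 1) `^ p^-1)%:E * ell p d h `^ p^-1 <= (c * g 0 - f 0)%:E)%E.
Proof.
move=> sc; have p0 : 0 < p by exact: lt_trans ltr01 p1.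
set K := conj_exp p * (p - 1) `^ p^-1; set q := c * g 0 - f 0.
have K0 : 0 < K by rewrite mulr_gt0 ?conj_exp_gt0// powR_gt0// subr_gt0.
have pV0 : 0 < p^-1 by rewrite invr_gt0.
have F0 : \forall x \near 0^'+, 0 <= kappa p d h x `^ (p - 1) / x.
  by near=> x; rewrite divr_ge0 ?powR_ge0.
have q0 : 0 <= q.
  by have := speed_lower_bound sc (lexx 0) F0; rewrite powR0 ?mulr0// gt_eqF.
have qK : 0 <= q / K by rewrite divr_ge0// ltW.
pose l0 := (q / K) `^ p.
have l0K : l0 `^ p^-1 = q / K by rewrite /l0 -powRrM mulfV ?gt_eqF// powRr1.
have ell_le : (ell p d h <= l0%:E)%E.
  rewrite leNgt; apply/negP => l0e.
  have [V [V0 HV]] : exists V : set R, (0^'+ : set_system R) V /\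
      (l0%:E < ereal_inf ((fun x => (kappa p d h x `^ (p - 1) / x)%:E) @` V))%E.
    move: l0e; rewrite /ell limf_einfE => /ereal_sup_gt[_ [V V0 <-] HV].
    by exists V.
  have [l [l0l HVl]] : exists l : R, l0 < l /\ forall x, V x -> l <= kappa p d h x `^ (p - 1) / x.
    have lb x : V x -> (ereal_inf ((fun x => (kappa p d h x `^ (p - 1) / x)%:E) @` V)
        <= (kappa p d h x `^ (p - 1) / x)%:E)%E.
      by move=> Vx; apply: ereal_inf_lbound; exists x.
    move: HV lb; case: (ereal_inf _) => [r||]//.
      by rewrite lte_fin => rl lb; exists r; split => // x /lb; rewrite lee_fin.
    by move=> _ lb; exists (l0 + 1); split; [rewrite ltrDl|move=> x /lb].
  have l00 : 0 <= l by apply: le_trans (powR_ge0 _ _) (ltW l0l).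
  have := speed_lower_bound sc l00 (filterS HVl V0).
  rewrite -/K -/q mulrC -ler_pdivlMr// -l0K => le_l.
  have : l0 `^ p^-1 < l `^ p^-1 by apply: gt0_ltr_powR; rewrite ?nnegrE ?powR_ge0.
  by rewrite ltNge le_l.
have elK : (ell p d h `^ p^-1 <= (q / K)%:E)%E.
  rewrite -l0K -poweR_EFin.
  have e0 : (0 <= ell p d h)%E.
    rewrite /ell limf_einfE.
    apply: (@le_trans _ _
        (ereal_inf ((fun x => (kappa p d h x `^ (p - 1) / x)%:E) @` [set x | 0 < x]))).
      apply: le_ereal_inf_tmp => _ [x /= x0 <-].
      by rewrite lee_fin divr_ge0 ?powR_ge0// ltW.
    by apply: ereal_sup_ubound; exists [set x | 0 < x] => //; exact: nbhs_right_gt.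
  by apply: gt0_ler_poweR; rewrite ?in_itv/= ?leey ?e0 ?(ltW pV0) ?lee_fin ?powR_ge0.
apply: (@le_trans _ _ (K%:E * (q / K)%:E)%E); first by rewrite lee_pmul2l// lte_fin.
by rewrite -EFinM mulrCA mulfV ?mulr1// gt_eqF.
Unshelve. all: by end_near. Qed.

Hypothesis g0_gt0 : 0 < g 0.

Lemma speeds_bounded_below : lbound (speeds p f g h d) (f 0 / g 0).
Proof.
move=> c sc; rewrite ler_pdivrMr// -subr_ge0.
have F0 : \forall x \near 0^'+, 0 <= kappa p d h x `^ (p - 1) / x.
  by near=> x; rewrite divr_ge0 ?powR_ge0.
have p0 : 0 < p by exact: lt_trans ltr01 p1.
have := speed_lower_bound sc (lexx 0) F0.
by rewrite powR0 ?mulr0// invr_neq0// gt_eqF.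
Unshelve. all: by end_near. Qed.

Hypothesis nonempty : speeds p f g h d !=set0.

Let cstar := inf (speeds p f g h d).

Let hinf : has_inf (speeds p f g h d).
Proof. by split => //; exists (f 0 / g 0); exact: speeds_bounded_below. Qed.

Lemma min_speed_lbound : lbound (speeds p f g h d) cstar.
Proof. by move=> c sc; apply: ge_inf => //; case: hinf. Qed.

(** If the profile at the infimum started from a positive value, it would by
    comparison exclude all speeds close to the infimum. *)
Lemma min_speed_attained : speeds p f g h d cstar.
Proof.
have [y [yP y0]] := profile_exists cstar.
apply/speedsP; exists y; split => //; apply/eqP; rewrite eq_le y0 andbT leNgt; apply/negP => L0.
have [C C0 HC] := mean_g_bound.
have e0 : 0 < y 0 / (2 * C) by rewrite divr_gt0// mulr_gt0.
have [c0 sc0 c0e] := inf_adherent e0 hinf.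
have c0c := min_speed_lbound sc0.
have /speedsP[y1 [y1P y10]] := sc0.
apply: (profile_compare yP y1P y10) => x x01.
have /andP[x0 x1] := x01.
have cc : c0 - cstar < y 0 / (2 * C) by rewrite ltrBlDl.
have A : `|(cstar - c0) * (prim (on01 g) x - prim (on01 g) 0)| <= y 0 / (2 * C) * C.
  rewrite normrM ler0_norm ?subr_le0// opprB; apply: ler_pM; rewrite ?subr_ge0 ?(ltW cc)//.
  by apply: le_trans (HC x x01) _; rewrite ger_pMr.
have E : y 0 / (2 * C) * C = y 0 / 2 by field; rewrite gt_eqF.
move: A; rewrite E ler_norml => /andP[A _].
by move: A L0; set w := (cstar - c0) * _; set w0 := y 0; lra.
Qed.

(** The average of c g - f depends on c in a Lipschitz way, uniformly in x, so a
    strict inequality at c would persist for slightly smaller speeds. *)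
Lemma min_speed_le_threshold : (inf_avg f g cstar <= threshold p d h)%E.
Proof.
rewrite leNgt; apply/negP => thc.
have [M [A [M0 SM IA MA]]] := threshold_fin thc.
have [C C0 HC] := mean_g_bound.
set th := _ * M `^ _ in MA.
have thE : threshold p d h = th%:E by rewrite /threshold SM poweR_EFin -EFinM.
pose e := (A - th) / (2 * C).
have e0 : 0 < e by rewrite divr_gt0 ?mulr_gt0// subr_gt0.
have eC : e * C = (A - th) / 2 by rewrite /e; field; rewrite gt_eqF.
have : speeds p f g h d (cstar - e).
  apply: speed_above_threshold; rewrite thE.
  apply: (@lt_le_trans _ _ (A - e * C)%:E); first by rewrite lte_fin eC; lra.
  apply: inf_avg_ge => x x01; have /andP[x0 x1] := x01.
  have x01' : 0 <= x <= 1 by rewrite !ltW.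
  have := inf_avg_le cstar x01; rewrite IA lee_fin ler_pdivlMl// mulrC => h1.
  have := HC x x01'; rewrite ler_norml => /andP[_ h2].
  have h3 : e * (prim (on01 g) x - prim (on01 g) 0) <= e * (C * x) by rewrite ler_pM2l.
  rewrite mulrBl [_ * C * x]mulrAC [X in _ <= X - _]mulrBl.
  move: h1 h3; rewrite mulrA [e * C * x]mulrAC.
  by move: (prim (on01 g) x - prim (on01 g) 0) (prim (on01 f) x - prim (on01 f) 0) => G F; lra.
by move=> /min_speed_lbound; rewrite lerBrDl gerDr leNgt e0.
Qed.

(** Under the sign condition on the primitive of g, the comparison term
    (c - c0) * prim g is nonnegative for every c above the minimum c0. *)
Lemma speeds_upward : (forall x, 0 <= x <= 1 -> 0 <= oint 0 x g) ->
  speeds p f g h d = [set c | cstar <= c].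
Proof.
move=> Hg; apply/seteqP; split => [c|c /= cc]; first exact: min_speed_lbound.
have /speedsP[y0 [y0P y00]] := min_speed_attained.
have [y [yP y0']] := profile_exists c.
apply/speedsP; exists y; split => //; apply/eqP; rewrite eq_le y0' andbT leNgt; apply/negP => L0.
apply: (profile_compare yP y0P y00) => x x01.
have [C [fC gC _]] := bounds H.
rewrite ltr_wpDr// mulr_ge0 ?subr_ge0//.
have := Hg x x01; rewrite (@oint_primE _ (on01 g)) ?subr_ge0//.
  exact: (integrable_on01 (st_gb H) gC).
have /andP[x0 x1] := x01.
move=> t; rewrite min_l// max_r// => /andP[t0 tx].
by rewrite on01_in// t0 (lt_le_trans tx).
Qed.

End Speeds.

Theorem theorem20 (R : realType) (p : R) (f g h d : R -> R)
  (p_gt1 : 1 < p)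
  (H1f : hatC_closed f) (H1g : hatC_closed g) (H1h : hatC_closed h)
  (H1d : hatC_open d)
  (H1f_bdd : Linfty01 f) (H1g_bdd : Linfty01 g) (H1h_bdd : Linfty01 h)
  (nrf : no_removable f) (nrg : no_removable g) (nrh : no_removable h)
  (nrd : no_removable d)
  (H2 : forall a b : R, 0 < a -> a < b -> b < 1 ->
    (0 < ereal_inf [set (d x)%:E | x in `[a, b]])%E /\
    (ereal_sup [set (d x)%:E | x in `[a, b]] < +oo)%E)
  (H3_ends : h 0 = 0 /\ h 1 = 0)
  (H3_pos : forall a b : R, 0 < a -> a < b -> b < 1 ->
    (0 < ereal_inf [set (h x)%:E | x in `[a, b]])%E)
  (H4 : (@lebesgue_measure R).-integrable `]0, 1[ (EFin \o kappa p d h))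
  (g0_gt0 : 0 < g 0)
  (Ell_fin : (Ell p d h < +oo)%E)
  (hc : exists c : R, (threshold p d h < inf_avg f g c)%E) :
  (speeds p f g h d !=set0 /\ has_lbound (speeds p f g h d)) /\
  exists cstar : R,
    [/\ speeds p f g h d cstar /\ lbound (speeds p f g h d) cstar,
        (inf_avg f g cstar <= threshold p d h)%E,
        ((conj_exp p * (p - 1) `^ p^-1)%:E * ell p d h `^ p^-1
          <= (cstar * g 0 - f 0)%:E)%E
      & (forall x : R, 0 <= x <= 1 -> 0 <= oint 0 x g) ->
        speeds p f g h d = [set c : R | cstar <= c]].
Proof.
have H : standing p f g h d by split.
have ne : speeds p f g h d !=set0.
  by case: hc => c /(speed_above_threshold H) sc; exists c.
split.
  by split => //; exists (f 0 / g 0); exact: (speeds_bounded_below H g0_gt0).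
exists (inf (speeds p f g h d)); split.
- by split; [exact: (min_speed_attained H g0_gt0 ne)|exact: (min_speed_lbound H g0_gt0 ne)].
- exact: (min_speed_le_threshold H g0_gt0 ne).
- exact: speed_ell H _ (min_speed_attained H g0_gt0 ne).
- exact: (speeds_upward H g0_gt0 ne).
Qed.
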